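(* Let $X$ be a compact, connected, orientable $3$-manifold with boundary. Then any of the three spaces $\mathscr R_{R>0,H>0}$, $\mathscr R_{R>0,H\ge 0}$, $\mathscr R_{R>0,H=0}$, when not empty, is an absolute neighborhood retract.
   Context: All manifolds and their boundaries are smooth and all metrics are smooth Riemannian metrics. $\mathscr R$ denotes the space of smooth Riemannian metrics on $X$ with the $C^\infty$ topology (a metrizable space), and subsets carry the subspace topology. For $g\in\mathscr R$, $R_g$ is the scalar curvature and $H_g:\partial X\to\mathbb R$ is the mean curvature of the boundary, with the convention that the boundary of the unit ball in $\mathbb R^3$ has mean curvature $2$. $\mathscr R_{R>0,H>0}$ (resp. $\mathscr R_{R>0,H\ge0}$, $\mathscr R_{R>0,H=0}$) is the set of $g\in\mathscr R$ with $R_g>0$ on $X$ and $H_g>0$ (resp. $H_g\ge 0$, $H_g=0$) on $\partial X$. A metrizable space $Z$ is an absolute neighborhood retract (ANR) if, whenever $Z$ is embedded as a closed subset of a metrizable space $Y$, there is an open set $U\subset Y$ containing $Z$ and a continuous map $r:U\to Z$ with $r|_Z=\mathrm{id}$. *)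

(* Defs.v *)
From HB Require Import structures.
From mathcomp Require Import all_boot all_order all_algebra.
From mathcomp Require Import all_classical all_reals all_analysis.

Set Implicit Arguments.
Unset Strict Implicit.
Unset Printing Implicit Defensive.

Import Order.TTheory GRing.Theory Num.Theory.
Import numFieldNormedType.Exports.

Local Open Scope classical_set_scope.
Local Open Scope ring_scope.

(** * Calculus on the half-space [x_0 >= 0] of R^3 *)

Section HalfSpaceCalculus.
Variable R : realType.

Definition half_space : set 'rV[R]_3 := [set x | 0 <= x ord0 ord0].

Definition basis_vec (i : 'I_3) : 'rV[R]_3 := delta_mx ord0 i.

Definition iter_derive (s : seq 'I_3) (F : 'rV[R]_3 -> R) : 'rV[R]_3 -> R :=
  foldr (fun i G => 'D_(basis_vec i) G) F s.

Definition smooth_open (V : set 'rV[R]_3) (F : 'rV[R]_3 -> R) : Prop :=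
  forall (s : seq 'I_3) x, V x ->
    {for x, continuous (iter_derive s F)} /\
    (forall i, derivable (iter_derive s F) x (basis_vec i)).

(* Smoothness on an arbitrary subset, in particular on relatively open subsets
   of the half-space: near every point, [f] extends to a smooth function on an
   open subset of R^3. *)
Definition smooth_on (A : set 'rV[R]_3) (f : 'rV[R]_3 -> R) : Prop :=
  forall x, A x -> exists (V : set 'rV[R]_3) (F : 'rV[R]_3 -> R),
    [/\ open V, V x, smooth_open V F & {in V `&` A, F =1 f}].

(* Partial derivative relative to the half-space: the increments [h] are
   restricted to those for which [x + h e_i] stays in the half-space.  This is
   the usual derivative in the interior, and the one-sided derivative for
   [i = 0] at a point of the boundary plane; at every point it is the partial
   derivative of any local smooth extension. *)
Definition pderiv (i : 'I_3) (f : 'rV[R]_3 -> R) (x : 'rV[R]_3) : R :=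
  lim ((fun h : R => (f (x + h *: basis_vec i) - f x) / h)
         @ within [set h | half_space (x + h *: basis_vec i)] (0 : R)^').

Definition iter_pderiv (s : seq 'I_3) (f : 'rV[R]_3 -> R) : 'rV[R]_3 -> R :=
  foldr pderiv f s.

(* [jacobian f x i j] is the [i]-th partial derivative of the [j]-th component
   of [f]; this is the transpose of the usual layout. *)
Definition jacobian (f : 'rV[R]_3 -> 'rV[R]_3) (x : 'rV[R]_3) : 'M[R]_3 :=
  \matrix_(i, j) pderiv i (fun y => f y ord0 j) x.

End HalfSpaceCalculus.

(** * Smooth 3-manifolds with (possibly empty) boundary *)

(* A homeomorphism [cmap] from the open set [cdom] onto the relatively open
   subset [cimg] of the half-space, with inverse [cinv]; the values of [cmap]
   and [cinv] outside [cdom] and [cimg] are irrelevant. *)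
Record chart (R : realType) (X : topologicalType) := Chart {
  cdom : set X;
  cimg : set 'rV[R]_3;
  cmap : X -> 'rV[R]_3;
  cinv : 'rV[R]_3 -> X;
  cdom_open : open cdom;
  cimg_open : exists2 W : set 'rV[R]_3, open W & cimg = W `&` @half_space R;
  cmap_fun : forall p, cdom p -> cimg (cmap p);
  cinv_fun : forall x, cimg x -> cdom (cinv x);
  cmapK : forall p, cdom p -> cinv (cmap p) = p;
  cinvK : forall x, cimg x -> cmap (cinv x) = x;
  cmap_continuous : {within cdom, continuous cmap};
  cinv_continuous : {within cimg, continuous cinv}
}.

Definition transition (R : realType) (X : topologicalType) (c d : chart R X) :
    'rV[R]_3 -> 'rV[R]_3 :=
  fun x => cmap d (cinv c x).

Definition smooth_transition (R : realType) (X : topologicalType)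
    (c d : chart R X) : Prop :=
  forall j : 'I_3, smooth_on (cmap c @` (cdom c `&` cdom d))
                             (fun x => transition c d x ord0 j).

Record manifold3 (R : realType) := Manifold3 {
  carrier :> topologicalType;
  atlas : set (chart R carrier);
  manifold_hausdorff : hausdorff_space carrier;
  manifold_second_countable : @second_countable carrier;
  atlas_cover : forall p : carrier, exists c : atlas, cdom (val c) p;
  atlas_smooth : forall c d : atlas, smooth_transition (val c) (val d)
}.

Arguments atlas {R} m _.

Section Manifold.
Variables (R : realType) (X : manifold3 R).

Definition chart_at (p : X) : atlas X := sval (cid (atlas_cover p)).

Definition coord_at (p : X) : 'rV[R]_3 := cmap (val (chart_at p)) p.

Definition boundary : set X := [set p | coord_at p ord0 ord0 = 0].

(* There is an atlas [B] of the same smooth structure all of whose transition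
   maps have positive Jacobian determinant. *)
Definition orientable : Prop :=
  exists B : set (chart R X),
    [/\ forall p : X, exists2 c, B c & cdom c p,
        forall b (c : atlas X), B b ->
          smooth_transition b (val c) /\ smooth_transition (val c) b
      & forall b c p, B b -> B c -> cdom b p -> cdom c p ->
          0 < \det (jacobian (transition b c) (cmap b p))].

(** * Riemannian metrics and the C^oo topology *)

(* A metric is given by its matrix of components in every chart of the atlas,
   as a function of the coordinates.  The components are set to 0 outside the
   image of the chart, so that each metric has a unique representation. *)
Record riemannian := Riemannian {
  components :> atlas X -> 'rV[R]_3 -> 'M[R]_3;
  metric_smooth : forall c i j,
    smooth_on (cimg (val c)) (fun x => components c x i j);
  metric_sym : forall c x, (components c x)^T = components c x;
  metric_posdef : forall c x (v : 'rV[R]_3), cimg (val c) x -> v != 0 ->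
    0 < (v *m components c x *m v^T) ord0 ord0;
  metric_transform : forall c d p, cdom (val c) p -> cdom (val d) p ->
    let J := jacobian (transition (val c) (val d)) (cmap (val c) p) in
    components c (cmap (val c) p) =
      J *m components d (cmap (val d) p) *m J^T;
  metric_out : forall c x, ~ cimg (val c) x -> components c x = 0
}.

(* For every chart [c] and multi-index [s], the [s]-th derivative of the
   components in [c], in the space of functions with the topology of uniform
   convergence on the compact subsets of the image of [c]. *)
Definition jets (g : riemannian) :
    prod_topology (fun k : atlas X * seq 'I_3 =>
      {family compactly_in (cimg (val k.1)), 'rV[R]_3 -> 'M[R]_3}) :=
  fun k x => \matrix_(i, j) iter_pderiv k.2 (fun y => g k.1 y i j) x.

HB.instance Definition _ := gen_eqMixin riemannian.
HB.instance Definition _ := gen_choiceMixin riemannian.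
HB.instance Definition _ :=
  Topological.copy riemannian (initial_topology jets).

End Manifold.

Arguments boundary {R} X _.

(** * Curvature *)

Section Curvature.
Variables (R : realType) (g : 'rV[R]_3 -> 'M[R]_3).

(* g^{ij} *)
Definition ginv (x : 'rV[R]_3) : 'M[R]_3 := invmx (g x).

(* Gamma^k_{ij} *)
Definition christoffel (k i j : 'I_3) (x : 'rV[R]_3) : R :=
  2^-1 * \sum_l ginv x k l *
    (pderiv i (fun y => g y j l) x + pderiv j (fun y => g y i l) x
     - pderiv l (fun y => g y i j) x).

Definition ricci_coord (i j : 'I_3) (x : 'rV[R]_3) : R :=
  \sum_k (pderiv k (christoffel k i j) x - pderiv j (christoffel k i k) x)
  + \sum_k \sum_l (christoffel k k l x * christoffel l i j x
                   - christoffel k j l x * christoffel l i k x).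

Definition scalar_coord (x : 'rV[R]_3) : R :=
  \sum_i \sum_j ginv x i j * ricci_coord i j x.

(* The unit normal field of the level sets of [x_0] pointing towards decreasing
   [x_0], i.e. - grad x_0 / |grad x_0|; on the boundary [x_0 = 0] this is the
   outward unit normal. *)
Definition normal_coord (k : 'I_3) (x : 'rV[R]_3) : R :=
  - ginv x ord0 k / Num.sqrt (ginv x ord0 ord0).

(* k-th component of the covariant derivative of the normal along d/dx_a *)
Definition cov_normal (a k : 'I_3) (x : 'rV[R]_3) : R :=
  pderiv a (normal_coord k) x
  + \sum_l christoffel k a l x * normal_coord l x.

(* Second fundamental form, with the sign for which the unit ball has mean
   curvature 2. *)
Definition second_ff (a b : 'I_3) (x : 'rV[R]_3) : R :=
  \sum_k cov_normal a k x * g x k b.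

(* Metric induced on the level sets of [x_0], in the coordinates x_1, x_2. *)
Definition induced_metric (x : 'rV[R]_3) : 'M[R]_2 :=
  \matrix_(a, b) g x (lift ord0 a) (lift ord0 b).

Definition mean_coord (x : 'rV[R]_3) : R :=
  \sum_(a < 2) \sum_(b < 2)
    invmx (induced_metric x) a b * second_ff (lift ord0 a) (lift ord0 b) x.

End Curvature.

Section MetricSpaces.
Variables (R : realType) (X : manifold3 R).

Definition scalar_curvature (g : riemannian X) (p : X) : R :=
  scalar_coord (g (chart_at p)) (coord_at p).

(* Only meaningful for [p] on the boundary. *)
Definition mean_curvature (g : riemannian X) (p : X) : R :=
  mean_coord (g (chart_at p)) (coord_at p).

Definition metrics_Rpos_Hpos : set (riemannian X) :=
  [set g | (forall p, 0 < scalar_curvature g p) /\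
           (forall p, boundary X p -> 0 < mean_curvature g p)].

Definition metrics_Rpos_Hnneg : set (riemannian X) :=
  [set g | (forall p, 0 < scalar_curvature g p) /\
           (forall p, boundary X p -> 0 <= mean_curvature g p)].

Definition metrics_Rpos_Hzero : set (riemannian X) :=
  [set g | (forall p, 0 < scalar_curvature g p) /\
           (forall p, boundary X p -> mean_curvature g p = 0)].

End MetricSpaces.

Arguments metrics_Rpos_Hpos {R} X _.
Arguments metrics_Rpos_Hnneg {R} X _.
Arguments metrics_Rpos_Hzero {R} X _.

(** * Absolute neighborhood retracts *)

Definition metrizable (R : realType) (T : topologicalType) : Prop :=
  exists (M : metricType R) (f : T -> M) (h : M -> T),
    [/\ cancel f h, cancel h f, continuous f & continuous h].

Definition closed_embedding (Z Y : topologicalType) (e : Z -> Y) : Prop :=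
  [/\ injective e, continuous e,
      forall A : set Z, open A -> exists2 B : set Y, open B & e @^-1` B = A
    & closed (range e)].

Definition ANR (R : realType) (Z : topologicalType) : Prop :=
  metrizable R Z /\
  forall (Y : topologicalType) (e : Z -> Y),
    metrizable R Y -> closed_embedding e ->
    exists (U : set Y) (r : U -> Z),
      [/\ open U, range e `<=` U, continuous r
        & forall (u : U) (z : Z), val u = e z -> r u = z].

(* Main.v *)
(** The conditions on the mean curvature are convex up to a conformal correction,
which yields an explicit extension operator.  Let S be one of the convex cones of
reals {> 0}, {>= 0}, {0} and let Z be the space of metrics with positive scalar
curvature and mean curvature in S.

Divided by |grad x_0|, the mean curvature of the boundary in a chart is a rational
expression q in the 1-jet of the metric which a change of charts multiplies by the
positive normal derivative of the transition map, and which a conformal factor w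
with w = 1 on the boundary changes to q - dw/dx_0.

The space of metrics is metrizable and separable: only countably many derivatives,
on finitely many compact sets, matter.  If Z is closed in a metrizable space Y,
Dugundji's formula with a dense sequence in Z therefore needs only countably many
locally finite weights, with no appeal to paracompactness.  Applied to the metrics
themselves, it gives a continuous extension F of the inclusion of Z whose values
are metrics, since these form a convex cone; applied to the functions q, it gives
functions with values in S on the boundary.  A partition of unity assembles a
function psi, zero on the boundary, such that (1 + psi + psi^2) F has exactly the
prescribed q, hence mean curvature in S.  On Z one has psi = 0.  The points of Y
where the resulting metric has positive scalar curvature form, by compactness of
X, an open neighborhood of Z, on which this metric is the retraction. *)

Require Import Defs.
From HB Require Import structures.
From mathcomp Require Import all_boot all_order all_algebra.
From mathcomp Require Import all_classical all_reals all_analysis.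
From mathcomp Require Import ring lra.

Set Implicit Arguments.
Unset Strict Implicit.
Unset Printing Implicit Defensive.

Import Order.TTheory GRing.Theory Num.Theory.
Import numFieldNormedType.Exports.

Local Open Scope classical_set_scope.
Local Open Scope ring_scope.

(** * Partial derivatives in R^3 and in the half-space *)

(** The obstacle is that neither [q] nor the mean curvature is convex in the metric: an average of
    metrics of [Z] may violate the boundary condition. Positive scalar curvature is an open
    condition and survives near [Z], but H >= 0 and H = 0 are not open, so the boundary condition
    has to be repaired exactly, at every point of [Y]. The average of the functions [q] says which
    value to prescribe, and the normal derivative of a conformal factor can absorb any difference.
    Positive rescaling in [S] takes care of |grad x_0| and of changes of charts, addition in [S] of
    averages and of the partition of unity.

    Continuity for the C^oo topology is reduced to one notion: families [F y x] all of whose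
    derivatives in [x] are jointly continuous in [(y, x)]. It is stable under the arithmetic of
    curvature, under changes of variables and under averaging with weights that depend on [y].

    Curvatures at a point are read in a chart chosen there with no regularity in the point, so their
    transformation laws must precede any statement about openness or about the boundary condition in
    a fixed chart. *)

(* The flag [b] selects the half-space ([true]) or all of R^3 ([false]), so that
   one-sided and ordinary calculus share their proofs. *)
Definition hs (R : realType) (b : bool) : set 'rV[R]_3 :=
  if b then @half_space R else setT.
Arguments hs {R} b.

Definition pd_filter (R : realType) (b : bool) (i : 'I_3) (x : 'rV[R]_3) :
    set_system R :=
  within [set h | hs b (x + h *: basis_vec R i)] (0 : R)^'.

(* Sealed, since unification would otherwise unfold limits. *)
HB.lock Definition pd (R : realType) (b : bool) (i : 'I_3) (f : 'rV[R]_3 -> R)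
    (x : 'rV[R]_3) : R :=
  lim ((fun h : R => (f (x + h *: basis_vec R i) - f x) / h) @ pd_filter b i x).
Arguments pd {R} b i f x.

Section Partial.
Variable R : realType.
Notation V := 'rV[R]_3.
Notation e := (@basis_vec R).
Implicit Types (b : bool) (i j : 'I_3) (x : V) (f g : V -> R).

Definition is_pd (b : bool) (i : 'I_3) (f : V -> R) (x : V) (l : R) :=
  (fun h : R => (f (x + h *: e i) - f x) / h) @ pd_filter b i x --> l.

Lemma nbhs_distP (x : V) (P : set V) : nbhs x P <->
  exists2 d : R, 0 < d & forall x', `|x' - x| < d -> P x'.
Proof.
split=> [/nbhs_normP[d /= d0 dP]|[d d0 dP]].
  by exists d => // x' dx; apply: dP; rewrite /= distrC.
by rewrite -nbhs_nbhs_norm; exists d => //= x' /=; rewrite distrC; exact: dP.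
Qed.

Lemma hs_pos b i x h : hs b x -> 0 <= h -> hs b (x + h *: e i).
Proof.
case: b => //=; rewrite /half_space /= !mxE => x0 h0.
by rewrite addr_ge0 // mulr_ge0.
Qed.

Global Instance pd_filter_filter b i x : Filter (pd_filter b i x).
Proof. exact: within_filter. Qed.

(** Positive increments never leave the half-space, even from the boundary plane; hence limits along
    this filter are unique. *)
Lemma pd_filter_proper b i x : hs b x -> ProperFilter (pd_filter b i x).
Proof.
move=> hx; apply: Build_ProperFilter_ex => // P.
rewrite /pd_filter /within /= => -[d /= d0] dP.
exists (d / 2); apply: dP => /=.
- by rewrite /ball /= sub0r normrN gtr0_norm ?divr_gt0 // ltr_pdivrMr // ltr_pMr // ltr1n.
- by rewrite gt_eqF // divr_gt0.
- by apply: hs_pos => //; rewrite divr_ge0 // ltW.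
Qed.

Lemma is_pdE b i f x l : hs b x -> is_pd b i f x l -> pd b i f x = l.
Proof.
move=> hx fl; have ? := pd_filter_proper i hx; rewrite pd.unlock.
by apply: cvg_lim => //; exact: Rhausdorff.
Qed.

Lemma pd_is b i f x : hs b x -> (exists l, is_pd b i f x l) ->
  is_pd b i f x (pd b i f x).
Proof. by move=> hx [l fl]; rewrite (is_pdE hx fl). Qed.

Lemma pd_filter_id b i x : (id : R -> R) @ pd_filter b i x --> 0.
Proof.
apply: cvg_within_filter; apply: cvg_within.
Qed.

Lemma pd_filter_neq0 b i x : \forall h \near pd_filter b i x, h != 0.
Proof.
rewrite /pd_filter; apply: filterS (nbhs_dnbhs_neq (0:R)) => h //.
Qed.

Lemma is_pd_cont b i f x l : is_pd b i f x l ->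
  (fun h => f (x + h *: e i)) @ pd_filter b i x --> f x.
Proof.
move=> fl.
have : (fun h => (f (x + h *: e i) - f x) / h * h + f x) @ pd_filter b i x
    --> l * 0 + f x.
  apply: cvgD; last exact: cvg_cst.
  by apply: cvgM => //; exact: pd_filter_id.
rewrite mulr0 add0r; apply: cvg_trans.
apply: near_eq_cvg; near=> h.
have h0 : h != 0 by near: h; exact: pd_filter_neq0.
by rewrite divfK // subrK.
Unshelve. all: by end_near. Qed.

Lemma is_pdD b i f g x l m : is_pd b i f x l -> is_pd b i g x m ->
  is_pd b i (fun y => f y + g y) x (l + m).
Proof.
move=> fl gm; apply: cvg_trans (cvgD fl gm).
by apply: near_eq_cvg; near=> h => /=; rewrite fctE -mulrDl; congr (_ * _); ring.
Unshelve. all: by end_near. Qed.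

Lemma is_pdM b i f g x l m : is_pd b i f x l -> is_pd b i g x m ->
  is_pd b i (fun y => f y * g y) x (l * g x + f x * m).
Proof.
move=> fl gm.
apply: cvg_trans
  (cvgD (cvgM fl (is_pd_cont gm)) (cvgM (cvg_cst (f x)) gm)).
apply: near_eq_cvg; near=> h => /=.
by rewrite !fctE /=; ring.
Unshelve. all: by end_near. Qed.

Lemma is_pd_cst b i x c : is_pd b i (fun=> c) x 0.
Proof.
rewrite /is_pd; under eq_fun do rewrite subrr mul0r; exact: cvg_cst.
Qed.

Lemma is_pd_coord b i x (j : 'I_3) :
  is_pd b i (fun y : V => y ord0 j) x (j == i)%:R.
Proof.
have H : (fun=> (j == i)%:R : R) @ pd_filter b i x --> ((j == i)%:R : R).
  exact: cvg_cst.
apply: cvg_trans H; apply: near_eq_cvg; near=> h => /=.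
have h0 : h != 0 by near: h; exact: pd_filter_neq0.
by rewrite !mxE eqxx /= addrAC subrr add0r mulrAC divff // mul1r.
Unshelve. all: by end_near. Qed.

Lemma is_pdV b i f x l : f x != 0 -> is_pd b i f x l ->
  is_pd b i (fun y => (f y)^-1) x (- l / (f x * f x)).
Proof.
move=> fx0 fl; have fc := is_pd_cont fl.
have H := cvgM (cvgN fl) (cvgV (mulf_neq0 fx0 fx0) (cvgM fc (cvg_cst (f x)))).
apply: cvg_trans (H _ _ _ _ _); apply: near_eq_cvg.
have : \forall h \near pd_filter b i x, f (x + h *: e i) != 0.
  exact: cvgr_neq0 fc fx0.
apply: filterS => h /= fh0; rewrite !fctE /=.
have [->|h0] := eqVneq h 0; first by rewrite !invr0 !mulr0 oppr0 mul0r.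
by field; rewrite fx0 fh0 h0.
Qed.

Definition ropen (b : bool) (A : set V) :=
  A `<=` hs b /\ forall x, A x -> within (hs b) (nbhs x) A.

Lemma cvg_line i x : (fun h : R => x + h *: e i) @ (0 : R) --> x.
Proof.
rewrite -[X in _ --> X]addr0 -[X in _ --> x + X](scale0r (e i)).
by apply: cvgD; [exact: cvg_cst|apply: cvgZl; exact: cvg_id].
Qed.

Lemma pd_filter_line b i x :
  (fun h : R => x + h *: e i) @ pd_filter b i x --> within (hs b) (nbhs x).
Proof.
move=> P NP; rewrite /pd_filter.
have := @cvg_line i x _ NP; rewrite /= /within /= => H.
have H' : \forall h \near (0 : R)^', hs b (x + h *: e i) -> P (x + h *: e i).
  by rewrite /dnbhs near_withinE; apply: filterS (H : nbhs (0 : R) _) => h Hh _.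
exact: H'.
Qed.

Lemma is_pd_local b i f g x l : hs b x ->
  (\forall y \near within (hs b) (nbhs x), f y = g y) ->
  is_pd b i f x l -> is_pd b i g x l.
Proof.
move=> hx fg; have fgx : f x = g x.
  by have /nbhs_singleton := fg; apply.
apply: cvg_trans; apply: near_eq_cvg.
have fg' : \forall h \near pd_filter b i x, f (x + h *: e i) = g (x + h *: e i) :=
  @pd_filter_line b i x _ fg.
by apply: filterS fg' => h /= ->; rewrite fgx.
Qed.

Lemma pd_local b i f g x : hs b x ->
  (\forall y \near within (hs b) (nbhs x), f y = g y) ->
  pd b i f x = pd b i g x.
Proof.
move=> hx fg; have fgx : f x = g x.
  by have /nbhs_singleton := fg; apply.
have fg' : \forall h \near pd_filter b i x,
    (f (x + h *: e i) - f x) / h = (g (x + h *: e i) - g x) / h.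
  have fg' : \forall h \near pd_filter b i x, f (x + h *: e i) = g (x + h *: e i) :=
  @pd_filter_line b i x _ fg.
by apply: filterS fg' => h /= ->; rewrite fgx.
rewrite pd.unlock; congr (lim _); apply/seteqP; split => P /=.
  by move=> fP; apply: filterS2 fg' (fP : pd_filter b i x _) => h /= ->.
by move=> fP; apply: filterS2 fg' (fP : pd_filter b i x _) => h /= ->.
Qed.

Lemma is_pd_nbhsP b i f x l (P : set R) : is_pd b i f x l -> nbhs (f x) P ->
  exists2 d : R, 0 < d & forall h, `|h| < d -> hs b (x + h *: e i) ->
    P (f (x + h *: e i)).
Proof.
move=> fl Pfx; have := @is_pd_cont b i f x l fl _ Pfx.
rewrite /pd_filter /= nbhs_simpl /= /within /= => -[d /= d0 H].
exists d => // h hd hh; have [->|h0] := eqVneq h 0.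
  by rewrite scale0r addr0; exact: nbhs_singleton.
by apply: H => //=; rewrite sub0r normrN.
Qed.

(** Since [s] is positive, increments smaller than [s] in absolute value keep the point on the ray
    from [x], hence in [hs b]: the restricted limit is there a two-sided one. *)
Lemma is_pd_derive b i f x s l : hs b x -> 0 < s ->
  is_pd b i f (x + s *: e i) l ->
  is_derive s 1 (fun r : R => f (x + r *: e i)) l.
Proof.
move=> hx s0 fl.
have H : (fun h : R => h^-1 *: (((fun r : R => f (x + r *: e i)) \o shift s)
   (h *: (1 : R)) - f (x + s *: e i))) @ (0:R)^' --> l.
  move=> P Pl; have := fl P Pl.
  rewrite /pd_filter /= nbhs_simpl /= /within /= => -[d /= d0 H].
  exists (Num.min d s) => /=; first by rewrite lt_min d0.
  move=> h /=; rewrite lt_min sub0r normrN => /andP[hd hs'] h0.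
  have -> : h^-1 *: (f (x + (h *: (1:R) + s) *: e i) - f (x + s *: e i)) =
    (f (x + s *: e i + h *: e i) - f (x + s *: e i)) / h.
    rewrite [_ *: (_ - _)]mulrC; congr ((f _ - _) / _).
    by rewrite -addrA -scalerDl addrC [s + h]addrC [_ *: (1:R)]mulr1 addrC.
  apply: H => //=; first by rewrite sub0r normrN.
  rewrite -addrA -scalerDl; apply: hs_pos => //.
  by have := ler_norm (- h); rewrite normrN => ?; lra.
by apply: DeriveDef; [apply/cvg_ex; exists l|apply: cvg_lim].
Qed.

Lemma mvt_pd b i f x t : hs b x -> 0 < t ->
  (forall s, 0 <= s <= t -> exists l, is_pd b i f (x + s *: e i) l) ->
  exists2 s, 0 <= s <= t & f (x + t *: e i) - f x = pd b i f (x + s *: e i) * t.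
Proof.
move=> hx t0 H.
have [||c] := @MVT_segment _ (fun r : R => f (x + r *: e i))
    (fun r => pd b i f (x + r *: e i)) 0 t (ltW t0).
- move=> s; rewrite in_itv /= => /andP[s0 st].
  apply: (@is_pd_derive b) => //; apply: pd_is; first by apply: hs_pos => //; exact: ltW.
  by apply: H; rewrite !ltW.
- apply/subspace_continuousP => s /=; rewrite in_itv /= => s0t P Ps.
  have [l sl] := H s s0t.
  have [d d0 dP] := is_pd_nbhsP sl Ps.
  exists d => //= r /=; rewrite in_itv /= => rs /andP[r0 rt].
  rewrite /from_subspace; have -> : x + r *: e i = x + s *: e i + (r - s) *: e i.
    by rewrite -addrA -scalerDl addrCA subrr addr0.
  apply: dP; first by rewrite distrC.
  by rewrite -addrA -scalerDl [s + _]addrC subrK; exact: hs_pos.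
- rewrite in_itv /= => c0t; rewrite scale0r addr0 subr0 => ?.
  by exists c.
Qed.

(** * Functions with a parameter whose partial derivatives are jointly continuous *)

Section JointContinuity.
Variable Y : topologicalType.
Implicit Types (F G : Y -> V -> R) (y : Y).

Definition jfilter b y x : set_system (Y * V) :=
  filter_prod (nbhs y) (within (hs b) (nbhs x)).

Definition jcont b F y x :=
  (fun z : Y * V => F z.1 z.2) @ jfilter b y x --> F y x.

Global Instance jfilter_filter b y x : Filter (jfilter b y x).
Proof. exact: filter_prod_filter. Qed.

Lemma jcontP b F y x : jcont b F y x <->
  forall eps : R, 0 < eps -> exists2 U, nbhs y U & exists2 d, 0 < d &
   forall y' x', U y' -> hs b x' -> `|x' - x| < d -> `|F y' x' - F y x| < eps.
Proof.
split.
- move=> /cvgrPdist_lt H eps eps0; have := H _ eps0.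
  move=> [[A B]] /= [Ay Bx] AB.
  have /nbhs_distP[d d0 dB] : nbhs x [set x' | hs b x' -> B x'] := Bx.
  exists A => //; exists d => // y' x' Ay' hx' dx.
  rewrite distrC; apply: (AB (y', x')) => /=; split => //; exact: dB.
- move=> H; apply/cvgrPdist_lt => eps eps0.
  have [U Uy [d d0 UdP]] := H _ eps0.
  exists (U, [set x' | `|x' - x| < d /\ hs b x']) => /=.
    by split => //; rewrite /within /=; apply/nbhs_distP; exists d.
  by move=> [y' x'] /= [Uy' [dx hx]]; rewrite distrC; exact: UdP.
Qed.

Lemma jcontD b F G y x : jcont b F y x -> jcont b G y x ->
  jcont b (fun y x => F y x + G y x) y x.
Proof. exact: cvgD. Qed.

Lemma jcontM b F G y x : jcont b F y x -> jcont b G y x ->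
  jcont b (fun y x => F y x * G y x) y x.
Proof. exact: cvgM. Qed.

Lemma jcontV b F y x : F y x != 0 -> jcont b F y x ->
  jcont b (fun y x => (F y x)^-1) y x.
Proof. exact: cvgV. Qed.

Lemma jcont_cst b (c : Y -> R) y x : {for y, continuous c} ->
  jcont b (fun y _ => c y) y x.
Proof. by move=> cc; apply: (@cvg_comp _ _ _ fst c _ (nbhs y)) cc; exact: cvg_fst. Qed.

Lemma jcont_coord b j y x : jcont b (fun _ x => x ord0 j) y x.
Proof.
apply: (@cvg_comp _ _ _ snd (fun x : V => x ord0 j) _ (nbhs x)).
  apply: cvg_trans; first exact: cvg_snd.
  exact: cvg_within.
exact: coord_continuous.
Qed.

Lemma jcont_local b F G y x : hs b x ->
  (\forall x' \near within (hs b) (nbhs x), forall y, F y x' = G y x') ->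
  jcont b F y x -> jcont b G y x.
Proof.
move=> hx FG; rewrite /jcont.
have -> : F y x = G y x by have /nbhs_singleton := FG; apply.
apply: cvg_trans; apply: near_eq_cvg.
exists (setT, [set x' | forall y, F y x' = G y x']) => /=.
  by split => //; exact: filterT.
by move=> [y' x'] /= [_ ->].
Qed.

Lemma jcont_slice b F y x : jcont b F y x ->
  F y @ within (hs b) (nbhs x) --> F y x.
Proof.
move=> /jcontP H; apply/cvgrPdist_lt => eps /H[U Uy [d d0 Ud]].
rewrite near_withinE; apply/nbhs_distP; exists d => //= x' dx hx.
by rewrite distrC; apply: Ud => //; exact: nbhs_singleton.
Qed.

(* [smk b k F y x]: the partial derivatives in [x] of [F] up to order [k] exist
   and are jointly continuous at [(y, x)]. *)
Fixpoint smk b (k : nat) F y x : Prop :=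
  jcont b F y x /\
  if k is k'.+1 then forall i, (exists l, is_pd b i (F y) x l) /\
    smk b k' (fun y => pd b i (F y)) y x
  else True.

Definition fam b (A : set V) F := forall k y x, A x -> smk b k F y x.

Lemma smk_jcont b k F y x : smk b k F y x -> jcont b F y x.
Proof. by case: k => [|k] []. Qed.

Lemma smkS b k F y x : smk b k.+1 F y x -> smk b k F y x.
Proof.
elim: k F => [|k IH] F /=; first by case.
case=> Fc H; split=> // i; have [Fi H1] := H i; split=> //.
by apply: IH.
Qed.

Lemma smk_local b A k F G : ropen b A -> {in A, forall x y, F y x = G y x} ->
  (forall y x, A x -> smk b k F y x) -> forall y x, A x -> smk b k G y x.
Proof.
move=> [Ahs Aop]; elim: k F G => [|k IH] F G FG HF y x Ax.
  split=> //; have [jF _] := HF y x Ax; apply: jcont_local jF; first exact: Ahs.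
  by apply: filterS (Aop _ Ax) => x' Ax' y'; rewrite FG // inE.
have near_FG x' : A x' -> \forall x'' \near within (hs b) (nbhs x'),
    forall y, F y x'' = G y x''.
  by move=> Ax'; apply: filterS (Aop _ Ax') => x'' ? y'; rewrite FG // inE.
split.
  have [jF _] := HF y x Ax; apply: jcont_local jF; first exact: Ahs.
  exact: near_FG.
move=> i; split.
  have [_ /(_ i)[[l Fl] _]] := HF y x Ax; exists l.
  by apply: is_pd_local Fl; [exact: Ahs|apply: filterS (near_FG x Ax)].
apply: (IH (fun y => pd b i (F y))) => //.
  move=> x'; rewrite inE => Ax' y'; apply: pd_local; first exact: Ahs.
  by apply: filterS (near_FG x' Ax').
by move=> y' x' Ax'; have [_ /(_ i)[]] := HF y' x' Ax'.
Qed.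

Section Closure.
Variables (b : bool) (A : set V).
Hypothesis oA : ropen b A.

Let Ahs x : A x -> hs b x. Proof. exact: oA.1. Qed.

Definition famk k F := forall y x, A x -> smk b k F y x.

Lemma famkS k F : famk k.+1 F -> famk k F.
Proof. by move=> H y x /(H y) /smkS. Qed.

Lemma famk_pd k F i : famk k.+1 F -> famk k (fun y => pd b i (F y)).
Proof. by move=> H y x /(H y) [_ /(_ i)[]]. Qed.

Lemma famk_is_pd k F i y x : famk k.+1 F -> A x ->
  is_pd b i (F y) x (pd b i (F y) x).
Proof.
by move=> H Ax; have [_ /(_ i)[]] := H y x Ax; move/(pd_is (Ahs Ax)).
Qed.

Lemma famk_ext k F G : {in A, forall x y, F y x = G y x} ->
  famk k F -> famk k G.
Proof. exact: smk_local. Qed.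

(* To bound the order of [G] by one more than that of [H i], it suffices that
   [H i] computes the partial derivatives of [G]. *)
Lemma famk_step k G (H : 'I_3 -> Y -> V -> R) :
  (forall y x, A x -> jcont b G y x) ->
  (forall i y x, A x -> is_pd b i (G y) x (H i y x)) ->
  (forall i, famk k (H i)) -> famk k.+1 G.
Proof.
move=> cG dG HH y x Ax; split; first exact: cG.
move=> i; split; first by exists (H i y x); exact: dG.
apply: (@famk_ext _ (H i)) => // x'; rewrite inE => Ax' y'.
by rewrite (is_pdE (Ahs Ax') (dG i y' x' Ax')).
Qed.

Lemma famk_cst k (c : Y -> R) : continuous c -> famk k (fun y _ => c y).
Proof.
move=> cc; elim: k c cc => [|k IH] c cc.
  by move=> y x Ax; split=> //; apply: jcont_cst; exact: cc.
apply: (@famk_step _ _ (fun _ _ _ => 0)).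
- by move=> y x Ax; apply: jcont_cst; exact: cc.
- by move=> i y x Ax; exact: is_pd_cst.
- by move=> _; apply: IH; exact: cst_continuous.
Qed.

Lemma famk_coord k (j : 'I_3) : famk k (fun _ x => x ord0 j).
Proof.
case: k => [|k]; first by move=> y x Ax; split=> //; exact: jcont_coord.
apply: (@famk_step _ _ (fun i _ _ => (j == i)%:R)).
- by move=> y x Ax; exact: jcont_coord.
- by move=> i y x Ax; exact: is_pd_coord.
- by move=> i; apply: famk_cst; exact: cst_continuous.
Qed.

Lemma famk_jcont k F y x : famk k F -> A x -> jcont b F y x.
Proof. by move=> H /(H y)/smk_jcont. Qed.

Lemma famkD k F G : famk k F -> famk k G -> famk k (fun y x => F y x + G y x).
Proof.
elim: k F G => [|k IH] F G HF HG.
  by move=> y x Ax; split=> //; apply: jcontD; apply: famk_jcont; eassumption.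
apply: (@famk_step _ _ (fun i y x => pd b i (F y) x + pd b i (G y) x)).
- by move=> y x Ax; apply: jcontD; apply: famk_jcont; eassumption.
- by move=> i y x Ax; apply: is_pdD; apply: famk_is_pd; eassumption.
- by move=> i; apply: IH; apply: famk_pd.
Qed.

Lemma famkM k F G : famk k F -> famk k G -> famk k (fun y x => F y x * G y x).
Proof.
elim: k F G => [|k IH] F G HF HG.
  by move=> y x Ax; split=> //; apply: jcontM; apply: famk_jcont; eassumption.
apply: (@famk_step _ _
  (fun i y x => pd b i (F y) x * G y x + F y x * pd b i (G y) x)).
- by move=> y x Ax; apply: jcontM; apply: famk_jcont; eassumption.
- by move=> i y x Ax; apply: is_pdM; apply: famk_is_pd; eassumption.
- by move=> i; apply: famkD; apply: IH => //; (apply: famk_pd || apply: famkS).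
Qed.

Lemma famk_sum k (I : Type) (s : seq I) (F : I -> Y -> V -> R) :
  (forall m, famk k (F m)) -> famk k (fun y x => \sum_(m <- s) F m y x).
Proof.
move=> H; elim: s => [|m s IH].
  apply: (@famk_ext _ (fun _ _ => 0)); last by apply: famk_cst; exact: cst_continuous.
  by move=> x _ y; rewrite big_nil.
apply: (@famk_ext _ (fun y x => F m y x + \sum_(m <- s) F m y x)).
  by move=> x _ y; rewrite big_cons.
exact: famkD.
Qed.

(** The derivative -F'/F^2 of 1/F involves 1/F only at the lower order, so the induction on [k]
    closes. *)
Lemma famkV k F : (forall y x, A x -> F y x != 0) -> famk k F ->
  famk k (fun y x => (F y x)^-1).
Proof.
move=> F0; elim: k => [|k IH] HF.
  move=> y x Ax; split=> //; apply: jcontV; first exact: F0.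
  by apply: famk_jcont; eassumption.
apply: (@famk_step _ _
  (fun i y x => - 1 * pd b i (F y) x * ((F y x)^-1 * (F y x)^-1))).
- move=> y x Ax; apply: jcontV; first exact: F0.
  by apply: famk_jcont; eassumption.
- move=> i y x Ax; rewrite mulN1r -invfM.
  by apply: is_pdV; [exact: F0|apply: famk_is_pd; eassumption].
- have ? := IH (famkS HF); move=> i; apply: famkM; last exact: famkM.
  apply: famkM; last exact: famk_pd.
  by apply: (@famk_cst _ (fun=> -1)); exact: cst_continuous.
Qed.

End Closure.

End JointContinuity.

End Partial.

(** * Chain rule and symmetry of second derivatives *)

Section Composition.
Variable R : realType.
Notation V := 'rV[R]_3.
Notation e := (@basis_vec R).
Implicit Types (b : bool) (i j : 'I_3) (x : V) (f g : V -> R).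

Lemma coord_le_norm x j : `|x ord0 j| <= `|x|.
Proof.
rewrite [leRHS]/Num.norm /= mx_normrE.
by apply/bigmax_geP; right => /=; exists (ord0, j).
Qed.

Lemma norm_lt_coord x d : 0 < d -> (forall j, `|x ord0 j| < d) -> `|x| < d.
Proof.
move=> d0 H; rewrite [ltLHS]/Num.norm /= mx_normrE.
by apply/bigmax_ltP; split=> // -[i j] _ /=; rewrite ord1.
Qed.

Lemma mvt_pd_le b i f x t c eps : hs b x -> hs b (x + t *: e i) ->
  (forall s, 0 <= s <= t \/ t <= s <= 0 ->
    (exists l, is_pd b i f (x + s *: e i) l) /\
    `|pd b i f (x + s *: e i) - c| <= eps) ->
  `|f (x + t *: e i) - f x - c * t| <= eps * `|t|.
Proof.
(* A negative step is read backwards from its end point, because [mvt_pd] moves in the positive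
   direction only. *)
wlog t0 : x t / 0 <= t.
  move=> W hx ht H; have [t0|t0] := leP 0 t; first exact: W.
  have E s : x + t *: e i + s *: e i = x + (t + s) *: e i.
    by rewrite -addrA -scalerDl.
  have := W (x + t *: e i) (- t).
  rewrite E subrr scale0r addr0 oppr_ge0 normrN => /(_ (ltW t0) ht hx).
  have -> : f x - f (x + t *: e i) - c * - t = - (f (x + t *: e i) - f x - c * t).
    by ring.
  rewrite normrN; apply => s st; rewrite E; apply: H.
  by right; case: st => /andP[? ?]; apply/andP; split; lra.
move: t0; rewrite le_eqVlt => /orP[/eqP<-|t0] hx ht H.
  by rewrite scale0r addr0 subrr mulr0 subrr normr0 mulr0.
have [s st ->] := mvt_pd hx t0 (fun s h => (H s (or_introl h)).1).
rewrite -mulrBl normrM ler_wpM2r //.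
by have [] := H s (or_introl st).
Qed.

(** The corners of the path from [a] to [x] that changes one coordinate at a time. Every coordinate
    stays between those of [a] and [x], so the path remains in the half-space and in any
    maximum-norm ball around [a] containing [x]. *)
Definition mix (n : nat) (x a : V) : V :=
  \row_(j < 3) if (j < n)%N then x ord0 j else a ord0 j.

Lemma mixS (n : 'I_3) x a :
  mix n.+1 x a = mix n x a + (x ord0 n - a ord0 n) *: e n.
Proof.
apply/rowP => j; rewrite !mxE eqxx /= ltnS.
have [->|jn] := eqVneq j n; first by rewrite leqnn ltnn mulr1 addrC subrK.
by rewrite mulr0 addr0 leq_eqVlt (inj_eq val_inj) (negbTE jn).
Qed.

Lemma mix0 x a : mix 0 x a = a.
Proof. by apply/rowP => j; rewrite mxE. Qed.

Lemma mix3 x a : mix 3 x a = x.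
Proof. by apply/rowP => j; rewrite mxE ltn_ord. Qed.

Lemma mix_seg b (n : 'I_3) x a s d : 0 < d -> hs b x -> hs b a ->
  `|x - a| < d ->
  0 <= s <= x ord0 n - a ord0 n \/ x ord0 n - a ord0 n <= s <= 0 ->
  hs b (mix n x a + s *: e n) /\ `|mix n x a + s *: e n - a| < d.
Proof.
move=> d0 hx ha dxa sn.
have xa j : `|x ord0 j - a ord0 j| < d.
  by have := coord_le_norm (x - a) j; rewrite !mxE => /le_lt_trans; apply.
split.
  case: b hx ha => //=; rewrite /half_space /= !mxE eqxx /= => hx ha.
  case: n sn => -[|n] nlt /= sn.
    move: sn; have -> : Ordinal nlt = ord0 by exact: val_inj.
    by rewrite mulr1; case=> /andP[? ?]; lra.
  by rewrite mulr0 addr0.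
apply: norm_lt_coord => // j; rewrite !mxE eqxx /=.
have [->|jn] := eqVneq j n.
  rewrite ltnn mulr1 addrAC subrr add0r.
  apply: le_lt_trans (xa n); case: sn => /andP[s0 s1].
    by rewrite !ger0_norm // (le_trans s0).
  by rewrite !ler0_norm ?lerN2 // (le_trans s0).
by rewrite mulr0 addr0; case: ifP => // _; rewrite subrr normr0.
Qed.

(** Continuous partial derivatives give a total derivative: the increment telescopes along the path
    of [mix], and [mvt_pd_le] bounds the error on each leg. *)
Lemma strong_diff b (A : set V) f a : ropen b A -> A a ->
  (forall x j, A x -> exists l, is_pd b j f x l) ->
  (forall j, pd b j f @ within (hs b) (nbhs a) --> pd b j f a) ->
  forall eps, 0 < eps -> exists2 d, 0 < d & forall x, hs b x -> `|x - a| < d ->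
   `|f x - f a - \sum_j pd b j f a * (x ord0 j - a ord0 j)|
     <= eps * \sum_j `|x ord0 j - a ord0 j|.
Proof.
move=> [Ahs Aop] Aa dA cA eps eps0.
have : \forall x \near within (hs b) (nbhs a), A x /\
    forall j, `|pd b j f x - pd b j f a| <= eps.
  have H : \forall x \near within (hs b) (nbhs a),
      forall j, `|pd b j f x - pd b j f a| <= eps.
    apply: filter_forall => j; have /cvgrPdist_le := cA j.
    by move=> /(_ _ eps0); apply: filterS => x; rewrite distrC.
  by apply: filterS2 (Aop _ Aa) H.
rewrite near_withinE => /nbhs_distP[d d0 dP].
exists d => // x hx dx.
have step (n : 'I_3) : `|f (mix n.+1 x a) - f (mix n x a) -
   pd b n f a * (x ord0 n - a ord0 n)| <= eps * `|x ord0 n - a ord0 n|.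
  have S s := @mix_seg b n x a s d d0 hx (Ahs _ Aa) dx.
  rewrite mixS; apply: (@mvt_pd_le b).
  - rewrite -[mix n x a]addr0 -(scale0r (e n)); apply: (S 0 _).1.
    by have [H|/ltW H] := leP 0 (x ord0 n - a ord0 n); [left|right];
      rewrite lexx ?H.
  - apply: (S _ _).1.
    by have [H|/ltW H] := leP 0 (x ord0 n - a ord0 n); [left|right];
      rewrite lexx ?andbT.
  - move=> s /S[h1 h2]; have [Ax H] := dP _ h2 h1; split; last exact: H.
    exact: dA.
have -> : f x - f a - \sum_j pd b j f a * (x ord0 j - a ord0 j) =
  \sum_(j < 3) (f (mix j.+1 x a) - f (mix j x a)
     - pd b j f a * (x ord0 j - a ord0 j)).
  rewrite sumrB; congr (_ - _); rewrite !big_ord_recr big_ord0 /= add0r.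
  by rewrite mix0 mix3; ring.
apply: le_trans (ler_norm_sum _ _ _) _.
by rewrite mulr_sumr; apply: ler_sum => n _; exact: step.
Qed.

Lemma is_pd_comp b b' i (B : set V) f (phi : V -> V) x (m : 'I_3 -> R) :
  hs b' x -> ropen b B -> B (phi x) ->
  (\forall x' \near within (hs b') (nbhs x), hs b (phi x')) ->
  (forall x j, B x -> exists l, is_pd b j f x l) ->
  (forall j, pd b j f @ within (hs b) (nbhs (phi x)) --> pd b j f (phi x)) ->
  (forall j, is_pd b' i (fun x => phi x ord0 j) x (m j)) ->
  is_pd b' i (f \o phi) x (\sum_j pd b j f (phi x) * m j).
Proof.
move=> hx oB Bx hphi df cf dphi.
have sd := strong_diff oB Bx df cf.
set c := fun j => pd b j f (phi x).
pose q j h := (phi (x + h *: e i) ord0 j - phi x ord0 j) / h.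
have cq : (fun h => \sum_j c j * q j h) @ pd_filter b' i x --> \sum_j c j * m j.
  apply: (cvg_big (op := +%R)) => [z|j _]; first exact: add_continuous.
  by apply: cvgM; [exact: cvg_cst|exact: dphi].
suff H : (fun h => ((f \o phi) (x + h *: e i) - (f \o phi) x) / h -
     \sum_j c j * q j h) @ pd_filter b' i x --> (0 : R).
  rewrite /is_pd -[X in _ --> X]add0r.
  apply: cvg_trans (cvgD H cq); apply: near_eq_cvg.
  by near=> h; rewrite /= fctE /= subrK.
(* For small [h] the sum of the [|q j h|] is at most [M], so an error of [eps / M] in [strong_diff]
   becomes [eps] after division by [h]. The added 1 also keeps [M] positive. *)
pose M := \sum_j (`|m j| + 1).
have M0 : 0 < M.
  rewrite /M (bigD1 ord0) //= ltr_pwDl ?sumr_ge0 //.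
apply/cvgrPdist_le => eps eps0.
have [d d0 Hd] := sd (eps / M) (divr_gt0 eps0 M0).
have nq : \forall h \near pd_filter b' i x, forall j, `|q j h| <= `|m j| + 1.
  apply: filter_forall => j; have /cvgrPdist_le/(_ _ ltr01) := dphi j.
  apply: filterS => h; rewrite -/(q j h) => H.
  by rewrite -[q j h](subrK (m j)) addrC (le_trans (ler_normD _ _)) // lerD2l distrC.
have nhs : \forall h \near pd_filter b' i x, hs b (phi (x + h *: e i)).
  exact: (@pd_filter_line _ b' i x _ hphi).
have nd : \forall h \near pd_filter b' i x, `|phi (x + h *: e i) - phi x| < d.
  have : \forall h \near pd_filter b' i x,
     forall j, `|phi (x + h *: e i) ord0 j - phi x ord0 j| < d.
    apply: filter_forall => j; have /cvgrPdist_lt/(_ _ d0) := is_pd_cont (dphi j).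
    by apply: filterS => h; rewrite distrC.
  apply: filterS => h H; apply: norm_lt_coord => // j; rewrite !mxE; exact: H.
near=> h; rewrite sub0r normrN.
have h0 : h != 0 by near: h; exact: pd_filter_neq0.
have nqh : forall j, `|q j h| <= `|m j| + 1 by near: h.
have := Hd (phi (x + h *: e i)).
have -> : \sum_j c j * q j h =
    (\sum_j c j * (phi (x + h *: e i) ord0 j - phi x ord0 j)) / h.
  by rewrite mulr_suml; apply: eq_bigr => j _; rewrite mulrA.
rewrite -mulrBl normrM normfV ler_pdivrMr ?normr_gt0 //.
move=> H; apply: le_trans (H _ _) _.
- by near: h.
- by near: h.
- have -> : \sum_j `|phi (x + h *: e i) ord0 j - phi x ord0 j| =
      (\sum_j `|q j h|) * `|h|.
    rewrite mulr_suml; apply: eq_bigr => j _.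
    by rewrite -normrM /q divfK.
  rewrite mulrA ler_wpM2r // mulrAC ler_pdivrMr // ler_wpM2l ?(ltW eps0) //.
  apply: ler_sum => j _; exact: nqh.
Unshelve. all: by end_near. Qed.

Section FamComp.
Variable Y : topologicalType.
Implicit Types (F G : Y -> V -> R) (y : Y).

Lemma jcont_comp b b' F (phi : V -> V) y x :
  (\forall x' \near within (hs b') (nbhs x), hs b (phi x')) ->
  (forall j, jcont b' (fun (_ : Y) x => phi x ord0 j) y x) ->
  jcont b F y (phi x) -> jcont b' (fun y x => F y (phi x)) y x.
Proof.
move=> hphi cphi /jcontP cF; apply/jcontP => eps /cF [U Uy [d d0 dP]].
have : \forall x' \near within (hs b') (nbhs x), forall j,
    `|phi x' ord0 j - phi x ord0 j| < d.
  apply: filter_forall => j; have /cvgrPdist_lt/(_ _ d0) := jcont_slice (cphi j).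
  by apply: filterS => x'; rewrite distrC.
move=> H; have : \forall x' \near within (hs b') (nbhs x),
    hs b (phi x') /\ `|phi x' - phi x| < d.
  apply: filterS2 hphi H => x' ? H; split=> //.
  by apply: norm_lt_coord => // j; rewrite !mxE.
rewrite near_withinE => /nbhs_distP[r r0 rP].
exists U => //; exists r => // y' x' Uy' hx' rx'.
by have [? ?] := rP x' rx' hx'; apply: dP.
Qed.

(** A derivative of the composite is a sum of products of a composite with a derivative of [F] and a
    derivative of [phi]; the induction on [k] therefore has to keep [F] general. *)
Lemma famk_comp b b' (A B : set V) k F (phi : V -> V) :
  ropen b' A -> ropen b B -> (forall x, A x -> B (phi x)) ->
  (forall j, famk b' A k (fun (_ : Y) x => phi x ord0 j)) ->
  famk b B k F -> famk b' A k (fun y x => F y (phi x)).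
Proof.
move=> oA oB AB; elim: k F => [|k IH] F Hphi HF.
  move=> y x Ax; split=> //; apply: (@jcont_comp b) => //.
  - by apply: filterS (oA.2 _ Ax) => x' /AB /oB.1.
  - by move=> j; apply: famk_jcont; [exact: Hphi|].
  - by apply: famk_jcont; [exact: HF|exact: AB].
have hphi x : A x -> \forall x' \near within (hs b') (nbhs x), hs b (phi x').
  by move=> Ax; apply: filterS (oA.2 _ Ax) => x' /AB /oB.1.
apply: (@famk_step _ _ _ _ oA _ _ (fun i y x => \sum_j pd b j (F y) (phi x) *
    pd b' i (fun x => phi x ord0 j) x)).
- move=> y x Ax; apply: (@jcont_comp b); first exact: hphi.
  + by move=> j; apply: famk_jcont; [exact: Hphi|].
  + by apply: famk_jcont; [exact: HF|exact: AB].
- move=> i y x Ax; apply: (@is_pd_comp _ _ _ B) => //.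
  + exact: oA.1.
  + exact: AB.
  + exact: hphi.
  + by move=> x' j Bx'; have [_ /(_ j)[]] := HF y x' Bx'.
  + move=> j; apply: (jcont_slice (F := fun y => pd b j (F y))).
    by apply: famk_jcont; [exact: famk_pd HF|exact: AB].
  + move=> j. exact: (@famk_is_pd _ Y b' A oA k _ i y x (Hphi j) Ax).
- move=> i; apply: famk_sum => // j; apply: famkM => //.
    apply: (IH (fun y => pd b j (F y))); last exact: famk_pd.
    by move=> j'; apply: famkS.
  by have := @famk_pd _ _ b' A k _ i (Hphi j).
Qed.

End FamComp.

Section Schwarz.

(* Both mixed derivatives are limits of the same second difference quotient. *)
Lemma second_difference b i j f x t : hs b x -> 0 < t ->
  (forall y, hs b y -> `|y - x| <= t + t -> exists l, is_pd b i f y l) ->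
  (forall y, hs b y -> `|y - x| <= t + t -> exists l, is_pd b j (pd b i f) y l) ->
  exists2 y, hs b y /\ `|y - x| <= t + t &
   f (x + t *: e i + t *: e j) - f (x + t *: e i) - f (x + t *: e j) + f x =
   pd b j (pd b i f) y * (t * t).
Proof.
move=> hx t0 di dj.
have enorm k s : `|s *: e k| <= `|s|.
  rewrite normrZ ler_piMr //.
  rewrite [leLHS]/Num.norm /= mx_normrE; apply/bigmax_leP; split=> // -[k1 k2] _ /=.
  by rewrite mxE; case: (_ && _); rewrite ?normr1 ?normr0.
have nrm r s : 0 <= r <= t -> 0 <= s <= t ->
    hs b (x + r *: e i + s *: e j) /\ `|x + r *: e i + s *: e j - x| <= t + t.
  move=> /andP[r0 rt] /andP[s0 st]; split; first by do 2!apply: hs_pos => //.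
  have -> : x + r *: e i + s *: e j - x = r *: e i + s *: e j.
    by rewrite -(addrA x) addrAC subrr add0r.
  by apply: le_trans (ler_normD _ _) _; apply: lerD;
    apply: le_trans (enorm _ _) _; rewrite ger0_norm.
pose G y := f (y + t *: e j) - f y.
have tt : 0 <= t <= t by rewrite (ltW t0) lexx.
have zt : 0 <= (0 : R) <= t by apply/andP; split=> //; exact: ltW.
have dG r : 0 <= r <= t -> is_pd b i G (x + r *: e i)
    (pd b i f (x + r *: e i + t *: e j) - pd b i f (x + r *: e i)).
  move=> rt; have [h1 n1] := nrm r t rt tt.
  have := nrm r 0 rt zt; rewrite scale0r addr0 => -[h2 n2].
  have D1 := pd_is h1 (di _ h1 n1); have D2 := pd_is h2 (di _ h2 n2).
  have D1' : is_pd b i (fun y => f (y + t *: e j)) (x + r *: e i)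
      (pd b i f (x + r *: e i + t *: e j)).
    rewrite /is_pd.
    under eq_fun do rewrite addrAC.
    apply: cvg_trans D1; apply: cvg_app; rewrite /pd_filter.
    move=> P; rewrite !nbhs_simpl /within /=; apply: filterS => h H hh; apply: H.
    by rewrite /= addrAC; apply: hs_pos => //; exact: ltW.
  apply: cvg_trans (cvgB D1' D2); apply: near_eq_cvg.
  by near=> h => /=; rewrite /G !fctE /=; ring.
have [r rt HG] := mvt_pd hx t0 (fun s hs => ex_intro _ _ (dG s hs)).
have [h1 n1] := nrm r t rt tt.
have [h2 n2] : hs b (x + r *: e i) /\ `|x + r *: e i - x| <= t + t.
  by have := nrm r 0 rt zt; rewrite scale0r addr0.
have [s st Hs] := mvt_pd h2 t0 (f := pd b i f) (i := j)
  (fun s st => dj _ (nrm r s rt st).1 (nrm r s rt st).2).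
exists (x + r *: e i + s *: e j); first exact: nrm.
move: HG; rewrite (is_pdE h2 (dG r rt)) Hs /G => HG.
by rewrite mulrA -HG; ring.
Unshelve. all: by end_near. Qed.

Lemma schwarz b (A : set V) f x i j : ropen b A -> A x ->
  (forall y k, A y -> exists l, is_pd b k f y l) ->
  (forall y k l, A y -> exists m, is_pd b k (pd b l f) y m) ->
  (forall k l, pd b k (pd b l f) @ within (hs b) (nbhs x) --> pd b k (pd b l f) x) ->
  pd b i (pd b j f) x = pd b j (pd b i f) x.
Proof.
move=> [Ahs Aop] Ax d1 d2 c2; have hx := Ahs _ Ax.
apply/eqP; rewrite -subr_eq0 -normr_le0; apply/ler_addgt0Pl => eps eps0.
have : \forall y \near within (hs b) (nbhs x), A y /\ forall k l,
   `|pd b k (pd b l f) x - pd b k (pd b l f) y| <= eps / 2.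
  have H : \forall y \near within (hs b) (nbhs x), forall k l,
     `|pd b k (pd b l f) x - pd b k (pd b l f) y| <= eps / 2.
    apply: filter_forall => k; apply: filter_forall => l.
    by have /cvgrPdist_le := c2 k l; apply; rewrite divr_gt0.
  by apply: filterS2 (Aop _ Ax) H.
rewrite near_withinE => /nbhs_distP[d d0 dP].
(* The second difference reaches points at distance at most 2t = d/2 from [x]. *)
pose t := d / 4.
have t0 : 0 < t by rewrite divr_gt0.
have td : t + t < d by rewrite /t; lra.
have ok y : hs b y -> `|y - x| <= t + t -> A y /\ forall k l,
   `|pd b k (pd b l f) x - pd b k (pd b l f) y| <= eps / 2.
  by move=> hy ny; apply: dP => //; exact: le_lt_trans td.
have [y1 [h1 n1] E1] := @second_difference b i j f x t hx t0
  (fun y hy ny => d1 y i (ok y hy ny).1) (fun y hy ny => d2 y j i (ok y hy ny).1).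
have [y2 [h2 n2] E2] := @second_difference b j i f x t hx t0
  (fun y hy ny => d1 y j (ok y hy ny).1) (fun y hy ny => d2 y i j (ok y hy ny).1).
(* The second difference is symmetric in [i] and [j], so both mean values equal it divided by
   t^2. *)
have E : pd b j (pd b i f) y1 = pd b i (pd b j f) y2.
  apply: (mulIf (lt0r_neq0 (mulr_gt0 t0 t0))).
  apply: etrans (esym E1) _; apply: etrans _ E2.
  rewrite (addrAC x (t *: e j)).
  by move: (f _) (f _) (f _) (f _) => u1 u2 u3 u4; ring.
have H1 := (ok _ h1 n1).2 j i; have H2 := (ok _ h2 n2).2 i j.
move: H1 H2; rewrite -E.
move: (pd b i (pd b j f) x) (pd b j (pd b i f) x) (pd b j (pd b i f) y1) => u v w H1 H2.
have -> : u - v = (u - w) - (v - w) by ring.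
rewrite addr0 [eps]splitr; apply: le_trans (ler_normB _ _) _.
exact: lerD.
Qed.

End Schwarz.

End Composition.

(** * Smoothness by local extension and one-sided derivatives *)

Section Smooth.
Variable R : realType.
Notation V := 'rV[R]_3.
Notation e := (@basis_vec R).
Implicit Types (b : bool) (i j : 'I_3) (x : V) (f g : V -> R) (s : seq 'I_3).

Definition iter_pd b s f : V -> R := foldr (pd b) f s.

Lemma pderivE : @pderiv R = pd true.
Proof. by rewrite pd.unlock. Qed.

Lemma near_forall (P : 'I_3 -> set V) x : (forall j, nbhs x (P j)) ->
  nbhs x [set y | forall j, P j y].
Proof. exact: (@filter_forall _ _ P (nbhs x) (nbhs_filter x)). Qed.

Lemma nbhs_withinW (D P : set V) x : nbhs x P -> within D (nbhs x) P.
Proof. by rewrite /within /=; apply: filterS => y Py _. Qed.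

Lemma cvg_rV (T : Type) (F : set_system T) (FF : Filter F) (phi : T -> V) (l : V) :
  (forall j, (fun t => phi t ord0 j) @ F --> l ord0 j) -> phi @ F --> l.
Proof.
move=> H P /nbhs_distP[d d0 dP].
have : \forall t \near F, forall j, `|phi t ord0 j - l ord0 j| < d.
  apply: filter_forall => j; have /cvgrPdist_lt/(_ _ d0) := H j.
  by apply: filterS => t; rewrite distrC.
by apply: filterS => t Ht; apply: dP; apply: norm_lt_coord => // j; rewrite !mxE.
Qed.

Lemma withinT_id (T : Type) (F : set_system T) : Filter F -> within setT F = F.
Proof.
move=> FF; apply/seteqP; split=> P /=; rewrite /within /=.
  by apply: filterS => y; apply.
by apply: filterS => y Py _.
Qed.

Lemma derive_quot f x i : (fun h : R => h^-1 *: ((f \o shift x) (h *: e i) - f x))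
   = (fun h : R => (f (x + h *: e i) - f x) / h).
Proof. by apply/funext => h /=; rewrite [LHS]mulrC [h *: _ + x]addrC. Qed.

Lemma pd_filterF i x : pd_filter false i x = (0 : R)^'.
Proof. exact: withinT_id. Qed.

Lemma derive_pd f i : 'D_(e i) f = pd false i f.
Proof. by apply/funext => x; rewrite /derive pd.unlock derive_quot pd_filterF. Qed.

Lemma derivable_pd f x i :
  derivable f x (e i) <-> exists l, is_pd false i f x l.
Proof. by rewrite /derivable derive_quot /is_pd pd_filterF; split=> /cvg_ex. Qed.

Lemma iter_pderivE s f : iter_pderiv s f = iter_pd true s f.
Proof. by rewrite /iter_pderiv pderivE. Qed.

Lemma iter_deriveE s f : iter_derive s f = iter_pd false s f.
Proof. by elim: s => //= i s ->; rewrite derive_pd. Qed.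

Lemma iter_pd_rcons b s i f : iter_pd b (rcons s i) f = iter_pd b s (pd b i f).
Proof. by rewrite /iter_pd foldr_rcons. Qed.

Section Families.
Variable Y : topologicalType.
Implicit Types (F G : Y -> V -> R) (y : Y).

Lemma fam_pd b A F i : fam b A F -> fam b A (fun y => pd b i (F y)).
Proof. by move=> H k; apply: famk_pd; exact: H. Qed.

Lemma fam_iter_pd b A F s : fam b A F -> fam b A (fun y => iter_pd b s (F y)).
Proof. by elim: s => //= i s IH /IH; exact: fam_pd. Qed.

Lemma famP b A F : fam b A F <-> forall s y x, A x ->
   jcont b (fun y => iter_pd b s (F y)) y x /\
   forall i, exists l, is_pd b i (iter_pd b s (F y)) x l.
Proof.
split.
  move=> H s y x Ax; have [cF HF] := fam_iter_pd s H 1%N y Ax.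
  by split=> // i; have [] := HF i.
move=> H k; elim: k F H => [|k IH] F H y x Ax.
  by split=> //; have [] := H [::] y x Ax.
split; first by have [] := H [::] y x Ax.
move=> i; split; first by have [_] := H [::] y x Ax; apply.
(* [smk] peels off the innermost derivative whereas [iter_pd] adds the outermost one, hence the
   passage through [rcons]. *)
by apply: (IH (fun y => pd b i (F y))) => // s y' x' Ax'; rewrite -!iter_pd_rcons;
  under eq_fun do rewrite -iter_pd_rcons; exact: H.
Qed.

Lemma fam_local b A F : (forall x, A x -> exists B, B x /\ fam b B F) -> fam b A F.
Proof. by move=> H k y x /H [B [Bx HB]]; exact: HB. Qed.

Lemma fam_sub b A B F : A `<=` B -> fam b B F -> fam b A F.
Proof. by move=> AB H k y x /AB; exact: H. Qed.

Lemma fam_pullback (Y' : topologicalType) (h : Y' -> Y) b A F : continuous h ->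
  fam b A F -> fam b A (fun z => F (h z)).
Proof.
move=> hc HF k; elim: k F HF => [|k IH] F HF y x Ax;
    (have jF : jcont b (fun z => F (h z)) y x
      by apply/jcontP => eps; have [/jcontP H _] := HF 0%N (h y) x Ax;
      move=> /H[U Uy [d d0 dP]]; exists (h @^-1` U); [exact: hc|];
      exists d => // y' x' ? ? ?; exact: dP); split=> // i; split.
  by have [_ /(_ i)[]] := HF 1%N (h y) x Ax.
by apply: (IH (fun y => pd b i (F y))) => //; exact: fam_pd.
Qed.

End Families.

(* A single function is a family over [bool] (a topological space, unlike
   [unit]). *)
Lemma jcont_single b f (y : bool) x :
  jcont b (fun _ : bool => f) y x <-> f @ within (hs b) (nbhs x) --> f x.
Proof.
split; first exact: (@jcont_slice _ _ b (fun _ : bool => f)).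
move=> H; apply: (@cvg_comp _ _ _ snd f) H; exact: cvg_snd.
Qed.

Lemma fam_const (Y : topologicalType) b A f :
  fam b A (fun _ : bool => f) -> fam b A (fun _ : Y => f).
Proof.
exact: (@fam_pullback bool Y (fun=> true) b A (fun=> f) (fun _ => cvg_cst _)).
Qed.

Lemma open_ropen (W : set V) : open W -> ropen false W.
Proof.
by move=> oW; split=> // x Wx; rewrite /hs withinT_id; exact: open_nbhs_nbhs.
Qed.

Lemma smooth_openP (W : set V) f :
  smooth_open W f <-> fam false W (fun _ : bool => f).
Proof.
split.
  move=> H; apply/famP => s y0 x Wx; have [cf df] := H s x Wx.
  rewrite -iter_deriveE; split; last by move=> i; apply/derivable_pd; exact: df.
  by apply/jcont_single; rewrite withinT_id.
move=> /famP H s x Wx; have [cf df] := H s true x Wx.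
rewrite iter_deriveE; split; last by move=> i; apply/derivable_pd; exact: df.
by move/jcont_single : cf; rewrite withinT_id.
Qed.

Definition smooth_at f x :=
  exists W, [/\ open W, W x & fam false W (fun _ : bool => f)].

Lemma smooth_at_near f x : smooth_at f x -> \forall y \near x, smooth_at f y.
Proof.
move=> [W [oW Wx fW]]; have := open_nbhs_nbhs (conj oW Wx).
by apply: filterS => y Wy; exists W.
Qed.

Lemma smooth_at_ext f g x : (\forall y \near x, f y = g y) ->
  smooth_at f x -> smooth_at g x.
Proof.
move=> fg [W [oW Wx fW]].
pose U := W `&` [set y | f y = g y]^°.
have oU : open U by apply: openI => //; exact: open_interior.
exists U; split=> //.
move=> k; apply: (@famk_ext _ _ _ _ (open_ropen oU) _ (fun=> f)).
  by move=> y; rewrite inE => -[_ /interior_subset].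
by apply: fam_sub (fW) _ => y [].
Qed.

Lemma smooth_at_cvg f x : smooth_at f x -> f @ x --> f x.
Proof.
move=> [W [oW Wx fW]]; have [/jcont_single + _] := fW 0%N true x Wx.
by rewrite withinT_id.
Qed.

Lemma smooth_at_cst c x : smooth_at (fun=> c) x.
Proof.
exists setT; split=> //; first exact: openT.
move=> k; apply: famk_cst; last exact: cst_continuous.
exact: open_ropen openT.
Qed.

Lemma smooth_at_coord j x : smooth_at (fun y => y ord0 j) x.
Proof.
exists setT; split=> //; first exact: openT.
move=> k; apply: famk_coord; exact: open_ropen openT.
Qed.

Lemma smooth_at2 f g x :
  smooth_at f x -> smooth_at g x -> exists W, [/\ open W, W x,
    fam false W (fun _ : bool => f) & fam false W (fun _ : bool => g)].
Proof.
move=> [W [oW Wx fW]] [U [oU Ux gU]]; exists (W `&` U); split=> //.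
- exact: openI.
- by apply: fam_sub (fW) => y [].
- by apply: fam_sub (gU) => y [].
Qed.

Lemma smooth_atD f g x : smooth_at f x -> smooth_at g x ->
  smooth_at (fun y => f y + g y) x.
Proof.
move=> sf sg; have [W [oW Wx fW gW]] := smooth_at2 sf sg.
by exists W; split=> // k; exact: (famkD (open_ropen oW) (fW k) (gW k)).
Qed.

Lemma smooth_atM f g x : smooth_at f x -> smooth_at g x ->
  smooth_at (fun y => f y * g y) x.
Proof.
move=> sf sg; have [W [oW Wx fW gW]] := smooth_at2 sf sg.
by exists W; split=> // k; exact: (famkM (open_ropen oW) (fW k) (gW k)).
Qed.

Lemma smooth_atV f x : f x != 0 -> smooth_at f x ->
  smooth_at (fun y => (f y)^-1) x.
Proof.
move=> fx0 sf; have f0 : \forall y \near x, f y != 0.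
  exact: cvgr_neq0 (smooth_at_cvg sf) fx0.
case: sf => W [oW Wx fW].
pose U := W `&` [set y | f y != 0]^°.
have oU : open U by apply: openI => //; exact: open_interior.
exists U; split=> // k; apply: (@famkV _ _ _ _ (open_ropen oU) k (fun=> f)).
  by move=> _ y [_ /interior_subset].
by apply: fam_sub (fW) _ => y [].
Qed.

Lemma smooth_at_pd f i x : smooth_at f x -> smooth_at (pd false i f) x.
Proof. by move=> [W [oW Wx /(fam_pd i) fW]]; exists W. Qed.

Lemma smooth_at_comp f (phi : V -> V) x : smooth_at f (phi x) ->
  (forall j, smooth_at (fun y => phi y ord0 j) x) ->
  smooth_at (fun y => f (phi y)) x.
Proof.
move=> [W [oW Wx fW]] sphi.
have phic : phi @ x --> phi x.
  by apply: (cvg_rV (nbhs_filter x)) => j; exact: smooth_at_cvg (sphi j).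
have H : \forall y \near x, W (phi y) /\ forall j, smooth_at (fun y => phi y ord0 j) y.
  have WN : nbhs (phi x) W by apply: open_nbhs_nbhs.
  have H1 : \forall y \near x, W (phi y) := phic _ WN.
  suff H2 : \forall y \near x, forall j, smooth_at (fun y => phi y ord0 j) y.
    by apply: filterS2 H1 H2.
  by apply: near_forall => j; exact: smooth_at_near.
pose U := [set y | W (phi y) /\ forall j, smooth_at (fun y => phi y ord0 j) y]^°.
have oU : open U by exact: open_interior.
exists U; split=> // k.
apply: (@famk_comp _ _ false false U W k (fun=> f) phi).
- exact: open_ropen.
- exact: open_ropen.
- by move=> y /interior_subset[].
- move=> j y0 y /interior_subset[_ /(_ j)] [U' [_ U'y]].
  by apply.
- exact: fW.
Qed.

(** Passes to germs: shrinking the open set to the interior of the locus of agreement turns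
    agreement near [x] into agreement on a whole open set. *)
Lemma smooth_onP (A : set V) f : smooth_on A f <-> forall x, A x ->
  exists2 F, smooth_at F x & \forall y \near x, A y -> F y = f y.
Proof.
split=> H x Ax.
  have [W [F [oW Wx sF FE]]] := H x Ax.
  exists F; first by exists W; split=> //; apply/smooth_openP.
  have := open_nbhs_nbhs (conj oW Wx).
  by apply: filterS => y Wy Ay; apply: FE; rewrite inE.
have [F [W [oW Wx FW]] FE] := H x Ax.
exists (W `&` [set y | A y -> F y = f y]^°), F; split.
- by apply: openI => //; exact: open_interior.
- by split.
- by apply/smooth_openP; apply: fam_sub FW => y [].
- by move=> y; rewrite inE => -[[_ /interior_subset]]; apply.
Qed.

Lemma smooth_on_cst (A : set V) c : smooth_on A (fun=> c).
Proof.
apply/smooth_onP => x Ax; exists (fun=> c); first exact: smooth_at_cst.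
by near=> y.
Unshelve. all: by end_near. Qed.

Lemma smooth_on_coord (A : set V) j : smooth_on A (fun x => x ord0 j).
Proof.
apply/smooth_onP => x Ax; exists (fun x => x ord0 j); first exact: smooth_at_coord.
by near=> y.
Unshelve. all: by end_near. Qed.

Lemma smooth_onD A f g : smooth_on A f -> smooth_on A g ->
  smooth_on A (fun x => f x + g x).
Proof.
move=> /smooth_onP Hf /smooth_onP Hg; apply/smooth_onP => x Ax.
have [F sF FE] := Hf x Ax; have [G sG GE] := Hg x Ax.
exists (fun x => F x + G x); first exact: smooth_atD.
by apply: filterS2 FE GE => y H1 H2 Ay; rewrite H1 // H2.
Qed.

Lemma smooth_onM A f g : smooth_on A f -> smooth_on A g ->
  smooth_on A (fun x => f x * g x).
Proof.
move=> /smooth_onP Hf /smooth_onP Hg; apply/smooth_onP => x Ax.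
have [F sF FE] := Hf x Ax; have [G sG GE] := Hg x Ax.
exists (fun x => F x * G x); first exact: smooth_atM.
by apply: filterS2 FE GE => y H1 H2 Ay; rewrite H1 // H2.
Qed.

Lemma smooth_onV A f : (forall x, A x -> f x != 0) -> smooth_on A f ->
  smooth_on A (fun x => (f x)^-1).
Proof.
move=> f0 /smooth_onP Hf; apply/smooth_onP => x Ax.
have [F sF FE] := Hf x Ax.
exists (fun x => (F x)^-1).
  by apply: smooth_atV => //; rewrite (nbhs_singleton FE) //; exact: f0.
by apply: filterS FE => y H1 Ay; rewrite H1.
Qed.

Lemma smooth_on_local A f g : (forall x, A x -> exists B, [/\ nbhs x B,
   (forall y, B y -> A y -> f y = g y) & smooth_on (A `&` B) f]) -> smooth_on A g.
Proof.
move=> H; apply/smooth_onP => x Ax; have [B [Bx fg /smooth_onP sf]] := H x Ax.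
have [F sF FE] := sf x (conj Ax (nbhs_singleton Bx)); exists F => //.
by apply: filterS2 Bx FE => y By FE Ay; rewrite FE // fg.
Qed.

Lemma smooth_on_sub A B f : A `<=` B -> smooth_on B f -> smooth_on A f.
Proof. by move=> AB H x /AB /H [W [F [? ? ? FE]]]; exists W, F; split=> // y;
  rewrite inE => -[Wy /AB By]; apply: FE; rewrite inE. Qed.

Lemma smooth_on_ext A f g : (forall x, A x -> f x = g x) ->
  smooth_on A f -> smooth_on A g.
Proof.
move=> fg sf; apply: (@smooth_on_local _ f) => x Ax; exists setT; split.
- exact: filterT.
- by move=> y _; exact: fg.
- by rewrite setIT.
Qed.

Lemma smooth_on_comp A B f (phi : V -> V) : (forall x, A x -> B (phi x)) ->
  (forall j, smooth_on A (fun x => phi x ord0 j)) -> smooth_on B f ->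
  smooth_on A (fun x => f (phi x)).
Proof.
move=> AB sphi /smooth_onP sf; apply/smooth_onP => x Ax.
have [F sF FE] := sf _ (AB _ Ax).
have H j : exists2 G, smooth_at G x & \forall y \near x, A y -> G y = phi y ord0 j.
  by move/smooth_onP : (sphi j); apply.
pose G j := s2val (cid2 (H j)).
have sG j : smooth_at (G j) x := s2valP (cid2 (H j)).
have GE j : \forall y \near x, A y -> G j y = phi y ord0 j := s2valP' (cid2 (H j)).
(* Off [A] the point [Phi y] may leave [B] and even the half-space, so it is composed with the
   extension [F] and not with [f]. *)
pose Phi y : V := \row_j G j y.
have PhiE : \forall y \near x, A y -> Phi y = phi y.
  have : \forall y \near x, forall j, A y -> G j y = phi y ord0 j.
    exact: (near_forall GE).
  by apply: filterS => y HG Ay; apply/rowP => j; rewrite mxE HG.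
have Phix : Phi x = phi x := nbhs_singleton PhiE Ax.
have sPhi j : smooth_at (fun y => Phi y ord0 j) x.
  by apply: smooth_at_ext (sG j); near=> y; rewrite mxE.
exists (fun y => F (Phi y)); first by apply: smooth_at_comp => //; rewrite Phix.
have Phic : Phi @ x --> phi x.
  by rewrite -Phix; apply: (cvg_rV (nbhs_filter x)) => j; exact: smooth_at_cvg (sPhi j).
apply: filterS2 PhiE (Phic _ FE) => y H1 H2 Ay.
by rewrite H1 //; rewrite /= H1 // in H2; rewrite H2 //; exact: AB.
Unshelve. all: by end_near. Qed.

Lemma is_pd_restrict f i x l : is_pd false i f x l -> is_pd true i f x l.
Proof.
rewrite /is_pd pd_filterF; apply: cvg_trans; apply: cvg_app.
exact: cvg_within.
Qed.

Lemma ropenI b (W : set V) A : open W -> ropen b A -> ropen b (A `&` W).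
Proof.
move=> oW [Ahs Aop]; split=> x [Ax Wx]; first exact: Ahs.
have H : within (hs b) (nbhs x) W.
  by apply: nbhs_withinW; exact: open_nbhs_nbhs.
by apply: filterS2 (Aop _ Ax) H.
Qed.

Lemma ropen_hs b : ropen b (hs b : set V).
Proof. by split=> // x hx; rewrite /within /=; near=> y. Unshelve. all: by end_near. Qed.

(** Where a function is smooth across the boundary plane, its one-sided derivative is the ordinary
    one; so the derivatives [pd true] of each order can be traded for [pd false]. *)
Lemma fam_restrict W f : open W -> fam false W (fun _ : bool => f) ->
  fam true (hs true `&` W) (fun _ : bool => f).
Proof.
move=> oW fW k; elim: k f fW => [|k IH] f fW.
  move=> y0 x [hx Wx]; split=> //; apply/jcont_single.
  have [/jcont_single + _] := fW 0%N true x Wx; rewrite withinT_id.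
  by apply: cvg_trans; apply: cvg_app; exact: cvg_within.
have oA := ropenI oW (@ropen_hs true).
apply: (@famk_step _ _ _ _ oA k _ (fun i _ => pd false i f)).
- move=> y0 x [hx Wx]; apply/jcont_single.
  have [/jcont_single + _] := fW 0%N true x Wx; rewrite withinT_id.
  by apply: cvg_trans; apply: cvg_app; exact: cvg_within.
- move=> i y0 x [hx Wx]; apply: is_pd_restrict; apply: pd_is => //.
  by have [_ /(_ i)[]] := fW 1%N true x Wx.
- by move=> i; apply: IH; exact: (@fam_pd bool false W (fun=> f)).
Qed.

(** A derivative of a local extension extends the one-sided derivative, and does so on a
    neighborhood; this is what makes [smooth_on] stable under [pd true]. *)
Lemma smooth_on_pdE A f F x i : ropen true A -> A x -> smooth_at F x ->
  (\forall y \near x, A y -> F y = f y) ->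
  \forall y \near x, A y -> pd false i F y = pd true i f y.
Proof.
move=> oA Ax [W [oW Wx fW]] FE.
pose U := W `&` [set y | A y -> F y = f y]^°.
have oU : open U by apply: openI => //; exact: open_interior.
have : nbhs x U by apply: open_nbhs_nbhs.
apply: filterS => y [Wy Ey] Ay; apply/esym.
have hy := oA.1 _ Ay; apply: is_pdE => //.
apply: (@is_pd_local _ _ _ F) => //.
  have H : within (hs true) (nbhs y) [set y | A y -> F y = f y]^°.
    by apply: nbhs_withinW; exact: open_nbhs_nbhs (conj (@open_interior _ _) Ey).
  by apply: filterS2 (oA.2 _ Ay) H => z Az /interior_subset; apply.
apply: is_pd_restrict; apply: pd_is => //.
by have [_ /(_ i)[]] := fW 1%N true y Wy.
Qed.

Lemma smooth_on_pd A f i : ropen true A -> smooth_on A f ->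
  smooth_on A (pd true i f).
Proof.
move=> oA /smooth_onP sf; apply/smooth_onP => x Ax.
have [F sF FE] := sf x Ax; exists (pd false i F); first exact: smooth_at_pd.
exact: smooth_on_pdE.
Qed.

Lemma smooth_on_fam (Y : topologicalType) A f : ropen true A -> smooth_on A f ->
  fam true A (fun _ : Y => f).
Proof.
move=> oA /smooth_onP sf; apply: fam_const; apply: fam_local => x Ax.
have [F [W [oW Wx FW]] FE] := sf x Ax.
pose U := W `&` [set y | A y -> F y = f y]^°.
have oU : open U by apply: openI => //; exact: open_interior.
exists (A `&` U); split=> // k.
apply: (@famk_ext _ _ _ _ (ropenI oU oA) _ (fun=> F)).
  by move=> y; rewrite inE => -[Ay [_ /interior_subset H]] _; exact: H.
apply: fam_sub (fam_restrict oW FW) _ => y [Ay [Wy _]]; split=> //.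
exact: oA.1.
Qed.

End Smooth.

(** * Smooth families and the topology of the space of metrics *)

Section SmoothFamilies.
Variable R : realType.
Notation V := 'rV[R]_3.
Notation e := (@basis_vec R).
Variables (Y : topologicalType).
Implicit Types (A B : set V) (F G : Y -> V -> R).

(** The clauses are kept side by side: recovering local smooth extensions from one-sided derivatives
    would take a Whitney or Seeley extension theorem, and smoothness for each [y] says nothing about
    continuity in [y]. *)
Definition sfam A F := (forall y, smooth_on A (F y)) /\ fam true A F.

Section Fixed.
Variable A : set V.
Hypothesis oA : ropen true A.

Lemma sfam_ext F G : (forall y x, A x -> F y x = G y x) -> sfam A F -> sfam A G.
Proof.
move=> FG [sF fF]; split.
  by move=> y; apply: smooth_on_ext (sF y) => x; exact: FG.
move=> k; apply: (famk_ext oA) (fF k) => x; rewrite inE => Ax y; exact: FG.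
Qed.

Lemma sfam_single (f : V -> R) : smooth_on A f -> sfam A (fun _ => f).
Proof. by move=> sf; split=> //; exact: smooth_on_fam. Qed.

Lemma sfam_const (c : R) : sfam A (fun _ _ => c).
Proof. by apply: sfam_single; exact: smooth_on_cst. Qed.

Lemma sfamD F G : sfam A F -> sfam A G -> sfam A (fun y x => F y x + G y x).
Proof.
move=> [sF fF] [sG fG]; split; first by move=> y; exact: smooth_onD.
by move=> k; exact: (famkD oA (fF k) (fG k)).
Qed.

Lemma sfamM F G : sfam A F -> sfam A G -> sfam A (fun y x => F y x * G y x).
Proof.
move=> [sF fF] [sG fG]; split; first by move=> y; exact: smooth_onM.
by move=> k; exact: (famkM oA (fF k) (fG k)).
Qed.

Lemma sfamN F : sfam A F -> sfam A (fun y x => - F y x).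
Proof.
move=> sF; apply: (@sfam_ext (fun y x => -1 * F y x)).
  by move=> y x _; rewrite mulN1r.
apply: sfamM => //; exact: sfam_const.
Qed.

Lemma sfamB F G : sfam A F -> sfam A G -> sfam A (fun y x => F y x - G y x).
Proof. by move=> sF sG; apply: sfamD => //; exact: sfamN. Qed.

Lemma sfamV F : (forall y x, A x -> F y x != 0) -> sfam A F ->
  sfam A (fun y x => (F y x)^-1).
Proof.
move=> F0 [sF fF]; split.
  by move=> y; apply: smooth_onV => //; exact: F0.
by move=> k; exact: (famkV oA F0 (fF k)).
Qed.

Lemma sfam_sum (I : Type) (s : seq I) (P : pred I) (F : I -> Y -> V -> R) :
  (forall m, sfam A (F m)) -> sfam A (fun y x => \sum_(m <- s | P m) F m y x).
Proof.
move=> H; elim: s => [|m s IH].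
  apply: (@sfam_ext (fun _ _ => 0)); last exact: sfam_const.
  by move=> y x _; rewrite big_nil.
case Pm: (P m); last first.
  by apply: sfam_ext IH => y x _; rewrite big_cons Pm.
apply: sfam_ext (sfamD (H m) IH) => y x _; by rewrite big_cons Pm.
Qed.

Lemma sfam_prod (I : Type) (s : seq I) (F : I -> Y -> V -> R) :
  (forall m, sfam A (F m)) -> sfam A (fun y x => \prod_(m <- s) F m y x).
Proof.
move=> H; elim: s => [|m s IH].
  apply: (@sfam_ext (fun _ _ => 1)); last exact: sfam_const.
  by move=> y x _; rewrite big_nil.
apply: sfam_ext (sfamM (H m) IH) => y x _; by rewrite big_cons.
Qed.

Lemma sfam_pd F i : sfam A F -> sfam A (fun y => pd true i (F y)).
Proof.
move=> [sF fF]; split; last exact: fam_pd.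
by move=> y; exact: smooth_on_pd.
Qed.

Lemma sfam_det n (M : Y -> V -> 'M[R]_n) :
  (forall i j, sfam A (fun y x => M y x i j)) ->
  sfam A (fun y x => \det (M y x)).
Proof.
move=> H; apply: sfam_sum => s; apply: sfamM; first exact: sfam_const.
exact: sfam_prod.
Qed.

(** Cramer's rule writes the entries of the inverse as quotients of determinants. *)
Lemma sfam_invmx n (M : Y -> V -> 'M[R]_n) i j :
  (forall i j, sfam A (fun y x => M y x i j)) ->
  (forall y x, A x -> M y x \in unitmx) ->
  sfam A (fun y x => invmx (M y x) i j).
Proof.
move=> H uM; apply: (@sfam_ext (fun y x => (\det (M y x))^-1 *
   ((-1) ^+ (j + i) * \det (row' j (col' i (M y x)))))).
  by move=> y x Ax; rewrite /invmx (uM y x Ax) !mxE.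
apply: sfamM.
  apply: sfamV; last exact: sfam_det.
  by move=> y x Ax; have := uM y x Ax; rewrite unitmxE unitfE.
apply: sfamM; first exact: sfam_const.
apply: sfam_det => k l; apply: sfam_ext (H (lift j k) (lift i l)) => y x _.
by rewrite !mxE.
Qed.

Lemma sfam_mulmx m n p (M : Y -> V -> 'M[R]_(m, n)) (N : Y -> V -> 'M[R]_(n, p)) i j :
  (forall i j, sfam A (fun y x => M y x i j)) ->
  (forall i j, sfam A (fun y x => N y x i j)) ->
  sfam A (fun y x => (M y x *m N y x) i j).
Proof.
move=> HM HN; apply: (@sfam_ext (fun y x => \sum_k M y x i k * N y x k j)).
  by move=> y x _; rewrite mxE.
by apply: sfam_sum => k; exact: sfamM.
Qed.

End Fixed.

Lemma sfam_sub A B F : A `<=` B -> sfam B F -> sfam A F.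
Proof.
move=> AB [sF fF]; split; last exact: fam_sub fF.
by move=> y; exact: smooth_on_sub (sF y).
Qed.

Lemma sfam_local A F : (forall x, A x -> exists B, nbhs x B /\
   sfam (A `&` B) F) -> sfam A F.
Proof.
move=> H; split.
  move=> y; apply: (@smooth_on_local _ _ (F y)) => x /H [B [Bx [sF _]]].
  by exists B.
apply: fam_local => x Ax; have [B [Bx [_ fF]]] := H x Ax.
by exists (A `&` B); split=> //; split=> //; exact: nbhs_singleton.
Qed.

Lemma sfam_comp A B F (phi : V -> V) : ropen true A -> ropen true B ->
  (forall x, A x -> B (phi x)) ->
  (forall j, smooth_on A (fun x => phi x ord0 j)) ->
  sfam B F -> sfam A (fun y x => F y (phi x)).
Proof.
move=> oA oB AB sphi [sF fF]; split.
  by move=> y; exact: smooth_on_comp (sF y).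
move=> k; apply: (famk_comp oA oB AB) (fF k) => j.
exact: smooth_on_fam.
Qed.

End SmoothFamilies.

Lemma cimg_ropen (R : realType) (X : topologicalType) (c : chart R X) : ropen true (cimg c).
Proof.
have [W oW ->] := cimg_open c; rewrite setIC; apply: ropenI => //.
exact: ropen_hs.
Qed.

(** * The topology of the space of metrics in terms of families *)

Section RiemannianTopology.
Variables (R : realType) (X : manifold3 R).
Notation V := 'rV[R]_3.

Lemma compact_half_ball (x : V) r :
  compact [set x' : V | hs true x' /\ `|x' - x| <= r].
Proof.
apply: bounded_closed_compact.
  exists (`|x| + r); split; first by rewrite num_real.
  move=> M MM x' [_ Hx']; apply: le_trans (ltW MM).
  by rewrite -[x'](subrK x) addrC (le_trans (ler_normD _ _)) // lerD2l.
apply: closedI.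
  have -> : hs true = (fun x' : V => x' ord0 ord0) @^-1` [set t : R | 0 <= t] by [].
  by apply: closed_comp; [move=> z _; exact: coord_continuous|exact: closed_ge].
have -> : (fun x' : V => is_true (`|x' - x| <= r)) =
  (fun x' : V => `|x' - x|) @^-1` [set t : R | t <= r] by [].
apply: closed_comp; last exact: closed_le.
move=> z _; apply: (@cvg_comp V V R (fun w => w - x) (fun w => `|w|) (nbhs z)
  (nbhs (z - x)) (nbhs `|z - x|)); last exact: norm_continuous.
apply: (cvg_rV (nbhs_filter z)) => j; rewrite !mxE.
under eq_fun do rewrite !mxE.
by apply: cvgB; [exact: coord_continuous|exact: cvg_cst].
Qed.

Lemma mx_norm_lt m n (M : 'M[R]_(m.+1, n.+1)) d : 0 < d ->
  `|M| < d <-> forall i j, `|M i j| < d.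
Proof.
move=> d0; rewrite [in X in X <-> _]/Num.norm /= mx_normrE; split.
  by move=> /bigmax_ltP[_ H] i j; exact: (H (i, j)).
by move=> H; apply/bigmax_ltP; split=> // -[i j] _ /=; exact: H.
Qed.

Lemma riem_cvgP (T : Type) (F : set_system T) (FF : Filter F)
    (f : T -> riemannian X) (g : riemannian X) :
  f @ F --> g <->
  forall (c : atlas X) s (K : set V), compact K -> K `<=` cimg (val c) ->
    forall eps, 0 < eps -> \forall t \near F, forall x i j, K x ->
    `|iter_pderiv s (fun y => f t c y i j) x -
      iter_pderiv s (fun y => g c y i j) x| < eps.
Proof.
split.
- move=> fg c s K cK Kc eps eps0.
  have Hj : (@jets R X \o f) @ F --> (jets g).
    by apply: cvg_comp fg _; exact: initial_continuous.
  have Hk : (fun t => jets (f t) (c, s) :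
     {family compactly_in (cimg (val c)), V -> 'M[R]_3}) @ F --> (jets g (c, s)).
    move=> P HP; have /cvg_sup/(_ (c, s)) := Hj.
    move=> /(_ [set z | P (z (c, s))]); apply.
    exact: (@initial_continuous _ _
      (fun z : (forall k : atlas X * seq 'I_3, {family compactly_in
        (cimg (val k.1)), V -> 'M[R]_3}) => z (c, s)) (jets g) P HP).
  have /fam_cvgP/(_ K (conj Kc cK)) H := Hk.
  have /H : @nbhs _ {uniform` K -> 'M[R]_3} (jets g (c, s))
     [set h | forall x, K x -> `|h x - jets g (c, s) x| < eps].
    apply/uniform_nbhs; exists [set z | `|z.2 - z.1| < eps]; split.
      rewrite -entourage_ballE; exists eps => //= -[z1 z2] /=.
      by rewrite -ball_normE /= distrC.
    by move=> h /= Hh x Kx; exact: Hh.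
  move=> HH; have {}HH : F [set t | forall x, K x ->
    `|jets (f t) (c, s) x - jets g (c, s) x| < eps] := HH.
  apply: filterS HH => t /= Ht x i j Kx.
  have /(mx_norm_lt _ eps0)/(_ i j) := Ht x Kx.
  by rewrite !mxE.
- move=> H; have Hj : (@jets R X \o f) @ F --> (jets g).
    apply/cvg_sup => -[c s] P [_ [[Q oQ <-] Qg QP]].
    apply: filterS QP _.
    have NQ : nbhs (jets g (c, s) : {family compactly_in (cimg (val c)), V -> 'M[R]_3}) Q.
      exact: open_nbhs_nbhs.
    suff : (fun t => jets (f t) (c, s) :
      {family compactly_in (cimg (val c)), V -> 'M[R]_3}) @ F --> (jets g (c, s)).
      by move=> /(_ _ NQ).
    apply/fam_cvgP => K [Kc cK] P' /uniform_nbhs [E [entE EP]].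
    have := entE; rewrite -entourage_ballE => -[eps /= eps0 epsE].
    have := H c s K cK Kc eps eps0.
    apply: filterS => t Ht; apply: EP => x Kx; apply: epsE => /=.
    rewrite -ball_normE /=; apply/mx_norm_lt => // i j.
    by rewrite !mxE distrC; exact: Ht.
  move=> P [_ [[Q oQ <-] Qg QP]]; apply: filterS QP _.
  exact: (Hj _ (open_nbhs_nbhs (conj oQ Qg))).
Qed.

(** Locally uniform convergence and joint continuity agree because chart images are locally compact:
    one direction tests the convergence on a compact half-ball around [x], the other covers [K] by
    the neighborhoods that joint continuity provides. *)
Lemma riem_continuousP (Y : topologicalType) (f : Y -> riemannian X) :
  continuous f <-> forall (c : atlas X) i j,
    sfam (cimg (val c)) (fun y x => f y c x i j).
Proof.
split.
- move=> cf c i j.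
  have sm y : smooth_on (cimg (val c)) (fun x => f y c x i j) by exact: metric_smooth.
  split=> //; apply/famP => s y x cx.
  have oc := cimg_ropen (val c); split; last first.
    have /famP/(_ s true x cx)[_] := @smooth_on_fam _ bool _ _ oc (sm y).
    exact.
  apply/jcontP => eps eps0.
  have /famP/(_ s true x cx)[] := @smooth_on_fam _ bool _ _ oc (sm y).
  have eps20 : 0 < eps / 2 by rewrite divr_gt0.
  move=> /jcontP/(_ _ eps20)[U0 U0y [d d0 dP]] _.
  have /nbhs_distP[r r0 rP] : nbhs x [set x' | hs true x' -> cimg (val c) x'].
    exact: oc.2.
  pose K : set V := [set x' | hs true x' /\ `|x' - x| <= r / 2].
  have Kc : K `<=` cimg (val c).
    by move=> x' [hx' xr]; apply: rP => //; apply: le_lt_trans xr _; lra.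
  have cK : compact K by exact: compact_half_ball.
  have /riem_cvgP H := cf y.
  have NU := H c s K cK Kc (eps / 2) eps20.
  exists [set t | forall x i j, K x ->
    `|iter_pderiv s (fun z => f t c z i j) x -
      iter_pderiv s (fun z => f y c z i j) x| < eps / 2]; first exact: NU.
  exists (Num.min d (r / 2)); first by rewrite lt_min d0 divr_gt0.
  move=> y' x' Uy' hx'; rewrite lt_min => /andP[dx rx].
  have Kx' : K x' by split=> //; exact: ltW.
  have := Uy' x' i j Kx'; rewrite !iter_pderivE => H1.
  have H2 := dP true x' (nbhs_singleton U0y) hx' dx.
  have -> : iter_pd true s (fun x => f y' c x i j) x' -
     iter_pd true s (fun x => f y c x i j) x =
    (iter_pd true s (fun x => f y' c x i j) x' -
      iter_pd true s (fun x => f y c x i j) x') +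
    (iter_pd true s (fun x => f y c x i j) x' -
      iter_pd true s (fun x => f y c x i j) x) by rewrite addrA subrK.
  by rewrite [eps]splitr (le_lt_trans (ler_normD _ _)) // ltrD.
- move=> H y; apply/riem_cvgP => c s K cK Kc eps eps0.
  suff main i j : \forall t \near y, forall x, K x ->
     `|iter_pderiv s (fun z => f t c z i j) x -
       iter_pderiv s (fun z => f y c z i j) x| < eps.
    have : \forall t \near y, forall i j x, K x ->
       `|iter_pderiv s (fun z => f t c z i j) x -
         iter_pderiv s (fun z => f y c z i j) x| < eps.
      by apply: filter_forall => i; apply: filter_forall => j; exact: main.
    by apply: filterS => t Ht x i j; exact: Ht.
  have /compact_near_coveringP/near_covering_withinP := cK.
  move=> /(_ Y (nbhs y) (fun t x =>
    `|iter_pderiv s (fun z => f t c z i j) x -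
      iter_pderiv s (fun z => f y c z i j) x| < eps)); apply => x Kx.
  have eps20 : 0 < eps / 2 by rewrite divr_gt0.
  have [_ /famP/(_ s y x (Kc _ Kx))[/jcontP/(_ _ eps20)[U Uy [d d0 dP]] _]] := H c i j.
  exists ([set x' | `|x' - x| < d], U).
    by split=> //=; apply/nbhs_distP; exists d.
  move=> [x' t] /= [dx Ut] Kx'.
  have hx' : hs true x' by apply: (cimg_ropen (val c)).1; exact: Kc.
  have H1 := dP t x' Ut hx' dx.
  have H2 := dP y x' (nbhs_singleton Uy) hx' dx.
  rewrite !iter_pderivE [eps]splitr.
  apply: le_lt_trans (ltrD H1 H2).
  by rewrite [X in _ <= _ + X]distrC; exact: ler_distD.
Qed.

End RiemannianTopology.

(** * Curvature and changes of coordinates *)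

Section PointwiseCalculus.
Variable R : realType.
Notation V := 'rV[R]_3.
Notation e := (@basis_vec R).
Variables (A : set V) (oA : ropen true A).
Implicit Types (f g : V -> R) (i j : 'I_3).

Lemma smooth_on_is_pd f i x : smooth_on A f -> A x ->
  is_pd true i f x (pd true i f x).
Proof.
by move=> sf Ax; have := @famk_is_pd _ bool true A oA _ _ i true x
  (smooth_on_fam oA sf 1%N) Ax.
Qed.

Lemma pdD f g i x : smooth_on A f -> smooth_on A g -> A x ->
  pd true i (fun y => f y + g y) x = pd true i f x + pd true i g x.
Proof.
move=> sf sg Ax; apply: is_pdE; first exact: oA.1.
by apply: is_pdD; exact: smooth_on_is_pd.
Qed.

Lemma pdM f g i x : smooth_on A f -> smooth_on A g -> A x ->
  pd true i (fun y => f y * g y) x = pd true i f x * g x + f x * pd true i g x.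
Proof.
move=> sf sg Ax; apply: is_pdE; first exact: oA.1.
by apply: is_pdM; exact: smooth_on_is_pd.
Qed.

Lemma pd_cst c i x : A x -> pd true i (fun=> c) x = 0.
Proof. by move=> Ax; apply: is_pdE; [exact: oA.1|exact: is_pd_cst]. Qed.

Lemma smooth_on_sum (I : Type) (s : seq I) (F : I -> V -> R) :
  (forall m, smooth_on A (F m)) -> smooth_on A (fun x => \sum_(m <- s) F m x).
Proof.
move=> H; have [+ _] := @sfam_sum R bool A oA I s xpredT (fun m _ => F m)
  (fun m => sfam_single _ oA (H m)).
by apply; exact: true.
Qed.

Lemma pd_sum (I : Type) (s : seq I) (F : I -> V -> R) i x :
  (forall m, smooth_on A (F m)) -> A x ->
  pd true i (fun y => \sum_(m <- s) F m y) x = \sum_(m <- s) pd true i (F m) x.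
Proof.
move=> H Ax; elim: s => [|m s IH].
  by rewrite big_nil; under eq_fun do rewrite big_nil; exact: pd_cst.
rewrite big_cons -IH; under eq_fun do rewrite big_cons.
by rewrite pdD //; exact: smooth_on_sum.
Qed.

Lemma pd_ext f g i x : A x -> (forall y, A y -> f y = g y) ->
  pd true i f x = pd true i g x.
Proof.
move=> Ax fg; apply: pd_local; first exact: oA.1.
by apply: filterS (oA.2 _ Ax) => y; exact: fg.
Qed.

Lemma pd_compE (B : set V) f (phi : V -> V) i x : ropen true B ->
  (forall y, A y -> B (phi y)) -> (forall j, smooth_on A (fun y => phi y ord0 j)) ->
  smooth_on B f -> A x ->
  pd true i (fun y => f (phi y)) x =
  \sum_j pd true j f (phi x) * pd true i (fun y => phi y ord0 j) x.
Proof.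
move=> oB AB sphi sf Ax; apply: is_pdE; first exact: oA.1.
have fB := @smooth_on_fam _ bool _ _ oB sf.
apply: (@is_pd_comp _ true true i B f phi) => //.
- exact: oA.1.
- exact: AB.
- by apply: filterS (oA.2 _ Ax) => y /AB /oB.1.
- by move=> y j By; have [_ /(_ j)[]] := fB 1%N true y By.
- move=> j; apply: (@jcont_slice _ _ true (fun _ : bool => pd true j f) true).
  by have [+ _] := fam_pd j fB 0%N true (AB _ Ax).
- by move=> j; exact: smooth_on_is_pd.
Qed.

Lemma pdC f i j x : smooth_on A f -> A x ->
  pd true i (pd true j f) x = pd true j (pd true i f) x.
Proof.
move=> sf Ax; have fA := @smooth_on_fam _ bool _ _ oA sf.
apply: (schwarz i j oA Ax).
- by move=> y k Ay; have [_ /(_ k)[]] := fA 1%N true y Ay.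
- by move=> y k l Ay; have [_ /(_ l)[_ [_ /(_ k)[]]]] := fA 2%N true y Ay.
- move=> k l; apply: (@jcont_slice _ _ true (fun _ : bool => pd true k (pd true l f)) true).
  by have [+ _] := fam_pd k (fam_pd l fA) 0%N true Ax.
Qed.

(** Increments along a direction other than [ord0] stay in the boundary plane, where the difference
    quotients vanish. *)
Lemma pd_tangent f c j x : (forall y, A y -> y ord0 ord0 = 0 -> f y = c) ->
  A x -> x ord0 ord0 = 0 -> j != ord0 -> pd true j f x = 0.
Proof.
move=> H Ax x0 j0; apply: is_pdE; first exact: oA.1.
have line : \forall h \near pd_filter true j x, A (x + h *: e j).
  exact: (@pd_filter_line _ true j x _ (oA.2 _ Ax)).
have Z : (fun=> 0 : R) @ pd_filter true j x --> (0 : R) by exact: cvg_cst.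
apply: cvg_trans Z; apply: near_eq_cvg; apply: filterS line => h Ah /=.
have hx0 : (x + h *: e j) ord0 ord0 = 0.
  by rewrite !mxE x0 eqxx eq_sym (negbTE j0) mulr0 addr0.
by rewrite (H _ Ah hx0) (H _ Ax x0) subrr mul0r.
Qed.

(* The key keeps unification from unfolding the limits in [pd]. *)
Fact mpd_key : unit. Proof. by []. Qed.
Definition mpd n (i : 'I_3) (M : V -> 'M[R]_n) x : 'M[R]_n :=
  \matrix[mpd_key]_(k, l) pd true i (fun y => M y k l) x.

Lemma mpdE n i (M : V -> 'M[R]_n) x k l :
  mpd i M x k l = pd true i (fun y => M y k l) x.
Proof. by rewrite mxE. Qed.

Definition msmooth (D : set V) n (M : V -> 'M[R]_n) :=
  forall k l, smooth_on D (fun y => M y k l).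

Lemma mpd_ext n i (M N : V -> 'M[R]_n) x : A x -> (forall y, A y -> M y = N y) ->
  mpd i M x = mpd i N x.
Proof.
move=> Ax MN; apply/matrixP => k l; rewrite !mxE; apply: pd_ext => // y /MN ->//.
Qed.

Lemma mpdD n i (M N : V -> 'M[R]_n) x : msmooth A M -> msmooth A N -> A x ->
  mpd i (fun y => M y + N y) x = mpd i M x + mpd i N x.
Proof.
move=> sM sN Ax; apply/matrixP => k l; rewrite !mxE -pdD //.
by congr (pd _ _ _ _); apply/funext => y; rewrite !mxE.
Qed.

Lemma msmooth_mul n (M N : V -> 'M[R]_n) : msmooth A M -> msmooth A N ->
  msmooth A (fun y => M y *m N y).
Proof.
move=> sM sN k l; apply: (@smooth_on_ext _ _ (fun y => \sum_m M y k m * N y m l)).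
  by move=> y _; rewrite mxE.
by apply: smooth_on_sum => m; exact: smooth_onM.
Qed.

Lemma mpdM n i (M N : V -> 'M[R]_n) x : msmooth A M -> msmooth A N -> A x ->
  mpd i (fun y => M y *m N y) x = mpd i M x *m N x + M x *m mpd i N x.
Proof.
move=> sM sN Ax; apply/matrixP => k l; rewrite !mxE -big_split /=.
rewrite -(@pd_ext (fun y => \sum_m M y k m * N y m l)) //; last first.
  by move=> y _; rewrite mxE.
rewrite pd_sum //; last by move=> m; exact: smooth_onM.
by apply: eq_bigr => m _; rewrite !mxE; exact: pdM.
Qed.

Lemma msmooth_scale n (f : V -> R) (M : V -> 'M[R]_n) :
  smooth_on A f -> msmooth A M -> msmooth A (fun y => f y *: M y).
Proof.
move=> sf sM k l; apply: (@smooth_on_ext _ _ (fun y => f y * M y k l)).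
  by move=> y _; rewrite mxE.
exact: smooth_onM.
Qed.

Lemma mpdZ n i (f : V -> R) (M : V -> 'M[R]_n) x :
  smooth_on A f -> msmooth A M -> A x ->
  mpd i (fun y => f y *: M y) x = pd true i f x *: M x + f x *: mpd i M x.
Proof.
move=> sf sM Ax; apply/matrixP => k l; rewrite !mxE -pdM //.
by congr (pd _ _ _ _); apply/funext => y; rewrite !mxE.
Qed.

Lemma msmooth_sum n (I : Type) (s : seq I) (M : I -> V -> 'M[R]_n) :
  (forall m, msmooth A (M m)) -> msmooth A (fun y => \sum_(m <- s) M m y).
Proof.
move=> H k l; apply: (@smooth_on_ext _ _ (fun y => \sum_(m <- s) M m y k l)).
  by move=> y _; rewrite summxE.
by apply: smooth_on_sum => m; exact: H.
Qed.

Lemma mpd_sum n i (I : Type) (s : seq I) (M : I -> V -> 'M[R]_n) x :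
  (forall m, msmooth A (M m)) -> A x ->
  mpd i (fun y => \sum_(m <- s) M m y) x = \sum_(m <- s) mpd i (M m) x.
Proof.
move=> H Ax; apply/matrixP => k l; rewrite summxE !mxE.
under eq_fun do rewrite summxE.
rewrite pd_sum //; last by move=> m; exact: H.
by apply: eq_bigr => m _; rewrite mxE.
Qed.

Lemma mpd_tr n i (M : V -> 'M[R]_n) x : mpd i (fun y => (M y)^T) x = (mpd i M x)^T.
Proof.
by apply/matrixP => k l; rewrite !mxE; congr (pd _ _ _ _); apply/funext => y; rewrite mxE.
Qed.

Lemma msmooth_tr n (M : V -> 'M[R]_n) : msmooth A M -> msmooth A (fun y => (M y)^T).
Proof.
move=> sM k l; apply: smooth_on_ext (sM l k) => y _; by rewrite mxE.
Qed.

End PointwiseCalculus.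

(** * Levi-Civita connection, curvature and mean curvature in coordinates *)

Section LeviCivita.
Variable R : realType.
Notation V := 'rV[R]_3.

Fact conn_key : unit. Proof. by []. Qed.
(* Row [j], column [k] of [conn g i x] is Gamma^k_{ij}: the matrices of the
   connection form act on row vectors. *)
Definition conn (g : V -> 'M[R]_3) (i : 'I_3) (x : V) : 'M[R]_3 :=
  \matrix[conn_key]_(j, k) christoffel g k i j x.

Lemma christoffelE (g : V -> 'M[R]_3) k i j x : christoffel g k i j x =
  2^-1 * \sum_l invmx (g x) k l *
    (pd true i (fun y => g y j l) x + pd true j (fun y => g y i l) x
     - pd true l (fun y => g y i j) x).
Proof. by rewrite /christoffel /ginv pderivE. Qed.

Lemma connE (g : V -> 'M[R]_3) i x j k : conn g i x j k = christoffel g k i j x.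
Proof. by rewrite mxE. Qed.

Lemma jacE (phi : V -> V) x i j :
  Defs.jacobian phi x i j = pd true i (fun y => phi y ord0 j) x.
Proof. by rewrite /Defs.jacobian mxE pderivE. Qed.

Lemma mulmx_entry m n p (M : 'M[R]_(m, n)) (N : 'M[R]_(n, p)) i j :
  (M *m N) i j = \sum_k M i k * N k j.
Proof. by rewrite mxE. Qed.

Lemma addmxE m n (M N : 'M[R]_(m, n)) i j : (M + N) i j = M i j + N i j.
Proof. by rewrite mxE. Qed.

Lemma oppmxE m n (M : 'M[R]_(m, n)) i j : (- M) i j = - M i j.
Proof. by rewrite mxE. Qed.

Lemma congr_invmx n (P G M : 'M[R]_n) : M = P *m G *m P^T -> M \in unitmx ->
  P \in unitmx -> invmx G = P^T *m invmx M *m P.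
Proof.
move=> E uM uP; have uPT : P^T \in unitmx by rewrite unitmx_tr.
have uG : G \in unitmx by move: uM; rewrite E !unitmx_mul => /andP[/andP[]].
have H : P^T *m invmx M *m P *m G = 1%:M.
  rewrite -[_ *m G](mulmxK uPT) -!mulmxA (mulmxA P) (mulmxA (P *m G)) -E.
  by rewrite (mulmxA (invmx M)) mulVmx // mul1mx mulmxV.
by rewrite -[RHS](mulmxK uG) H mul1mx.
Qed.

Section AtPoint.
Variables (g : V -> 'M[R]_3) (x : V).
Hypothesis gsym : forall y, (g y)^T = g y.
Hypothesis gunit : g x \in unitmx.

Lemma gsymE y i j : g y i j = g y j i.
Proof. by rewrite -{1}(gsym y) mxE. Qed.

Lemma gsym_fun i j : (fun y => g y i j) = (fun y => g y j i).
Proof. by apply/funext => y; exact: gsymE. Qed.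

Lemma invg_sym : (invmx (g x))^T = invmx (g x).
Proof. by rewrite trmx_inv gsym. Qed.

(** The Koszul formula in a coordinate frame: lowering the upper index cancels the inverse metric in
    the Christoffel symbols. *)
Lemma conn_lower i j l : (conn g i x *m g x) j l =
  2^-1 * (pd true i (fun y => g y j l) x + pd true j (fun y => g y i l) x
     - pd true l (fun y => g y i j) x).
Proof.
pose t l := pd true i (fun y => g y j l) x + pd true j (fun y => g y i l) x
     - pd true l (fun y => g y i j) x.
rewrite mulmx_entry; under eq_bigr do rewrite connE christoffelE -/(t _) -mulrA mulr_suml.
rewrite -mulr_sumr; congr (_ * _); rewrite exchange_big /=.
transitivity (\sum_m t m * (invmx (g x) *m g x) m l).
  apply: eq_bigr => m _; rewrite mxE mulr_sumr; apply: eq_bigr => k _.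
  by rewrite -{1}invg_sym mxE -/(t m); ring.
rewrite mulVmx // (bigD1 l) //= mxE eqxx mulr1 big1 ?addr0 // => m ml.
by rewrite mxE (negbTE ml) mulr0.
Qed.

Lemma conn_torsion i j k : conn g i x j k = conn g j x i k.
Proof.
rewrite !connE !christoffelE; congr (_ * _); apply: eq_bigr => l _; congr (_ * _).
by rewrite (gsym_fun j i); congr (_ - _); exact: addrC.
Qed.

Lemma conn_metric i : conn g i x *m g x + (conn g i x *m g x)^T = mpd i g x.
Proof.
apply/matrixP => j l; rewrite mxE [X in _ + X]mxE !conn_lower mpdE.
by rewrite (gsym_fun l j); field.
Qed.

(** The uniqueness half of the fundamental theorem of Riemannian geometry, at one point: metric
    compatibility for three arrangements of the indices, combined with symmetry, determines the
    lowered coefficients. It reduces the transformation law of the connection to checking two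
    properties. *)
Lemma conn_unique (C : 'I_3 -> 'M[R]_3) :
  (forall i j k, C i j k = C j i k) ->
  (forall i, C i *m g x + (C i *m g x)^T = mpd i g x) ->
  forall i, C i = conn g i x.
Proof.
move=> tC mC i.
suff E : C i *m g x = conn g i x *m g x by rewrite -[LHS](mulmxK gunit) E mulmxK.
apply/matrixP => j l; rewrite conn_lower.
have T a b c : (C a *m g x) b c = (C b *m g x) a c.
  by rewrite !mulmx_entry; apply: eq_bigr => k _; rewrite tC.
have M a b c : (C a *m g x) b c + (C a *m g x) c b = pd true a (fun y => g y b c) x.
  by have /matrixP/(_ b c) := mC a; rewrite mpdE mxE [X in _ + X]mxE.
rewrite -!M (T l j i) (T l i j) (T j i l); by field.
Qed.

End AtPoint.

(** The commutator of the covariant derivatives along x_k and x_j on the coordinate frame. Matrices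
    act on rows, which fixes the order of the products; the Ricci tensor is a trace of it. *)
Definition curv (g : V -> 'M[R]_3) k j x : 'M[R]_3 :=
  mpd k (conn g j) x - mpd j (conn g k) x + conn g j x *m conn g k x
   - conn g k x *m conn g j x.

Lemma ricci_curv (g : V -> 'M[R]_3) x i j : (forall y, (g y)^T = g y) ->
  ricci_coord g i j x = \sum_k (curv g k j x) i k.
Proof.
move=> gsym; rewrite /ricci_coord.
have T k' i' j' : christoffel g k' i' j' = christoffel g k' j' i'.
  by apply/funext => y; have := conn_torsion y gsym i' j' k'; rewrite !connE.
rewrite -big_split /=; apply: eq_bigr => k _; rewrite pderivE sumrB addrA.
rewrite /curv !addmxE !oppmxE !mpdE !mulmx_entry.
congr (_ - _ + _ - _).
- by congr (pd _ _ _ _); apply/funext => y; rewrite connE T.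
- by congr (pd _ _ _ _); apply/funext => y; rewrite connE T.
- by apply: eq_bigr => l _; rewrite !connE mulrC (T l i j).
- by apply: eq_bigr => l _; rewrite !connE mulrC (T l i k).
Qed.

Lemma msmooth_conn (A : set V) (g : V -> 'M[R]_3) i : ropen true A ->
  msmooth A g -> (forall y, A y -> g y \in unitmx) -> msmooth A (conn g i).
Proof.
move=> oA sg gu j k; apply: (@smooth_on_ext _ _ (fun x => 2^-1 * \sum_l invmx (g x) k l *
    (pd true i (fun y => g y j l) x + pd true j (fun y => g y i l) x
     - pd true l (fun y => g y i j) x))).
  by move=> y _; rewrite connE christoffelE.
apply: smooth_onM; first exact: smooth_on_cst.
apply: smooth_on_sum => // l; apply: smooth_onM.
  have [+ _] := @sfam_invmx R bool A oA 3 (fun=> g) k l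
    (fun i j => sfam_single _ oA (sg i j)) (fun _ y => gu y).
  by apply; exact: true.
have sp a b c : smooth_on A (pd true a (fun y => g y b c)).
  by apply: smooth_on_pd => //; exact: sg.
apply: smooth_onD; first exact: smooth_onD.
apply: (@smooth_on_ext _ _ (fun x => -1 * pd true l (fun y => g y i j) x)).
  by move=> y _; rewrite mulN1r.
by apply: smooth_onM => //; exact: smooth_on_cst.
Qed.

Definition chris0 (g : V -> 'M[R]_3) x : 'M[R]_2 :=
  \matrix_(a, b) christoffel g ord0 (lift ord0 a) (lift ord0 b) x.

(* On the boundary this is the mean curvature divided by |grad x_0|, see
   [mean_coordE]; unlike the mean curvature it is rational in the 1-jet of [g]. *)
Definition bdry_q (g : V -> 'M[R]_3) x : R :=
  \tr (invmx (induced_metric g x) *m (chris0 g x)^T) / invmx (g x) ord0 ord0.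

Lemma is_pd_sqrt b i (f : V -> R) x l : 0 < f x -> is_pd b i f x l ->
  is_pd b i (fun y => Num.sqrt (f y)) x (l / (Num.sqrt (f x) + Num.sqrt (f x))).
Proof.
move=> fx0 fl; have fc := is_pd_cont fl.
have sx0 : Num.sqrt (f x) + Num.sqrt (f x) != 0.
  by rewrite gt_eqF // addr_gt0 // sqrtr_gt0.
have sc : (fun h => Num.sqrt (f (x + h *: basis_vec R i))) @ pd_filter b i x -->
    Num.sqrt (f x).
  by apply: (cvg_comp _ _ fc); exact: sqrt_continuous.
have H := cvgM fl (cvgV sx0 (cvgD sc (cvg_cst (Num.sqrt (f x))))).
apply: cvg_trans (H _ _ _ _); apply: near_eq_cvg.
have fpos : \forall h \near pd_filter b i x, 0 < f (x + h *: basis_vec R i).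
  exact: (cvgr_gt _ fc).
apply: filterS fpos => h fh /=; rewrite !fctE /=.
have sh : 0 < Num.sqrt (f (x + h *: basis_vec R i)) by rewrite sqrtr_gt0.
have sxp : 0 < Num.sqrt (f x) by rewrite sqrtr_gt0.
rewrite -{1}(sqr_sqrtr (ltW fh)) -{1}(sqr_sqrtr (ltW fx0)) subr_sqr mulrAC -mulrA.
rewrite mulrA mulfK //.
by rewrite gt_eqF // addr_gt0.
Qed.

Section MeanCurvature.
Variables (A : set V) (oA : ropen true A) (g : V -> 'M[R]_3).
Hypothesis sg : msmooth A g.
Hypothesis gsym : forall y, (g y)^T = g y.
Hypothesis gu : forall x, A x -> g x \in unitmx.
Hypothesis g00 : forall x, A x -> 0 < invmx (g x) ord0 ord0.

Lemma smooth_on_invmx k l : smooth_on A (fun y => invmx (g y) k l).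
Proof.
have [+ _] := @sfam_invmx R bool A oA 3 (fun=> g) k l
    (fun i j => sfam_single _ oA (sg i j)) (fun _ y Ay => gu Ay).
by apply; exact: true.
Qed.

Lemma normal_is_pd a k x : A x -> exists l, is_pd true a (normal_coord g k) x l.
Proof.
move=> Ax; rewrite /normal_coord /ginv.
have s0 : Num.sqrt (invmx (g x) ord0 ord0) != 0 by rewrite gt_eqF // sqrtr_gt0 g00.
have H1 := smooth_on_is_pd oA (i := a) (smooth_on_invmx ord0 k) Ax.
have H2 := is_pdV s0 (is_pd_sqrt (g00 Ax) (smooth_on_is_pd oA (i := a) (smooth_on_invmx ord0 ord0) Ax)).
have H3 := is_pdM (is_pdM (is_pd_cst true a x (-1)) H1) H2.
eexists; apply: is_pd_local H3; first exact: oA.1.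
by near=> y; rewrite mulN1r.
Unshelve. all: by end_near. Qed.

(** Lowering its index turns the normal into the covector -dx_0/|dx_0|, which kills tangent
    directions. *)
Lemma normal_lower b x : A x -> \sum_k normal_coord g k x * g x k b =
  - (b == ord0)%:R / Num.sqrt (invmx (g x) ord0 ord0).
Proof.
move=> Ax; have /matrixP/(_ ord0 b) := mulVmx (gu Ax).
rewrite mulmx_entry mxE eq_sym => <-.
rewrite -sumrN mulr_suml; apply: eq_bigr => k _.
by rewrite /normal_coord /ginv !mulNr mulrAC.
Qed.

(* Since the normal is orthogonal to the level set, the derivative of the normal
   can be moved onto the metric, and metric compatibility leaves a Christoffel
   symbol. *)
Lemma second_ffE a b x : A x -> b != ord0 -> second_ff g a b x =
  christoffel g ord0 a b x / Num.sqrt (invmx (g x) ord0 ord0).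
Proof.
move=> Ax b0; set s := Num.sqrt _.
pose nu k := normal_coord g k x.
have D : \sum_k (pd true a (normal_coord g k) x * g x k b +
     nu k * pd true a (fun y => g y k b) x) = 0.
  have H k : is_pd true a (fun y => normal_coord g k y * g y k b) x
     (pd true a (normal_coord g k) x * g x k b +
     nu k * pd true a (fun y => g y k b) x).
    apply: is_pdM; last exact: smooth_on_is_pd (sg k b) Ax.
    by apply: pd_is; [exact: oA.1|exact: normal_is_pd].
  have HS : is_pd true a (fun y => \sum_k normal_coord g k y * g y k b) x
     (\sum_k (pd true a (normal_coord g k) x * g x k b +
     nu k * pd true a (fun y => g y k b) x)).
    rewrite !big_ord_recl !big_ord0 !addr0.
    have := is_pdD (H ord0) (is_pdD (H (lift ord0 ord0)) (H (lift ord0 (lift ord0 ord0)))).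
    apply: is_pd_local; first exact: oA.1.
    by near=> y; rewrite !big_ord_recl big_ord0 addr0.
  rewrite -(is_pdE _ HS); last exact: oA.1.
  rewrite (@pd_ext _ A oA _ (fun=> 0)) //; first exact: (pd_cst oA).
  by move=> y Ay; rewrite normal_lower // (negbTE b0) oppr0 mul0r.
have L c : \sum_k nu k * g x k c = - (c == ord0)%:R / s by exact: normal_lower.
have M l : (conn g a x *m g x) l b + (conn g a x *m g x) b l =
    pd true a (fun y => g y l b) x.
  have /matrixP/(_ l b) := conn_metric gsym (gu Ax) a.
  by rewrite addmxE [X in _ + X]mxE mpdE.
rewrite /second_ff /cov_normal pderivE.
have -> : \sum_k (pd true a (normal_coord g k) x +
     \sum_l christoffel g k a l x * normal_coord g l x) * g x k b =
   - \sum_l nu l * (conn g a x *m g x) b l.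
  under eq_bigr do rewrite mulrDl.
  rewrite big_split /= (_ : \sum_k _ * _ = - \sum_k nu k * pd true a (fun y => g y k b) x); last first.
    by apply/eqP; rewrite -subr_eq0 opprK -big_split /= D.
  rewrite addrC.
  under eq_bigr do rewrite mulr_suml.
  rewrite exchange_big -sumrB -sumrN; apply: eq_bigr => l _ /=.
  rewrite -M mulrDr opprD addrA mulmx_entry mulr_sumr.
  rewrite (_ : \sum_i _ = \sum_i nu l * (conn g a x l i * g x i b)) ?subrr ?sub0r //.
  by apply: eq_bigr => k _; rewrite connE /nu; ring.
under eq_bigr do rewrite mulmx_entry mulr_sumr.
rewrite exchange_big /= -sumrN.
have K c : \sum_l nu l * (conn g a x b c * g x c l) =
    conn g a x b c * (- (c == ord0)%:R / s).
  rewrite -L mulr_sumr; apply: eq_bigr => l _.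
  by rewrite (gsymE gsym x c l); ring.
under eq_bigr do rewrite K.
rewrite big_ord_recl big1 => [|k _]; last by rewrite oppr0 mul0r mulr0 oppr0.
by rewrite addr0 eqxx connE mulNr mulrN opprK mul1r.
Unshelve. all: by end_near. Qed.

Lemma mean_coordE x : A x ->
  mean_coord g x = Num.sqrt (invmx (g x) ord0 ord0) * bdry_q g x.
Proof.
move=> Ax; have G0 := g00 Ax.
have -> : mean_coord g x = \tr (invmx (induced_metric g x) *m (chris0 g x)^T) /
    Num.sqrt (invmx (g x) ord0 ord0).
  rewrite /mean_coord /mxtrace mulr_suml; apply: eq_bigr => a _.
  rewrite mulmx_entry mulr_suml; apply: eq_bigr => b _.
  by rewrite second_ffE // mulrA !mxE.
rewrite /bdry_q mulrCA; congr (_ * _).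
have s0 : Num.sqrt (invmx (g x) ord0 ord0) != 0 by rewrite gt_eqF // sqrtr_gt0.
by move: (Num.sqrt _) s0 (sqr_sqrtr (ltW G0)) => s s0 <-; field.
Qed.

(** On the boundary [w] is 1 and its tangential derivatives vanish, so the metric is unchanged there
    and Gamma^0_ab changes by -(1/2) g^{00} (dw/dx_0) g_ab. The trace of the identity of the
    2-dimensional boundary cancels the factor 1/2, and the division by g^{00} in [bdry_q] removes
    the rest. *)
Lemma bdry_q_conformal (w : V -> R) x : smooth_on A w ->
  (forall y, A y -> y ord0 ord0 = 0 -> w y = 1) -> A x -> x ord0 ord0 = 0 ->
  induced_metric g x \in unitmx ->
  bdry_q (fun y => w y *: g y) x = bdry_q g x - pd true ord0 w x.
Proof.
move=> sw w1 Ax x0 uI; have wx := w1 _ Ax x0.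
have -> : bdry_q (fun y => w y *: g y) x =
   \tr (invmx (induced_metric g x) *m (chris0 (fun y => w y *: g y) x)^T)
     / invmx (g x) ord0 ord0.
  rewrite /bdry_q wx scale1r; congr (\tr (invmx _ *m _) / _).
  by apply/matrixP => a b; rewrite !mxE wx mul1r.
have dwg i j k : pd true i (fun y => (w y *: g y) j k) x =
    pd true i w x * g x j k + pd true i (fun y => g y j k) x.
  rewrite (@pd_ext _ A oA _ (fun y => w y * g y j k)) //; last first.
    by move=> y _; rewrite mxE.
  by rewrite (pdM oA i sw (sg j k) Ax) wx mul1r.
have dw0 j : j != ord0 -> pd true j w x = 0.
  exact: (pd_tangent oA w1 Ax x0).
have E : chris0 (fun y => w y *: g y) x = chris0 g x -
   (2^-1 * invmx (g x) ord0 ord0 * pd true ord0 w x) *: induced_metric g x.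
  apply/matrixP => a b; rewrite !mxE !christoffelE wx scale1r.
  rewrite -mulrA -mulrA -mulrBr; congr (_ * _).
  under eq_bigr do rewrite !dwg !(dw0 (lift ord0 _)) // !mul0r !add0r.
  rewrite !big_ord_recl !big_ord0 !(dw0 (lift ord0 _)) // !mul0r !add0r !addr0.
  by ring.
rewrite E linearB linearZ /= mulmxBr -scalemxAr linearB linearZ /= mulrBl /bdry_q.
congr (_ - _).
have -> : (induced_metric g x)^T = induced_metric g x.
  by apply/matrixP => a b; rewrite !mxE (gsymE gsym).
rewrite mulVmx // mxtrace1.
have := g00 Ax; move: (invmx _ _ _) => u u0; field.
by rewrite gt_eqF.
Qed.

End MeanCurvature.

(** * Behavior of connection, curvature and [bdry_q] under a change of coordinates *)

Section Transformation.
Variables (A B : set V) (oA : ropen true A) (oB : ropen true B) (phi : V -> V).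
Variables (g g' : V -> 'M[R]_3).
Hypothesis AB : forall x, A x -> B (phi x).
Hypothesis sphi : forall j, smooth_on A (fun x => phi x ord0 j).
Hypothesis sg : msmooth A g.
Hypothesis sg' : msmooth B g'.
Hypothesis gsym : forall y, (g y)^T = g y.
Hypothesis gsym' : forall y, (g' y)^T = g' y.
Hypothesis gu : forall x, A x -> g x \in unitmx.
Hypothesis gu' : forall x, B x -> g' x \in unitmx.
Notation J := (Defs.jacobian phi).
Hypothesis gE : forall x, A x -> g x = J x *m g' (phi x) *m (J x)^T.

Lemma msmooth_jac : msmooth A J.
Proof.
move=> i j; apply: (@smooth_on_ext _ _ (pd true i (fun y => phi y ord0 j))).
  by move=> x _; rewrite jacE.
exact: smooth_on_pd.
Qed.

Lemma jac_unit x : A x -> J x \in unitmx.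
Proof.
move=> Ax; have := gu Ax; rewrite (gE Ax) -mulmxA unitmx_mul => /andP[-> //].
Qed.

Lemma mpd_jac_sym x i j k : A x -> mpd i J x j k = mpd j J x i k.
Proof.
move=> Ax; rewrite !mpdE.
under eq_fun do rewrite jacE; under [in RHS]eq_fun do rewrite jacE.
exact: (pdC oA).
Qed.

Lemma mpd_comp (M : V -> 'M[R]_3) x i : msmooth B M -> A x ->
  mpd i (fun y => M (phi y)) x = \sum_a J x i a *: mpd a M (phi x).
Proof.
move=> sM Ax; apply/matrixP => k l; rewrite summxE mpdE.
rewrite (pd_compE oA i oB AB sphi (sM k l) Ax).
by apply: eq_bigr => a _; rewrite mxE mpdE jacE mulrC.
Qed.

Lemma msmooth_comp (M : V -> 'M[R]_3) : msmooth B M -> msmooth A (fun y => M (phi y)).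
Proof. by move=> sM k l; exact: smooth_on_comp (sM k l). Qed.

(** The connection form of [g'] pulled back along [phi], still expressed in the coordinate frame of
    the target; passing to the frame of the source is a gauge transformation by [J]. *)
Definition pull_conn j x := \sum_a J x j a *: conn g' a (phi x).

(** The candidate given by the gauge law is torsion-free, since second derivatives of [phi] commute,
    and metric, by differentiating [gE]; [conn_unique] identifies it with the connection of [g]. *)
Lemma conn_transform x i : A x ->
  conn g i x *m J x = J x *m pull_conn i x + mpd i J x.
Proof.
move=> Ax; have uJ := jac_unit Ax.
pose C i := (J x *m pull_conn i x + mpd i J x) *m invmx (J x).
have CJ i' : C i' *m J x = J x *m pull_conn i' x + mpd i' J x by rewrite /C mulmxKV.
rewrite -(@conn_unique g x gsym (gu Ax) C) //.
- move=> a b k.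
  suff E m : (J x *m pull_conn a x + mpd a J x) b m =
             (J x *m pull_conn b x + mpd b J x) a m.
    by rewrite /C !mulmx_entry; apply: eq_bigr => m _; rewrite E.
  rewrite !addmxE mpd_jac_sym //; congr (_ + _).
  rewrite /pull_conn !mulmx_sumr !summxE.
  under eq_bigr do rewrite -scalemxAr mxE mulmx_entry mulr_sumr.
  under [RHS]eq_bigr do rewrite -scalemxAr mxE mulmx_entry mulr_sumr.
  rewrite exchange_big; apply: eq_bigr => c _; apply: eq_bigr => d _.
  by rewrite (conn_torsion (phi x) gsym' d c); ring.
- move=> a.
  have -> : C a *m g x = (J x *m pull_conn a x + mpd a J x) *m g' (phi x) *m (J x)^T.
    by rewrite (gE Ax) !mulmxA CJ.
  rewrite (@mpd_ext _ A oA _ a g (fun y => J y *m g' (phi y) *m (J y)^T)) //.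
  have sJ := msmooth_jac; have sgp := msmooth_comp sg'.
  rewrite (mpdM oA) //; [|exact: msmooth_mul|exact: msmooth_tr].
  rewrite (mpdM oA) // mpd_tr mpd_comp //.
  have E : \sum_b J x a b *: mpd b g' (phi x) =
     pull_conn a x *m g' (phi x) + (pull_conn a x *m g' (phi x))^T.
    rewrite /pull_conn mulmx_suml raddf_sum -big_split; apply: eq_bigr => b _ /=.
    by rewrite -scalemxAl linearZ /= -scalerDr conn_metric //; exact/gu'/AB.
  rewrite E; move: (pull_conn a x) (mpd a J x) (J x) (g' (phi x)) (gsym' (phi x)).
  move=> P D Jx G GT.
  have -> : ((Jx *m P + D) *m G *m Jx^T)^T =
     Jx *m (P *m G)^T *m Jx^T + Jx *m G *m D^T.
    by rewrite !trmx_mul trmxK linearD /= !trmx_mul GT !mulmxDr !mulmxA.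
  rewrite !mulmxDl !mulmxDr !mulmxDl !mulmxA.
  by rewrite [X in X + _ = _]addrC -!addrA.
Qed.

(** The first two hypotheses are the gauge law in two directions, the last two its cross
    derivatives. Both contain the same second derivative [Dkj] of the Jacobian, which cancels by
    antisymmetry. *)
Lemma gauge_curv (Jx Aj Ak Bj Bk Dj Dk dkAj djAk dkBj djBk Dkj : 'M[R]_3) :
  Aj *m Jx = Jx *m Bj + Dj -> Ak *m Jx = Jx *m Bk + Dk ->
  dkAj *m Jx + Aj *m Dk = Dk *m Bj + Jx *m dkBj + Dkj ->
  djAk *m Jx + Ak *m Dj = Dj *m Bk + Jx *m djBk + Dkj ->
  (dkAj - djAk + Aj *m Ak - Ak *m Aj) *m Jx =
  Jx *m (dkBj - djBk + Bj *m Bk - Bk *m Bj).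
Proof.
move=> ej ek /(canRL (addrK _)) ekj /(canRL (addrK _)) ejk.
rewrite !mulmxDl !mulNmx !mulmxDr !mulmxN -!mulmxA ej ek ekj ejk.
rewrite !mulmxDr !(mulmxA Aj) !(mulmxA Ak) ej ek !mulmxDl !mulmxA.
move: (Jx *m Bj *m Bk) (Jx *m Bk *m Bj) (Dk *m Bj) (Jx *m dkBj) (Aj *m Dk)
  (Dj *m Bk) (Jx *m djBk) (Ak *m Dj) => P7 P8 P1 P2 P3 P4 P5 P6.
by apply/matrixP => p q; rewrite !addmxE !oppmxE !addmxE !oppmxE; ring.
Qed.

Lemma msmooth_pull_conn j : msmooth A (pull_conn j).
Proof.
apply: msmooth_sum => // a; apply: msmooth_scale; first exact: msmooth_jac.
by apply: msmooth_comp; exact: msmooth_conn.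
Qed.

Lemma msmooth_mpd n i (M : V -> 'M[R]_n) : msmooth A M -> msmooth A (mpd i M).
Proof.
move=> sM k l; apply: (@smooth_on_ext _ _ (pd true i (fun y => M y k l))).
  by move=> y _; rewrite mpdE.
by apply: smooth_on_pd => //; exact: sM.
Qed.

Lemma mpd_pull_conn k j x : A x -> mpd k (pull_conn j) x =
  \sum_a mpd k J x j a *: conn g' a (phi x) +
  \sum_a \sum_b (J x j a * J x k b) *: mpd b (conn g' a) (phi x).
Proof.
move=> Ax; have sc a : msmooth B (conn g' a) by exact: msmooth_conn.
rewrite /pull_conn (mpd_sum oA) //; last first.
  by move=> a; apply: msmooth_scale => //; [exact: msmooth_jac|exact: msmooth_comp].
rewrite -big_split; apply: eq_bigr => a _ /=.
rewrite (mpdZ oA) //; [|exact: msmooth_jac|exact: msmooth_comp].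
rewrite -mpdE mpd_comp //; congr (_ + _).
by rewrite scaler_sumr; apply: eq_bigr => b _; rewrite scalerA.
Qed.

Lemma curv_transform k j x : A x -> curv g k j x *m J x =
  J x *m \sum_a \sum_b (J x j a * J x k b) *: curv g' b a (phi x).
Proof.
move=> Ax.
have sJ := msmooth_jac; have sc i : msmooth A (conn g i) by exact: msmooth_conn.
have law l m : mpd l (conn g m) x *m J x + conn g m x *m mpd l J x =
  mpd l J x *m pull_conn m x + J x *m mpd l (pull_conn m) x + mpd l (mpd m J) x.
  rewrite -(mpdM oA) // -(mpdM oA) //; last exact: msmooth_pull_conn.
  rewrite -(mpdD oA) //; last exact: msmooth_mpd.
    by apply: (mpd_ext oA) => // y Ay; exact: conn_transform.
  by apply: msmooth_mul => //; exact: msmooth_pull_conn.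
have sym : mpd j (mpd k J) x = mpd k (mpd j J) x.
  apply/matrixP => p q; rewrite !mpdE; under eq_fun do rewrite mpdE.
  by under [in RHS]eq_fun do rewrite mpdE; apply: (pdC oA) => //; exact: sJ.
have H := law j k; rewrite sym in H.
rewrite /curv (gauge_curv (conn_transform j Ax) (conn_transform k Ax) (law k j) H).
congr (_ *m _); rewrite !mpd_pull_conn //.
(* The terms with second derivatives of [phi] are symmetric in [j] and [k], so they drop out of the
   antisymmetric difference and the law becomes tensorial. *)
have -> : \sum_a mpd k J x j a *: conn g' a (phi x) =
          \sum_a mpd j J x k a *: conn g' a (phi x).
  by apply: eq_bigr => a _; rewrite mpd_jac_sym.
rewrite opprD addrACA subrr add0r.
have E1 : \sum_a \sum_b (J x k a * J x j b) *: mpd b (conn g' a) (phi x) =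
    \sum_a \sum_b (J x j a * J x k b) *: mpd a (conn g' b) (phi x).
  rewrite exchange_big; apply: eq_bigr => a _; apply: eq_bigr => b _.
  by rewrite [_ * J x j a]mulrC.
have E2 m n : pull_conn m x *m pull_conn n x =
    \sum_a \sum_b (J x m a * J x n b) *: (conn g' a (phi x) *m conn g' b (phi x)).
  rewrite /pull_conn mulmx_suml; apply: eq_bigr => a _.
  rewrite mulmx_sumr; apply: eq_bigr => b _.
  by rewrite -scalemxAl -scalemxAr scalerA.
have E3 : pull_conn k x *m pull_conn j x =
    \sum_a \sum_b (J x j a * J x k b) *: (conn g' b (phi x) *m conn g' a (phi x)).
  rewrite E2 exchange_big; apply: eq_bigr => a _; apply: eq_bigr => b _.
  by rewrite [_ * J x j a]mulrC.
rewrite E1 E3 E2 -sumrB -big_split -sumrB; apply: eq_bigr => a _ /=.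
rewrite -sumrB -big_split -sumrB; apply: eq_bigr => b _ /=.
by rewrite /curv !(scalerBr, scalerDr).
Qed.

(** The trace over [k] pairs the factor [invmx (J x)] of the conjugated curvature with the row index
    of [J x k b]; the two cancel and the trace is taken over the new index. *)
Lemma ricci_transform i j x : A x -> ricci_coord g i j x =
  \sum_d \sum_a J x i d * J x j a * ricci_coord g' d a (phi x).
Proof.
move=> Ax; rewrite ricci_curv //.
pose T b := \sum_a J x j a *: curv g' b a (phi x).
have E k : curv g k j x = \sum_b J x k b *: (J x *m T b *m invmx (J x)).
  rewrite -[LHS](mulmxK (jac_unit Ax)) curv_transform // exchange_big.
  rewrite mulmx_sumr mulmx_suml; apply: eq_bigr => b _.
  rewrite scalemxAl scalemxAr; congr (_ *m _ *m _).
  by rewrite scaler_sumr; apply: eq_bigr => a _; rewrite scalerA mulrC.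
transitivity (\sum_b (J x *m T b) i b).
  under eq_bigr do rewrite E summxE.
  rewrite exchange_big; apply: eq_bigr => b _ /=.
  rewrite -[in RHS](mulmxKV (jac_unit Ax) (J x *m T b)) [RHS]mulmx_entry.
  by apply: eq_bigr => k _; rewrite mxE mulrC.
under eq_bigr do rewrite mulmx_entry; rewrite exchange_big; apply: eq_bigr => d _ /=.
rewrite -mulr_sumr; under [RHS]eq_bigr do rewrite -mulrA; rewrite -mulr_sumr.
congr (_ * _); under eq_bigr do rewrite summxE.
rewrite exchange_big; apply: eq_bigr => a _; rewrite ricci_curv // mulr_sumr.
by apply: eq_bigr => b _; rewrite mxE.
Qed.

Lemma scalar_transform x : A x -> scalar_coord g x = scalar_coord g' (phi x).
Proof.
move=> Ax; have uJ := jac_unit Ax.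
pose Ric h y : 'M[R]_3 := \matrix_(i, j) ricci_coord h i j y.
have sE h y : scalar_coord h y = \tr (invmx (h y) *m (Ric h y)^T).
  rewrite /scalar_coord /mxtrace; apply: eq_bigr => i _; rewrite mulmx_entry.
  by apply: eq_bigr => j _; rewrite !mxE.
have RE : Ric g x = J x *m Ric g' (phi x) *m (J x)^T.
  apply/matrixP => i j; rewrite !mxE ricci_transform // exchange_big /=.
  apply: eq_bigr => a _; rewrite mulmx_entry mulr_suml; apply: eq_bigr => d _.
  by rewrite !mxE; ring.
rewrite !sE RE (congr_invmx (gE Ax) (gu Ax) uJ) !trmx_mul trmxK.
by rewrite !mulmxA mxtrace_mulC !mulmxA.
Qed.

Hypothesis bdry : forall y, A y -> y ord0 ord0 = 0 -> phi y ord0 ord0 = 0.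

Lemma jac_tangent x j : A x -> x ord0 ord0 = 0 -> j != ord0 -> J x j ord0 = 0.
Proof.
move=> Ax x0 j0; rewrite jacE; exact: (pd_tangent oA (c := 0)).
Qed.

Let m x := J x ord0 ord0.

Lemma jac_normal x : A x -> x ord0 ord0 = 0 -> m x != 0.
Proof.
move=> Ax x0; apply/negP => /eqP m0; have := mulmxV (jac_unit Ax).
have c0 k : J x k ord0 = 0.
  by have [->//|k0] := eqVneq k ord0; exact: jac_tangent.
have := mulVmx (jac_unit Ax) => /matrixP/(_ ord0 ord0).
rewrite mulmx_entry big1 => [|k _]; last by rewrite c0 mulr0.
by rewrite mxE eqxx => /eqP; rewrite eq_sym oner_eq0.
Qed.

Let T x : 'M[R]_2 := \matrix_(a, b) J x (lift ord0 a) (lift ord0 b).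

Lemma induced_transform x : A x -> x ord0 ord0 = 0 ->
  induced_metric g x = T x *m induced_metric g' (phi x) *m (T x)^T.
Proof.
move=> Ax x0; apply/matrixP => a b; rewrite mxE (gE Ax) -mulmxA mulmx_entry.
rewrite big_ord_recl jac_tangent // mul0r add0r -mulmxA [RHS]mulmx_entry.
apply: eq_bigr => c _; rewrite !mxE; congr (_ * _).
rewrite big_ord_recl [X in _ * X]mxE jac_tangent // mulr0 add0r.
by apply: eq_bigr => d _; rewrite !mxE.
Qed.

(** The entry of the gauge law in column 0, for tangential row and direction. Its inhomogeneous term
    is a tangential derivative of a tangential derivative of the component 0 of [phi], which is 0
    along the boundary. *)
Lemma christoffel_transform x : A x -> x ord0 ord0 = 0 ->
  m x *: chris0 g x = T x *m chris0 g' (phi x) *m (T x)^T.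
Proof.
move=> Ax x0; apply/matrixP => a b.
have /matrixP/(_ (lift ord0 b) ord0) := conn_transform (lift ord0 a) Ax.
rewrite addmxE [in X in _ + X]mpdE.
have -> : pd true (lift ord0 a) (fun y => J y (lift ord0 b) ord0) x = 0.
  by apply: (pd_tangent oA (c := 0)) => // y Ay y0; exact: jac_tangent.
rewrite addr0 mulmx_entry big_ord_recl big1 => [|k _]; last by rewrite jac_tangent // mulr0.
rewrite addr0 connE => H; rewrite [LHS]mxE [X in _ * X]mxE mulrC /m H.
rewrite /pull_conn mulmx_sumr summxE big_ord_recl jac_tangent // scale0r mulmx0.
rewrite mxE add0r -mulmxA mulmx_entry; apply: eq_bigr => c _.
rewrite -scalemxAr [LHS]mxE [X in _ = X * _]mxE; congr (_ * _).
rewrite mulmx_entry big_ord_recl jac_tangent // mul0r add0r [RHS]mulmx_entry.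
by apply: eq_bigr => d _; rewrite connE !mxE mulrC.
Qed.

(** Along the boundary the column 0 of [J] has the single entry [m]. Thus Gamma^0 acquires a factor
    1/m and g^{00} a factor 1/m^2, while the tangential block cancels in the trace; one factor [m]
    remains. *)
Lemma bdry_q_transform x : A x -> x ord0 ord0 = 0 ->
  induced_metric g x \in unitmx ->
  bdry_q g x = m x * bdry_q g' (phi x).
Proof.
move=> Ax x0 uI; have m0 := jac_normal Ax x0.
have IE := induced_transform Ax x0.
have uT : T x \in unitmx by move: uI; rewrite IE !unitmx_mul => /andP[/andP[]].
rewrite /bdry_q (congr_invmx (gE Ax) (gu Ax) (jac_unit Ax)).
have -> : ((J x)^T *m invmx (g x) *m J x) ord0 ord0 =
     m x * m x * invmx (g x) ord0 ord0.
  rewrite mulmx_entry big_ord_recl big1 => [|k _]; last by rewrite jac_tangent // mulr0.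
  rewrite addr0 mulmx_entry big_ord_recl big1 => [|k _]; last by rewrite mxE jac_tangent // mul0r.
  by rewrite addr0 mxE /m; ring.
rewrite (congr_invmx IE uI uT).
have -> : chris0 g x = (m x)^-1 *: (T x *m chris0 g' (phi x) *m (T x)^T).
  by rewrite -christoffel_transform // scalerA mulVf // scale1r.
rewrite linearZ /= -scalemxAr mxtraceZ !trmx_mul trmxK.
have -> : \tr (invmx (induced_metric g x) *m (T x *m ((chris0 g' (phi x))^T *m (T x)^T))) =
  \tr ((T x)^T *m invmx (induced_metric g x) *m T x *m (chris0 g' (phi x))^T).
  by rewrite !mulmxA mxtrace_mulC !mulmxA.
move: (invmx (g x) _ _) (\tr _) m0 => u v; move: (m x) => c c0.
have [->|u0] := eqVneq u 0; first by rewrite mulr0 invr0 !mulr0.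
by field; rewrite c0 u0.
Qed.

End Transformation.

End LeviCivita.

Section PosDef.
Variable R : realType.

Definition posdef n (M : 'M[R]_n) :=
  forall v : 'rV[R]_n, v != 0 -> 0 < (v *m M *m v^T) ord0 ord0.

Lemma posdef_unit n (M : 'M[R]_n) : posdef M -> M \in unitmx.
Proof.
move=> pM; rewrite -row_free_unit -kermx_eq0; apply/negPn/negP => K0.
have [i Ki] : exists i, row i (kermx M) != 0.
  apply/existsP; apply: contraNT K0; rewrite negb_exists => /forallP H.
  by apply/eqP/row_matrixP => i; rewrite row0; apply/eqP; have := H i; rewrite negbK.
have := pM _ Ki; rewrite -row_mul mulmx_ker row0 mul0mx mxE ltxx //.
Qed.

Lemma posdef_induced (G : 'M[R]_3) : posdef G ->
  posdef (\matrix_(a < 2, b < 2) G (lift ord0 a) (lift ord0 b)).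
Proof.
move=> pG v v0.
pose w : 'rV[R]_3 := \row_j oapp (v ord0) 0 (unlift ord0 j).
have wl a : w ord0 (lift ord0 a) = v ord0 a by rewrite mxE liftK.
have w0 : w ord0 ord0 = 0 by rewrite mxE unlift_none.
have wn0 : w != 0.
  apply: contra v0 => /eqP E; apply/eqP/rowP => a.
  by rewrite -wl E !mxE.
have := pG _ wn0; rewrite mulmx_entry big_ord_recl [X in _ * X]mxE w0 mulr0 add0r.
congr (_ < _); rewrite [RHS]mulmx_entry; apply: eq_bigr => a _.
rewrite [X in _ * X = _]mxE wl [X in _ = _ * X]mxE; congr (_ * _).
rewrite !mulmx_entry big_ord_recl w0 mul0r add0r; apply: eq_bigr => b _.
by rewrite wl mxE.
Qed.

(** The entry is the value of the quadratic form [G] on the first row of its inverse. *)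
Lemma posdef_inv00 (G : 'M[R]_3) : G^T = G -> posdef G -> 0 < invmx G ord0 ord0.
Proof.
move=> sG pG; have uG := posdef_unit pG.
have sI : (invmx G)^T = invmx G by rewrite trmx_inv sG.
have v0 : row ord0 (invmx G) != 0.
  apply/negP => /eqP E; have : row ord0 (invmx G *m G) = 0 by rewrite row_mul E mul0mx.
  rewrite mulVmx // => /rowP/(_ ord0); rewrite !mxE => /eqP.
  by rewrite oner_eq0.
have := pG _ v0; rewrite -row_mul mulVmx // tr_row sI.
rewrite mulmx_entry (bigD1 ord0) //= big1 => [|k k0].
  by rewrite !mxE mul1r addr0.
by rewrite !mxE eq_sym (negbTE k0) mul0r.
Qed.

End PosDef.

Section Overlap.
Variables (R : realType) (X : topologicalType).
Notation V := 'rV[R]_3.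
Implicit Types c d : chart R X.

Definition overlap c d : set V := cmap c @` (cdom c `&` cdom d).

Lemma overlapP c d x : overlap c d x <-> cimg c x /\ cdom d (cinv c x).
Proof.
split=> [[p [cp dp] <-]|[cx dx]]; first by split; [exact: cmap_fun|rewrite cmapK].
by exists (cinv c x); [split=> //; exact: cinv_fun|exact: cinvK].
Qed.

Lemma overlap_ropen c d : ropen true (overlap c d).
Proof.
have oc := cimg_ropen c; split=> x /overlapP[cx dx]; first exact: oc.1.
have cc : cinv c @ within (cimg c) (nbhs x) --> cinv c x.
  by have /subspace_continuousP := cinv_continuous (c := c); exact.
have dN : nbhs (cinv c x) (cdom d) by apply: open_nbhs_nbhs; split=> //; exact: cdom_open.
have H1 : nbhs x [set y | cimg c y -> cdom d (cinv c y)] := cc _ dN.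
have H2 : nbhs x [set y | hs true y -> cimg c y] := oc.2 _ cx.
rewrite /within /=; apply: filterS2 H1 H2 => y h1 h2 hy; apply/overlapP.
by split; [exact: h2|apply: h1; exact: h2].
Qed.

Lemma transition_overlap c d x : overlap c d x -> overlap d c (transition c d x).
Proof.
move=> [p [cp dp] <-]; exists p => //; by rewrite /transition cmapK.
Qed.

Lemma transitionK c d x : overlap c d x -> transition d c (transition c d x) = x.
Proof. by move=> [p [cp dp] <-]; rewrite /transition !cmapK. Qed.

Lemma overlap_cimg c d : overlap c d `<=` cimg c.
Proof. by move=> x /overlapP[]. Qed.

End Overlap.

(** * Metrics on overlaps of charts and invariance of the boundary *)

Section MetricInCharts.
Variables (R : realType) (X : manifold3 R).
Notation V := 'rV[R]_3.
Implicit Types (c d : atlas X) (g : riemannian X).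

Lemma metric_posdef_at g c x : cimg (val c) x -> posdef (g c x).
Proof. by move=> cx v v0; exact: metric_posdef. Qed.

Lemma metric_unit g c x : cimg (val c) x -> g c x \in unitmx.
Proof. by move=> cx; apply: posdef_unit; exact: metric_posdef_at. Qed.

Lemma metric_inv00 g c x : cimg (val c) x -> 0 < invmx (g c x) ord0 ord0.
Proof.
by move=> cx; apply: posdef_inv00; [exact: Defs.metric_sym|exact: metric_posdef_at].
Qed.

Lemma induced_unit g c x : cimg (val c) x -> induced_metric (g c) x \in unitmx.
Proof.
by move=> cx; apply: posdef_unit; apply: posdef_induced; exact: metric_posdef_at.
Qed.

Lemma metric_msmooth g c : msmooth (cimg (val c)) (g c).
Proof. by move=> k l; exact: metric_smooth. Qed.

Lemma transition_smooth c d j :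
  smooth_on (overlap (val c) (val d)) (fun x => transition (val c) (val d) x ord0 j).
Proof. exact: atlas_smooth. Qed.

Lemma metric_overlap g c d x : overlap (val c) (val d) x ->
  g c x = Defs.jacobian (transition (val c) (val d)) x *m
    g d (transition (val c) (val d) x) *m
    (Defs.jacobian (transition (val c) (val d)) x)^T.
Proof.
move=> [p [cp dp] <-]; rewrite /transition cmapK //.
exact: metric_transform.
Qed.

Lemma msmooth_overlap g c d : msmooth (overlap (val c) (val d)) (g c).
Proof.
by move=> k l; exact: (smooth_on_sub (@overlap_cimg _ _ (val c) (val d)) (@metric_msmooth g c k l)).
Qed.

(** A metric certifies the invertibility: [g c] is invertible and has the Jacobian as a factor. This
    is why the lemmas about the boundary carry a metric among their arguments. *)
Lemma transition_jac_unit g c d x : overlap (val c) (val d) x ->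
  Defs.jacobian (transition (val c) (val d)) x \in unitmx.
Proof.
move=> ox; apply: (@jac_unit R (overlap (val c) (val d)) _ (g c) (g d)) ox.
  by move=> y /overlap_cimg; exact: metric_unit.
exact: metric_overlap.
Qed.

Lemma scalar_chart g c d p : cdom (val c) p -> cdom (val d) p ->
  scalar_coord (g c) (cmap (val c) p) = scalar_coord (g d) (cmap (val d) p).
Proof.
move=> cp dp; have ox : overlap (val c) (val d) (cmap (val c) p) by exists p.
rewrite (@scalar_transform R _ _ (overlap_ropen (val c) (val d))
  (overlap_ropen (val d) (val c)) (transition (val c) (val d)) (g c) (g d)) //.
- by rewrite /transition cmapK.
- exact: transition_overlap.
- exact: transition_smooth.
- exact: msmooth_overlap.
- exact: msmooth_overlap.
- exact: Defs.metric_sym.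
- exact: Defs.metric_sym.
- by move=> y /overlap_cimg; exact: metric_unit.
- by move=> y /overlap_cimg; exact: metric_unit.
- exact: metric_overlap.
Qed.

(* At an interior point the derivative of a nonnegative function vanishes where
   the function does. *)
Lemma pd_min (A : set V) (f : V -> R) j x : ropen true A -> A x ->
  smooth_on A f -> (forall y, A y -> 0 <= f y) -> f x = 0 -> 0 < x ord0 ord0 ->
  pd true j f x = 0.
Proof.
move=> oA Ax sf f0 fx x0; have := smooth_on_is_pd oA (i := j) sf Ax.
set l := pd _ _ _ _ => fl.
have line : \forall h \near pd_filter true j x, A (x + h *: basis_vec R j).
  exact: (@pd_filter_line _ true j x _ (oA.2 _ Ax)).
apply/eqP; rewrite -normr_le0; apply/ler_addgt0Pl => eps eps0; rewrite addr0.
have /cvgrPdist_lt/(_ _ eps0) H := fl.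
have : \forall h \near pd_filter true j x, A (x + h *: basis_vec R j) /\
    `|l - (f (x + h *: basis_vec R j) - f x) / h| < eps by exact: filterI line H.
rewrite /pd_filter near_withinE => -[d /= d0 dP].
pose r := Num.min d (x ord0 ord0) / 2.
have r0 : 0 < r by rewrite divr_gt0 // lt_min d0.
have m1 : Num.min d (x ord0 ord0) <= d by rewrite ge_min lexx.
have m2 : Num.min d (x ord0 ord0) <= x ord0 ord0 by rewrite ge_min lexx orbT.
have rd : r < d by rewrite /r; lra.
have rx : r <= x ord0 ord0 by rewrite /r; lra.
have P h : `|h| = r -> A (x + h *: basis_vec R j) /\
    `|l - f (x + h *: basis_vec R j) / h| < eps.
  have -> : f (x + h *: basis_vec R j) = f (x + h *: basis_vec R j) - f x.
    by rewrite fx subr0.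
  move=> hr; apply: dP => /=; first by rewrite sub0r normrN hr.
    by rewrite -normr_gt0 hr.
  rewrite /half_space /= !mxE eqxx /=; case: (_ == j); last by rewrite mulr0 addr0 ltW.
  by rewrite mulr1; have := ler_norm (- h); rewrite normrN hr; lra.
have [A1 H1] := P r (gtr0_norm r0).
have [A2 H2] := P (- r) (etrans (normrN r) (gtr0_norm r0)).
have q1 : 0 <= f (x + r *: basis_vec R j) / r by rewrite divr_ge0 ?f0 // ltW.
have q2 : f (x + (- r) *: basis_vec R j) / - r <= 0.
  by rewrite invrN mulrN oppr_le0 divr_ge0 ?f0 // ltW.
move: H1 H2; rewrite !ltr_norml => /andP[H1 _] /andP[_ H2].
by rewrite ler_norml; apply/andP; split; lra.
Qed.

(** If the image were an interior point, the normal coordinate of the first chart would attain its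
    minimum 0 there; its gradient, a column of the invertible Jacobian of the inverse transition,
    would vanish. *)
Lemma transition_boundary g c d x : overlap (val c) (val d) x ->
  x ord0 ord0 = 0 -> transition (val c) (val d) x ord0 ord0 = 0.
Proof.
move=> ox x0; set y := transition _ _ x.
have oy : overlap (val d) (val c) y by exact: transition_overlap.
have hy : 0 <= y ord0 ord0.
  by have := (cimg_ropen (val d)).1 _ (overlap_cimg oy).
apply/eqP; rewrite eq_le hy andbT leNgt; apply/negP => y0.
have := mulVmx (transition_jac_unit g oy) => /matrixP/(_ ord0 ord0).
rewrite mulmx_entry big1 => [|k _].
  by rewrite mxE eqxx => /eqP; rewrite eq_sym oner_eq0.
rewrite [X in _ * X]jacE (@pd_min (overlap (val d) (val c))) ?mulr0 //.
- exact: overlap_ropen.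
- exact: transition_smooth.
- move=> z /transition_overlap oz.
  by have := (cimg_ropen (val c)).1 _ (overlap_cimg oz).
- by rewrite transitionK.
Qed.

Definition normal_factor c d x : R :=
  Defs.jacobian (transition (val c) (val d)) x ord0 ord0.

(** The derivative is a limit of quotients of nonnegative numbers, as the transition maps the
    half-space into itself and fixes the value 0; it is nonzero by [jac_normal]. *)
Lemma normal_factor_gt0 g c d x : overlap (val c) (val d) x ->
  x ord0 ord0 = 0 -> 0 < normal_factor c d x.
Proof.
move=> ox x0; rewrite lt_neqAle eq_sym (@jac_normal R (overlap (val c) (val d))
  (overlap_ropen _ _) (transition (val c) (val d)) (g c) (g d)) //; last first.
- by move=> y oy; exact: transition_boundary.
- exact: metric_overlap.
- by move=> y /overlap_cimg; exact: metric_unit.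
rewrite /normal_factor jacE /=.
have sf := @transition_smooth c d ord0.
have oA := overlap_ropen (val c) (val d).
have fl := smooth_on_is_pd oA (i := ord0) sf ox.
have ? := @pd_filter_proper R true ord0 x (oA.1 _ ox).
have line : \forall h \near pd_filter true ord0 x,
    overlap (val c) (val d) (x + h *: basis_vec R ord0).
  exact: (@pd_filter_line _ true ord0 x _ (oA.2 _ ox)).
rewrite -(cvg_lim (@Rhausdorff R) fl); apply: limr_ge; first by apply/cvg_ex; eexists; exact: fl.
have hs0 : \forall h \near pd_filter true ord0 x, hs true (x + h *: basis_vec R ord0).
  by rewrite /pd_filter near_withinE; near=> h.
apply: filterS2 line hs0 => h oh.
rewrite (transition_boundary g ox x0) subr0 /hs /half_space /= !mxE x0 add0r eqxx mulr1 => h0.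
rewrite divr_ge0 //.
by have := (cimg_ropen (val d)).1 _ (overlap_cimg (transition_overlap oh)).
Unshelve. all: by end_near. Qed.

Lemma bdry_q_chart g c d x : overlap (val c) (val d) x -> x ord0 ord0 = 0 ->
  bdry_q (g c) x = normal_factor c d x * bdry_q (g d) (transition (val c) (val d) x).
Proof.
move=> ox x0.
rewrite (@bdry_q_transform R _ _ (overlap_ropen (val c) (val d))
  (overlap_ropen (val d) (val c)) (transition (val c) (val d)) (g c) (g d)) //.
- exact: transition_overlap.
- exact: transition_smooth.
- exact: msmooth_overlap.
- exact: Defs.metric_sym.
- exact: Defs.metric_sym.
- by move=> y /overlap_cimg; exact: metric_unit.
- by move=> y /overlap_cimg; exact: metric_unit.
- exact: metric_overlap.
- by move=> y oy; exact: transition_boundary.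
- exact: induced_unit (overlap_cimg ox).
Qed.

End MetricInCharts.

Section CurvatureFamilies.
Variables (R : realType) (Y : topologicalType).
Notation V := 'rV[R]_3.
Variables (A : set V) (oA : ropen true A) (g : Y -> V -> 'M[R]_3).
Hypothesis sg : forall i j, sfam A (fun y x => g y x i j).
Hypothesis gpd : forall y x, A x -> posdef (g y x).
Hypothesis gsym : forall y x, (g y x)^T = g y x.

Let gu y x : A x -> g y x \in unitmx.
Proof. by move=> Ax; apply: posdef_unit; exact: gpd. Qed.

Lemma sfam_christoffel k i j : sfam A (fun y => christoffel (g y) k i j).
Proof.
apply: (sfam_ext oA (F := fun y x => 2^-1 * \sum_l invmx (g y x) k l *
    (pd true i (fun z => g y z j l) x + pd true j (fun z => g y z i l) x
     - pd true l (fun z => g y z i j) x))).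
  by move=> y x _; rewrite christoffelE.
apply: (sfamM oA); first exact: sfam_const.
apply: (sfam_sum oA) => l; apply: (sfamM oA); first exact: sfam_invmx.
apply: (sfamB oA); first apply: (sfamD oA).
- exact: (sfam_pd oA i (sg j l)).
- exact: (sfam_pd oA j (sg i l)).
- exact: (sfam_pd oA l (sg i j)).
Qed.

Lemma sfam_scalar : sfam A (fun y => scalar_coord (g y)).
Proof.
apply: (sfam_sum oA) => i; apply: (sfam_sum oA) => j.
apply: (sfamM oA); first exact: sfam_invmx.
have H k i' j' l : sfam A (fun y => pd true l (christoffel (g y) k i' j')).
  by apply: (sfam_pd oA); exact: sfam_christoffel.
rewrite /ricci_coord pderivE; apply: (sfamD oA).
  by apply: (sfam_sum oA) => k; apply: (sfamB oA).
apply: (sfam_sum oA) => k; apply: (sfam_sum oA) => l.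
by apply: (sfamB oA); apply: (sfamM oA); exact: sfam_christoffel.
Qed.

Lemma sfam_bdry_q : sfam A (fun y => bdry_q (g y)).
Proof.
apply: (sfamM oA).
  apply: (sfam_sum oA) => a.
  apply: (sfam_mulmx oA) => b c.
    apply: (sfam_invmx oA) => [b' c'|y x Ax].
      by apply: sfam_ext (sg (lift ord0 b') (lift ord0 c')) => // y x _; rewrite mxE.
    by apply: posdef_unit; apply: posdef_induced; exact: gpd.
  apply: sfam_ext (sfam_christoffel ord0 (lift ord0 c) (lift ord0 b)) => // y x _.
  by rewrite !mxE.
apply: (sfamV oA); last exact: sfam_invmx.
by move=> y x Ax; rewrite gt_eqF // posdef_inv00 //; exact: gpd.
Qed.

End CurvatureFamilies.

(** * Partitions of unity *)

Section Bump.
Variable R : realType.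
Notation V := 'rV[R]_3.

(* t^-n exp(-1/t) for t > 0; the derivative of [flat n] is a combination of
   [flat n.+1] and [flat n.+2]. *)
Definition flat (n : nat) (t : R) : R :=
  if 0 < t then t ^- n * expR (- t^-1) else 0.

Lemma flat_ge0 n t : 0 <= flat n t.
Proof.
by rewrite /flat; case: ifP => // t0; rewrite mulr_ge0 ?expR_ge0 // invr_ge0 exprn_ge0 // ltW.
Qed.

Lemma flat_gt0 t : (0 < flat 0 t) = (0 < t).
Proof.
by rewrite /flat; case: ifP => // t0; rewrite ?ltxx // expr0 invr1 mul1r expR_gt0.
Qed.

Lemma flatS n t : flat n t / t = flat n.+1 t.
Proof.
rewrite /flat; case: ifP => t0; last by rewrite mul0r.
by rewrite exprS invfM mulrC mulrA.
Qed.

(** From e^v >= v at v = 1/((n+1)t), raised to the power n+1. A bound linear in [t] for every [n]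
    suffices at 0, since dividing [flat n] by [t] gives [flat n.+1]. *)
Lemma flat_bound n t : flat n t <= n.+1%:R ^+ n.+1 * `|t|.
Proof.
have C0 : 0 <= n.+1%:R ^+ n.+1 * `|t| :> R by rewrite mulr_ge0 // exprn_ge0.
rewrite /flat; case: ifP => // t0; rewrite gtr0_norm //.
have H : (t^-1) ^+ n.+1 <= n.+1%:R ^+ n.+1 * expR (t^-1).
  have -> : t^-1 = n.+1%:R * (t^-1 / n.+1%:R) by rewrite mulrC divfK // pnatr_eq0.
  rewrite expRM_natl exprMn ler_wpM2l ?exprn_ge0 //.
  rewrite lerXn2r ?nnegrE ?expR_ge0 //; first by rewrite divr_ge0 // invr_ge0 ltW.
  by apply: le_trans (expR_ge1Dx _); rewrite lerDr.
rewrite expRN -ler_pdivlMr ?invr_gt0 ?expR_gt0 // invrK.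
rewrite -(@ler_pM2r _ t^-1) ?invr_gt0 // -exprVn -exprSr.
by rewrite mulrAC mulfK ?gt_eqF.
Qed.

Lemma flat_cvg0 n : flat n h @[h --> (0 : R)^'] --> (0 : R).
Proof.
apply/cvgrPdist_lt => eps eps0.
pose C : R := n.+1%:R ^+ n.+1.
have C0 : 0 < C by rewrite exprn_gt0.
exists (eps / C) => /=; first by rewrite divr_gt0.
move=> h /=; rewrite sub0r normrN ltr_pdivlMr // mulrC => hC _.
by rewrite sub0r normrN ger0_norm ?flat_ge0 // (le_lt_trans (flat_bound n h)).
Qed.

Lemma is_derive_cvg (f : R -> R) (t l : R) :
  (f (t + h) - f t) / h @[h --> (0 : R)^'] --> l -> is_derive t 1 f l.
Proof.
move=> fl; have H : (fun h : R => h^-1 *: ((f \o shift t) (h *: (1 : R)) - f t))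
    @ (0:R)^' --> l.
  apply: cvg_trans fl; apply: near_eq_cvg; near=> h => /=.
  by rewrite [RHS]mulrC [h *: _]mulr1 [h + t]addrC.
by apply: DeriveDef; [apply/cvg_ex; exists l|apply: cvg_lim].
Unshelve. all: by end_near. Qed.

Lemma cvg_is_derive (f : R -> R) (t l : R) : is_derive t 1 f l ->
  (f (t + h) - f t) / h @[h --> (0 : R)^'] --> l.
Proof.
move=> [fd fE]; rewrite -fE; apply: cvg_trans fd; apply: near_eq_cvg.
by near=> h => /=; rewrite [LHS]mulrC [h *: _]mulr1 [h + t]addrC.
Unshelve. all: by end_near. Qed.

Lemma flat_derive n (t : R) :
  is_derive t 1 (flat n) (flat n.+2 t - n%:R * flat n.+1 t).
Proof.
have [t0|t0|->] := ltgtP t 0.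
- have near0 : \forall s \near t, flat n s = 0.
    near=> s; rewrite /flat; case: ifP => // s0.
    suff : s < 0 by rewrite ltNge ltW.
    by near: s; exact: lt_nbhsl.
  have -> : flat n.+2 t - n%:R * flat n.+1 t = 0.
    by rewrite /flat ltNge (ltW t0) /= mulr0 subrr.
  apply: (@near_eq_is_derive _ _ _ (fun=> 0)).
  by near=> s; rewrite (near near0 s).
- have tn0 : t != 0 by rewrite gt_eqF.
  have H1 := is_deriveV tn0 (is_derive_id t (1 : R)).
  have H3 := is_derive1_comp (is_derive_expR _) (is_deriveN H1).
  have tn : (id ^+ n : R -> R) t != 0 by rewrite exprfctE expf_neq0.
  have H5 := is_deriveV tn (is_deriveX n (is_derive_id t (1 : R))).
  have H6 := is_deriveM H5 H3.
  apply: (@near_eq_is_derive _ _ _ _ _ _ _ _ _ (is_derive_eq H6 _)).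
    near=> s; rewrite /flat ifT; last by near: s; exact: lt_nbhsr.
    by rewrite fctE /= exprfctE.
  rewrite /flat t0 /= !exprfctE /= [_ *: 1]mulr1 [_ *: 1]mulr1.
  change (t ^- n * (expR (- t^-1) * - - t ^- 2) +
    expR (- t^-1) * (- t ^+ n ^- 2 * (n%:R * t ^+ n.-1)) =
    t ^- n.+2 * expR (- t^-1) - n%:R * (t ^- n.+1 * expR (- t^-1))).
  move: (expR _) => E; have tm m : t ^+ m != 0 by rewrite expf_neq0.
  case: n tn H5 H6 => [|m] _ _ _.
    by rewrite !mul0r !mulr0 addr0 subr0 expr0; field.
  by rewrite /= !exprS; field; rewrite tn0 tm.
- have flat0 m : flat m 0 = 0 by rewrite /flat ltxx.
  rewrite !flat0 mulr0 subrr; apply: is_derive_cvg.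
  apply: cvg_trans (flat_cvg0 n.+1); apply: near_eq_cvg; near=> h.
  by rewrite add0r flat0 subr0 flatS.
Unshelve. all: by end_near. Qed.

Lemma is_pd_flat n (i : 'I_3) (x : V) :
  is_pd false i (fun y => flat n (y ord0 ord0)) x
    ((flat n.+2 (x ord0 ord0) - n%:R * flat n.+1 (x ord0 ord0)) * (ord0 == i)%:R).
Proof.
rewrite /is_pd pd_filterF; have [<-|i0] := eqVneq ord0 i.
  rewrite mulr1; apply: cvg_trans (cvg_is_derive (flat_derive n _)).
  by apply: near_eq_cvg; near=> h; rewrite !mxE eqxx /= mulr1.
rewrite mulr0; have H : (fun=> 0 : R) @ (0 : R)^' --> (0 : R) by exact: cvg_cst.
apply: cvg_trans H; apply: near_eq_cvg; near=> h.
by rewrite !mxE eqxx (negbTE i0) /= mulr0 addr0 subrr mul0r.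
Unshelve. all: by end_near. Qed.

Lemma smooth_flat (A : set V) : smooth_on A (fun y => flat 0 (y ord0 ord0)).
Proof.
apply/smooth_onP => x Ax; exists (fun y => flat 0 (y ord0 ord0)); last by near=> y.
exists setT; split=> //; first exact: openT.
have oT : ropen false (setT : set V) by apply: open_ropen; exact: openT.
(* All [flat n] are treated at once, because differentiation leads from [flat 0] to larger
   indices. *)
suff H k n : famk false setT k (fun _ : bool => fun y : V => flat n (y ord0 ord0)).
  by move=> k; exact: H.
have C m y (z : V) : jcont false (fun _ : bool => fun y : V => flat m (y ord0 ord0)) y z.
  apply/jcont_single; rewrite withinT_id.
  apply: (@cvg_comp _ _ _ (fun y : V => y ord0 ord0) (flat m) _ (nbhs (z ord0 ord0))).
    exact: coord_continuous.
  apply: differentiable_continuous; apply/derivable1_diffP.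
  by have [] := flat_derive m (z ord0 ord0).
elim: k n => [|k IH] n; first by move=> y z _; split.
apply: (@famk_step _ _ _ _ oT k _ (fun i _ y =>
   (flat n.+2 (y ord0 ord0) + (- n%:R) * flat n.+1 (y ord0 ord0)) * (ord0 == i)%:R)).
- by move=> y z _.
- by move=> i y z _; rewrite mulNr; exact: is_pd_flat.
- move=> i; apply: (famkM oT); last by apply: famk_cst => //; exact: cst_continuous.
  apply: (famkD oT); first exact: IH.
  by apply: (famkM oT) => //; apply: famk_cst => //; exact: cst_continuous.
Unshelve. all: by end_near. Qed.

(** Balls of the maximum norm are cubes, so a product of one-variable factors is positive exactly on
    a ball. *)
Definition bump (c : V) (r : R) (x : V) : R :=
  \prod_(j < 3) (flat 0 (r - (x ord0 j - c ord0 j)) *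
                 flat 0 (r + (x ord0 j - c ord0 j))).

Lemma bump_ge0 c r x : 0 <= bump c r x.
Proof. by apply: prodr_ge0 => j _; rewrite mulr_ge0 // flat_ge0. Qed.

Lemma bump_gt0 c r x : 0 < r -> (0 < bump c r x) = (`|x - c| < r).
Proof.
move=> r0; apply/idP/idP.
  move=> H; apply: norm_lt_coord => // j; rewrite !mxE ltr_norml.
  have : flat 0 (r - (x ord0 j - c ord0 j)) * flat 0 (r + (x ord0 j - c ord0 j)) != 0.
    apply: contraTneq H => H; rewrite -leNgt /bump (bigD1 j) //= H mul0r //.
  rewrite mulf_eq0 negb_or => /andP[h1 h2].
  have {}h1 : 0 < flat 0 (r - (x ord0 j - c ord0 j)) by rewrite lt_def h1 flat_ge0.
  have {}h2 : 0 < flat 0 (r + (x ord0 j - c ord0 j)) by rewrite lt_def h2 flat_ge0.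
  by move: h1 h2; rewrite !flat_gt0 => h1 h2; apply/andP; split; lra.
move=> H; apply: prodr_gt0 => j _.
have := le_lt_trans (coord_le_norm (x - c) j) H; rewrite !mxE ltr_norml => /andP[h1 h2].
by rewrite mulr_gt0 // flat_gt0; lra.
Qed.

Lemma smooth_bump (A : set V) c r : ropen true A -> smooth_on A (bump c r).
Proof.
move=> oA.
(* [flat 0] is known to be smooth only as a function of the coordinate 0, so [f x] is placed in that
   coordinate before composing. *)
have H (f : V -> R) : smooth_on A f -> smooth_on A (fun x => flat 0 (f x)).
  move=> sf; apply: (@smooth_on_ext _ _ (fun x => flat 0 ((f x *: basis_vec R ord0) ord0 ord0))).
    by move=> x _; rewrite !mxE mulr1.
  apply: (@smooth_on_comp _ A setT (fun y => flat 0 (y ord0 ord0)) (fun x => f x *: basis_vec R ord0)) => //.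
    move=> j; apply: (@smooth_on_ext _ _ (fun x => f x * (j == ord0)%:R)).
      by move=> x _; rewrite !mxE.
    by apply: smooth_onM => //; exact: smooth_on_cst.
  exact: smooth_flat.
have S (s : R) j : smooth_on A (fun x => flat 0 (r + s * (x ord0 j - c ord0 j))).
  apply: H; apply: smooth_onD; first exact: smooth_on_cst.
  apply: smooth_onM; first exact: smooth_on_cst.
  by apply: smooth_onD; [exact: smooth_on_coord|exact: smooth_on_cst].
have [+ _] := @sfam_prod R bool A oA 'I_3 (index_enum 'I_3)
  (fun j _ x => flat 0 (r + (-1) * (x ord0 j - c ord0 j)) *
     flat 0 (r + 1 * (x ord0 j - c ord0 j)))
  (fun j => sfamM oA (sfam_single _ oA (S (-1) j)) (sfam_single _ oA (S 1 j))).
move=> /(_ true); apply: smooth_on_ext => x _.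
by apply: eq_bigr => j _; rewrite mulN1r mul1r.
Qed.

End Bump.

Definition chart_ext (R : realType) (X : topologicalType) (a : chart R X)
    (f : 'rV[R]_3 -> R) (q : X) : R :=
  if pselect (cdom a q) then f (cmap a q) else 0.

(** * Extension by zero from charts and partitions of unity *)

Section Gluing.
Variables (R : realType) (X : manifold3 R).
Notation V := 'rV[R]_3.
Implicit Types (a c : atlas X).

Lemma chart_compact_closed a (K : set V) : compact K -> K `<=` cimg (val a) ->
  closed (cinv (val a) @` K).
Proof.
move=> cK Ka; apply: compact_closed; first exact: manifold_hausdorff.
apply: continuous_compact => //.
apply: continuous_subspaceW Ka _; exact: cinv_continuous.
Qed.

Lemma chart_ext_in a f q : cdom (val a) q -> chart_ext (val a) f q = f (cmap (val a) q).
Proof. by rewrite /chart_ext; case: pselect. Qed.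

(** The manifold is Hausdorff, so the compact image of [K] is closed and points outside the chart
    domain have a neighborhood missing it. The quantifier over [f] stands inside, so that one
    neighborhood serves a whole family. *)
Lemma near_chart_ext0 a c (K : set V) x : compact K -> K `<=` cimg (val a) ->
  cimg (val c) x -> ~ cdom (val a) (cinv (val c) x) ->
  \forall x' \near x, cimg (val c) x' ->
    forall f, (forall y, cimg (val a) y -> ~ K y -> f y = 0) ->
    chart_ext (val a) f (cinv (val c) x') = 0.
Proof.
move=> cK Ka cx nax; have cC := chart_compact_closed cK Ka.
have nK : ~ (cinv (val a) @` K) (cinv (val c) x).
  by move=> [z Kz Ez]; apply: nax; rewrite -Ez; apply: cinv_fun; exact: Ka.
have cc : cinv (val c) @ within (cimg (val c)) (nbhs x) --> cinv (val c) x.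
  by have /subspace_continuousP := cinv_continuous (c := val c); exact.
have oC : nbhs (cinv (val c) x) (~` (cinv (val a) @` K)).
  by apply: open_nbhs_nbhs; split => //; exact: closed_openC.
have N : nbhs x [set z | cimg (val c) z -> ~ (cinv (val a) @` K) (cinv (val c) z)] := cc _ oC.
apply: filterS N => z /= + cz f F0 => /(_ cz) nz; rewrite /chart_ext.
case: pselect => //= az; rewrite F0 //; first exact: cmap_fun.
by move=> Kz; apply: nz; exists (cmap (val a) (cinv (val c) z)) => //; rewrite cmapK.
Qed.

Lemma sfam_chart_ext (Y : topologicalType) a (F : Y -> V -> R) (K : set V) :
  compact K -> K `<=` cimg (val a) -> sfam (cimg (val a)) F ->
  (forall y x, cimg (val a) x -> ~ K x -> F y x = 0) ->
  forall c, sfam (cimg (val c)) (fun y x => chart_ext (val a) (F y) (cinv (val c) x)).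
Proof.
move=> cK Ka sF F0 c; have oc := cimg_ropen (val c).
apply: sfam_local => x cx; have [ax|nax] := pselect (cdom (val a) (cinv (val c) x)).
  have ox : overlap (val c) (val a) x by apply/overlapP.
  exists [set z | hs true z -> overlap (val c) (val a) z]; split.
    exact: (overlap_ropen (val c) (val a)).2.
  apply: (@sfam_sub _ _ _ (overlap (val c) (val a))).
    by move=> z [cz]; apply; exact: oc.1.
  apply: (sfam_ext (overlap_ropen _ _)
     (F := fun y z => F y (transition (val c) (val a) z))).
    by move=> y z /overlapP[cz az]; rewrite chart_ext_in.
  apply: (sfam_comp (overlap_ropen _ _) (cimg_ropen (val a))) sF.
    by move=> z /transition_overlap /overlap_cimg.
  exact: transition_smooth.
have H := near_chart_ext0 cK Ka cx nax.
exists ([set z | cimg (val c) z -> forall f, (forall y, cimg (val a) y -> ~ K y -> f y = 0) ->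
   chart_ext (val a) f (cinv (val c) z) = 0]^°); split.
  by apply: open_nbhs_nbhs; split => //; exact: open_interior.
have oB := ropenI (@open_interior _ [set z | cimg (val c) z ->
  forall f, (forall y, cimg (val a) y -> ~ K y -> f y = 0) ->
  chart_ext (val a) f (cinv (val c) z) = 0]) oc.
apply: (sfam_ext oB (F := fun _ _ => 0)); last exact: sfam_const.
by move=> y z [cz /interior_subset /(_ cz (F y) (F0 y)) ->].
Qed.

Lemma chart_at_dom (p : X) : cdom (val (chart_at p)) p.
Proof. by rewrite /chart_at; case: cid. Qed.

Lemma coord_at_cimg (p : X) : cimg (val (chart_at p)) (coord_at p).
Proof. by apply: cmap_fun; exact: chart_at_dom. Qed.

Lemma chart_nbhs a p (N : set V) : cdom (val a) p -> nbhs (cmap (val a) p) N ->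
  \forall q \near p, cdom (val a) q /\ N (cmap (val a) q).
Proof.
move=> ap Nx; have ad : nbhs p (cdom (val a)).
  by apply: open_nbhs_nbhs; split=> //; exact: cdom_open.
have cc : cmap (val a) @ within (cdom (val a)) (nbhs p) --> cmap (val a) p.
  by have /subspace_continuousP := cmap_continuous (c := val a); exact.
have H : nbhs p [set q | cdom (val a) q -> N (cmap (val a) q)] := cc _ Nx.
by apply: filterS2 ad H => q aq /(_ aq).
Qed.

Definition plateau (p : X) (K : set V) (b : X -> R) :=
  [/\ compact K /\ K `<=` cimg (val (chart_at p)), forall q, 0 <= b q,
      forall q, b q != 0 -> cdom (val (chart_at p)) q /\ K (cmap (val (chart_at p)) q),
      forall c, smooth_on (cimg (val c)) (fun x => b (cinv (val c) x))
    & \forall q \near p, 0 < b q].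

Lemma exists_plateau p : exists K b, plateau p K b.
Proof.
have oa := cimg_ropen (val (chart_at p)).
have /nbhs_distP[r r0 rP] := oa.2 _ (coord_at_cimg p).
pose K : set V := [set x' | hs true x' /\ `|x' - coord_at p| <= r / 2].
have r20 : 0 < r / 2 by rewrite divr_gt0.
have Ka : K `<=` cimg (val (chart_at p)).
  by move=> x' [hx' xr]; apply: rP => //; apply: le_lt_trans xr _; lra.
have cK : compact K by exact: compact_half_ball.
have bK x : cimg (val (chart_at p)) x -> ~ K x -> bump (coord_at p) (r / 2) x = 0.
  move=> ax nK; apply/eqP; rewrite eq_le bump_ge0 andbT leNgt bump_gt0 //.
  by apply/negP => xr; apply: nK; split; [exact: oa.1|exact: ltW].
exists K, (chart_ext (val (chart_at p)) (bump (coord_at p) (r / 2))); split=> //.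
- by move=> q; rewrite /chart_ext; case: pselect => //= _; exact: bump_ge0.
- move=> q; rewrite /chart_ext; case: pselect => [aq|nq] /=; last by rewrite eqxx.
  move=> b0; split=> //; apply: contrapT => nK; move/eqP: b0; apply.
  by apply: bK => //; exact: cmap_fun.
- move=> c; have [+ _] := @sfam_chart_ext bool (chart_at p) (fun _ => bump (coord_at p) (r / 2))
    K cK Ka (sfam_single _ oa (smooth_bump _ _ oa)) (fun _ => bK) c.
  by move=> /(_ true).
- have N : nbhs (cmap (val (chart_at p)) p) [set x | `|x - coord_at p| < r / 2].
    by apply/nbhs_distP; exists (r / 2).
  have := chart_nbhs (chart_at_dom p) N; apply: filterS => q [aq /= xq].
  by rewrite chart_ext_in // bump_gt0.
Qed.

Lemma finite_subcover (N : X -> set X) : compact [set: X] ->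
  (forall p, nbhs p (N p)) -> exists s : seq X, forall q, exists2 p, p \in s & N p q.
Proof.
(* In this filter a property holds eventually if it holds for all lists containing a given one.
   Compactness, as a covering property along filters, then yields one list serving all points. *)
move=> cX NP; pose F : set_system (seq X) := [set S | exists s : seq X, forall s' : seq X, {subset s <= s'} -> S s'].
have FF : Filter F.
  split.
  - by exists [::].
  - move=> P Q [s sP] [t tQ]; exists (s ++ t) => s' ss; split.
      by apply: sP => z zs; apply: ss; rewrite mem_cat zs.
    by apply: tQ => z zs; apply: ss; rewrite mem_cat zs orbT.
  - by move=> P Q PQ [s sP]; exists s => s' /sP; exact: PQ.
have /compact_near_coveringP/near_covering_withinP/(_ _ F
   (fun (s : seq X) q => exists2 p, p \in s & N p q)) := cX.
case=> [q _|s sP].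
  exists (N q, [set s : seq X | q \in s]).
    by split=> //; exists [:: q] => s'; apply; rewrite mem_head.
  by move=> [q' s] [/= Nq qs] _; exists q.
by exists s => q; apply: sP.
Qed.

(** The compact sets [K p] serve twice: as supports for extension by zero, and as the sets on which
    the jets of a metric determine the topology. *)
Record partition_unity (s : seq X) (K : X -> set V) (chi : X -> X -> R) : Prop := {
  pu_compact : forall p, compact (K p);
  pu_cimg : forall p, K p `<=` cimg (val (chart_at p));
  pu_supp : forall p q, chi p q != 0 ->
    cdom (val (chart_at p)) q /\ K p (cmap (val (chart_at p)) q);
  pu_ge0 : forall p q, 0 <= chi p q;
  pu_sum : forall q, \sum_(p <- s) chi p q = 1;
  pu_smooth : forall p c, smooth_on (cimg (val c)) (fun x => chi p (cinv (val c) x))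
}.

Lemma exists_partition_unity : compact [set: X] ->
  exists s K chi, partition_unity s K chi.
Proof.
move=> cX.
have /choice[K /choice[b bP]] : forall p, exists K, exists b, plateau p K b.
  exact: exists_plateau.
have [|s0 s0P] := @finite_subcover (fun p q => 0 < b p q) cX.
  by move=> p; have [] := bP p.
pose s := undup s0; pose S q := \sum_(p <- s) b p q.
have b0 p q : 0 <= b p q by have [] := bP p.
have S0 q : 0 < S q.
  have [p ps bpq] := s0P q; rewrite /S (bigD1_seq p) /= ?undup_uniq ?mem_undup //.
  by rewrite ltr_pwDl // sumr_ge0.
exists s, K, (fun p q => b p q / S q); split.
- by move=> p; have [[]] := bP p.
- by move=> p; have [[]] := bP p.
- move=> p q; rewrite mulf_eq0 negb_or => /andP[bn _].
  by have [_ _ /(_ q bn)] := bP p.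
- by move=> p q; rewrite divr_ge0 // ltW.
- by move=> q; rewrite -mulr_suml; apply: divff; rewrite gt_eqF //; exact: S0.
- move=> p c; have oc := cimg_ropen (val c).
  have bs p' : smooth_on (cimg (val c)) (fun x => b p' (cinv (val c) x)).
    by have [_ _ _ /(_ c)] := bP p'.
  apply: smooth_onM; first exact: bs.
  apply: smooth_onV; first by move=> x _; rewrite gt_eqF.
  have [+ _] := @sfam_sum R bool _ oc X s xpredT (fun p _ x => b p (cinv (val c) x))
    (fun p => sfam_single _ oc (bs p)).
  by move=> /(_ true).
Qed.

End Gluing.

(** * Metrizability and separability *)

Section CountableUniformMetric.
Variables (R : realType) (T : choiceType) (P : Type).
Variables (K : nat -> set P) (D : nat -> T -> P -> R).

Definition separates := forall t t' : T,
  (forall n x, K n x -> D n t x = D n t' x) -> t = t'.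

Definition dist_set (t t' : T) : set R := [set r | r = 0 \/
  exists n x, K n x /\ r = Num.min n.+1%:R^-1 `|D n t x - D n t' x|].

(* Truncating the [n]-th seminorm at 1/(n+1) makes the supremum metrize the
   convergence in every seminorm. *)
Definition udist t t' := sup (dist_set t t').

Lemma dist_set_sup t t' : has_sup (dist_set t t').
Proof.
split; first by exists 0; left.
exists 1 => r [->|[n [x [_ ->]]]]; first exact: ler01.
by rewrite ge_min invf_le1 // ler1n.
Qed.

Lemma udist_le t t' r : 0 <= r ->
  (forall n x, K n x -> Num.min n.+1%:R^-1 `|D n t x - D n t' x| <= r) ->
  udist t t' <= r.
Proof.
move=> r0 H; apply: ge_sup; first by exists 0; left.
by move=> _ [->//|[n [x [Kx ->]]]]; exact: H.
Qed.

Lemma udist_ge t t' n x : K n x ->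
  Num.min n.+1%:R^-1 `|D n t x - D n t' x| <= udist t t'.
Proof.
by move=> Kx; apply: ub_le_sup; [have [] := dist_set_sup t t'|right; exists n, x].
Qed.

Lemma udist_ge0 t t' : 0 <= udist t t'.
Proof. by apply: ub_le_sup; [have [] := dist_set_sup t t'|left]. Qed.

Lemma udistxx t : udist t t = 0.
Proof.
apply/eqP; rewrite eq_le udist_ge0 andbT; apply: udist_le => // n x _.
by rewrite subrr normr0 ge_min lexx orbT.
Qed.

Lemma udist_positivity t t' : separates -> udist t t' = 0 -> t = t'.
Proof.
move=> sep d0; apply: sep => n x Kx; apply/eqP; rewrite -subr_eq0 -normr_le0.
have := udist_ge t t' Kx; rewrite d0 ge_min => /orP[|//].
by rewrite leNgt invr_gt0 ltr0n.
Qed.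

Lemma udist_sym t t' : udist t t' = udist t' t.
Proof.
suff H s s' : udist s s' <= udist s' s by apply/eqP; rewrite eq_le !H.
by apply: udist_le => [|n x Kx]; [exact: udist_ge0|rewrite distrC; exact: udist_ge].
Qed.

Lemma udist_triangle t' t t'' : udist t t'' <= udist t t' + udist t' t''.
Proof.
apply: udist_le => [|n x Kx]; first by rewrite addr_ge0 // udist_ge0.
have := udist_ge t t' Kx; have := udist_ge t' t'' Kx.
have := udist_ge0 t t'; have := udist_ge0 t' t''.
have := ler_distD (D n t' x) (D n t x) (D n t'' x).
have n0 : 0 < n.+1%:R^-1 :> R by rewrite invr_gt0.
rewrite !ge_min; move: (n.+1%:R^-1) n0 => r r0 H1 H2 H3 /orP[h1|h1] /orP[h2|h2]; apply/orP.
- by left; lra.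
- by left; lra.
- by left; lra.
- by right; lra.
Qed.

(** A copy of [T] to carry the new metric; the separation proof is a parameter because the instance
    needs it for positivity. *)
Definition uspace of separates : Type := T.

HB.instance Definition _ (s : separates) := Choice.on (uspace s).
HB.instance Definition _ (s : separates) := @isMetric.Build R (uspace s) udist
  udistxx (fun t t' => @udist_positivity t t' s) udist_sym udist_triangle.

Lemma uspace_nbhsP (s : separates) (t : uspace s) (A : set T) :
  nbhs t A <-> exists2 eps, 0 < eps & forall t', udist t t' < eps -> A t'.
Proof.
rewrite -nbhs_ballE; split=> -[eps eps0 H]; exists eps => //= t'; exact: H.
Qed.

Lemma uspace_near (s : separates) (t : uspace s) n eps : 0 < eps ->
  nbhs t [set t' : T | forall x, K n x -> `|D n t x - D n t' x| < eps].
Proof.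
move=> eps0; apply/uspace_nbhsP; exists (Num.min eps n.+1%:R^-1).
  by rewrite lt_min eps0 invr_gt0 ltr0n.
move=> t' /= + x Kx; rewrite lt_min => /andP[h1 h2].
have := udist_ge t t' Kx; rewrite ge_min => /orP[h|h].
  by have := le_lt_trans h h2; rewrite ltxx.
exact: le_lt_trans h1.
Qed.

Lemma uspace_basis (s : separates) (t : uspace s) A : nbhs t A ->
  exists N eps, 0 < eps /\ forall t' : T, (forall n x, (n < N)%N -> K n x ->
    `|D n t x - D n t' x| <= eps) -> A t'.
Proof.
(* Beyond this index 1/(n+1) is below [eps / 2], so the truncation alone bounds the remaining
   seminorms. *)
move=> /uspace_nbhsP[eps eps0 H]; exists (Num.truncn (2 / eps)), (eps / 2).
rewrite divr_gt0 //; split=> // t' Ht'; apply: H.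
apply: (@le_lt_trans _ _ (eps / 2)); last by lra.
apply: udist_le => [|n x Kx]; first by rewrite divr_ge0 // ltW.
rewrite ge_min; have [nN|Nn] := ltnP n (Num.truncn (2 / eps)).
  by rewrite Ht' ?orbT.
have h : 2 / eps < n.+1%:R by apply: lt_le_trans (truncnS_gt _) _; rewrite ler_nat.
apply/orP; left; rewrite -[leRHS]invrK lef_pV2 ?posrE ?invr_gt0 ?divr_gt0 //.
by rewrite invf_div ltW.
Qed.

End CountableUniformMetric.

Lemma uniform_metrizable (R : realType) (T : topologicalType) (P : Type)
    (K : nat -> set P) (D : nat -> T -> P -> R) (sep : separates K D) :
  (forall n (t : T) eps, 0 < eps ->
    \forall t' \near t, forall x, K n x -> `|D n t x - D n t' x| <= eps) ->
  continuous (id : uspace sep -> T) -> metrizable R T.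
Proof.
move=> H idc; exists (uspace sep), id, id; split=> // t A /uspace_basis[N [eps [eps0 HA]]].
have : \forall t' \near t, forall n : 'I_N, forall x, K n x -> `|D n t x - D n t' x| <= eps.
  by apply: filter_forall => n; exact: H.
rewrite nbhs_simpl; apply: filterS => t' Ht'; apply: HA => n x nN.
exact: (Ht' (Ordinal nN)).
Qed.

(** * Separability by countable codes *)

Section Codes.
Variables (R : realType).
Notation V := 'rV[R]_3.

Lemma compact_net (K : set V) (d : R) : compact K -> 0 < d ->
  exists s : seq V, (forall x, x \in s -> K x) /\
    forall y, K y -> exists2 x, x \in s & `|y - x| < d.
Proof.
move=> cK d0.
(* The same filter of large lists as in [finite_subcover], generated by lists of points of [K] so
   that the net stays in [K]. *)
pose F : set_system (seq V) := [set S | exists s : seq V, (forall x, x \in s -> K x) /\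
   forall s' : seq V, {subset s <= s'} -> S s'].
have FF : Filter F.
  split.
  - by exists [::].
  - move=> P Q [s [sK sP]] [t [tK tQ]]; exists (s ++ t); split.
      by move=> x; rewrite mem_cat => /orP[/sK|/tK].
    move=> s' ss; split.
      by apply: sP => z zs; apply: ss; rewrite mem_cat zs.
    by apply: tQ => z zs; apply: ss; rewrite mem_cat zs orbT.
  - by move=> P Q PQ [s [sK sP]]; exists s; split=> // s' /sP; exact: PQ.
have /compact_near_coveringP/near_covering_withinP/(_ _ F
   (fun (s : seq V) y => exists2 x, x \in s & `|y - x| < d)) := cK.
case=> [y Ky|s [sK sP]].
  exists ([set y' | `|y' - y| < d], [set s : seq V | y \in s]).
    split=> /=; first by apply/nbhs_distP; exists d.
    exists [:: y]; split=> [x|s']; first by rewrite inE => /eqP ->.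
    by apply; rewrite mem_head.
  by move=> [y' s] [/= yy' ys] _; exists y.
by exists s; split=> // y Ky; exact: sP.
Qed.

Definition unif_cont (K : set V) (f : V -> R) := forall eps, 0 < eps ->
  exists2 d, 0 < d & forall x y, K x -> K y -> `|x - y| < d -> `|f x - f y| < eps.

(* A function uniformly continuous on [K] is determined up to [eps] by a mesh
   size and its rounded values on a finite net of that mesh. *)
Lemma exists_code (K : set V) (eps : R) : compact K -> 0 < eps ->
  exists code : (V -> R) -> nat * seq int, forall f g,
    unif_cont K f -> unif_cont K g -> code f = code g ->
    forall x, K x -> `|f x - g x| <= eps.
Proof.
move=> cK eps0; have e0 : 0 < eps / 4 by rewrite divr_gt0.
have net0 (k : nat) : 0 < k.+1%:R^-1 :> R by rewrite invr_gt0.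
have /choice[net netP] := fun k : nat => compact_net cK (net0 k).
pose good (f : V -> R) (k : nat) := forall x y, K x -> K y -> `|x - y| < k.+1%:R^-1 -> `|f x - f y| < eps / 4.
have H f : exists k, unif_cont K f -> good f k.
  have [cf|ncf] := pselect (unif_cont K f); last by exists 0%N.
  have [d d0 dP] := cf _ e0; exists (Num.truncn d^-1) => _ x y Kx Ky xy.
  apply: dP => //; apply: lt_trans xy _.
  by rewrite -[ltRHS]invrK ltf_pV2 ?posrE ?invr_gt0 // truncnS_gt.
have /choice[k kP] := H.
exists (fun f => (k f, [seq Num.floor (f x / (eps / 4)) | x <- net (k f)])).
move=> f g uf ug [kk E] y Ky.
have [netK cov] := netP (k f); have [x xn yx] := cov y Ky; have Kx := netK _ xn.
have h1 := kP f uf y x Ky Kx yx; have h2 := kP g ug y x Ky Kx; rewrite -kk in h2.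
have {}h2 := h2 yx.
have Ex : Num.floor (f x / (eps / 4)) = Num.floor (g x / (eps / 4)).
  rewrite -kk in E; have ix : (index x (net (k f)) < size (net (k f)))%N by rewrite index_mem.
  have := congr1 (fun l => nth 0 l (index x (net (k f)))) E.
  by rewrite !(nth_map 0) // nth_index.
have h3 : `|f x - g x| < eps / 4.
  have bnd (z : R) : (Num.floor (z / (eps / 4)))%:~R * (eps / 4) <= z <
      ((Num.floor (z / (eps / 4)))%:~R + 1) * (eps / 4).
    by rewrite -ler_pdivlMr // -ltr_pdivrMr // floor_le /=; have := floorD1_gt (z / (eps / 4)); rewrite intrD.
  have := bnd (f x); have := bnd (g x); rewrite Ex => /andP[b1 b2] /andP[a1 a2].
  by rewrite ltr_norml; apply/andP; split; lra.
have := ler_distD (f x) (f y) (g y); have := ler_distD (g x) (f x) (g y).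
rewrite [`|g x - g y|]distrC; lra.
Qed.

(** Finite tuples of codes form a countable set, and one point is chosen for each tuple that is
    realized, with [t0] as default. The chosen points lie in [T] itself, so the argument applies to
    any subspace of metrics. *)
Lemma uniform_separable (T : topologicalType) (K : nat -> set V) (D : nat -> T -> V -> R)
    (sep : separates K D) (t0 : T) :
  (forall n, compact (K n)) -> (forall n t, unif_cont (K n) (D n t)) ->
  continuous (id : uspace sep -> T) ->
  exists a : nat -> T, forall (t : T) A, nbhs t A -> exists n, A (a n).
Proof.
move=> cK uD idc.
have m0 (m : nat) : 0 < m.+1%:R^-1 :> R by rewrite invr_gt0.
have H (mn : nat * nat) := exists_code (cK mn.2) (m0 mn.1).
have /choice[code codeP] := H.
pose full m N t := [seq code (m, n) (D n t) | n <- iota 0 N].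
have E m N t t' : full m N t = full m N t' -> forall n x, (n < N)%N -> K n x ->
    `|D n t x - D n t' x| <= m.+1%:R^-1.
  move=> e n x nN Kx; apply: (codeP (m, n)) => //.
  have := congr1 (fun l => nth (0%N, [::]) l n) e.
  by rewrite !(nth_map 0%N) ?size_iota // !nth_iota.
pose I := (nat * nat * seq (nat * seq int))%type.
have /choice[b bP] : forall i : I, exists t, forall t', full i.1.1 i.1.2 t' = i.2 ->
    full i.1.1 i.1.2 t = i.2.
  move=> i; have [[t ti]|n] := pselect (exists t, full i.1.1 i.1.2 t = i.2).
    by exists t.
  by exists t0 => t' ti; exfalso; apply: n; exists t'.
exists (fun n => oapp b t0 (unpickle n)) => t A tA.
have /uspace_basis[N [eps [eps0 HA]]] : nbhs (t : uspace sep) A := idc t A tA.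
pose m := Num.truncn eps^-1; exists (pickle (m, N, full m N t)).
rewrite pickleK /=; apply: HA => n x nN Kx.
have e := bP (m, N, full m N t) t erefl.
apply: (le_trans (E m N _ _ (esym e) n x nN Kx)).
by rewrite -[leRHS]invrK lef_pV2 ?posrE ?invr_gt0 // ltW // truncnS_gt.
Qed.

End Codes.

Lemma continuous_val (T : topologicalType) (A : set T) :
  continuous (fun z : set_type A => val z).
Proof. exact: initial_continuous. Qed.

Lemma continuous_to_set_type (Y T : topologicalType) (A : set T) (f : Y -> set_type A) :
  continuous (fun y => val (f y)) -> continuous f.
Proof. exact: continuous_comp_initial. Qed.

Lemma unif_cont_smooth (R : realType) (A K : set 'rV[R]_3) f : ropen true A ->
  compact K -> K `<=` A -> smooth_on A f -> unif_cont K f.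
Proof.
move=> oA cK KA sf eps eps0; have eps20 : 0 < eps / 2 by rewrite divr_gt0.
have H : \forall d \near (0 : R)^'+, K `<=` [set x | forall y, K y ->
    `|x - y| < d -> `|f x - f y| < eps].
  have /compact_near_coveringP/near_covering_withinP := cK.
  move=> /(_ R (0^'+) (fun d x => forall y, K y -> `|x - y| < d -> `|f x - f y| < eps)).
  apply=> x Kx.
  have /famP/(_ [::] true x (KA _ Kx))[/jcontP/(_ _ eps20)[U Uy [d d0 dP]] _] :=
    @smooth_on_fam _ bool _ _ oA sf.
  have d20 : 0 < d / 2 by rewrite divr_gt0.
  exists ([set x' | `|x' - x| < d / 2], [set r : R | r < d / 2]).
    split=> /=; first by apply/nbhs_distP; exists (d / 2).
    exact: nbhs_right_lt.
  move=> [x' r] /= [xx' rd] Kx' y Ky yx'.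
  have yx : `|y - x| < d.
    by have := ler_distD x' y x; rewrite [`|y - x'|]distrC; lra.
  have h1 := dP true x' (nbhs_singleton Uy) (oA.1 _ (KA _ Kx')) (lt_trans xx' _).
  have {}h1 : `|f x' - f x| < eps / 2 by apply: h1; lra.
  have h2 := dP true y (nbhs_singleton Uy) (oA.1 _ (KA _ Ky)) yx; rewrite /= in h2.
  by have := ler_distD (f x) (f x') (f y); rewrite [`|f x - f y|]distrC; lra.
have r0 : \forall r \near 0^'+, (0 : R) < r by exact: nbhs_right_gt.
have [d [d0 dP]] := filter_ex (filterI r0 H).
by exists d => // x y Kx Ky xy; exact: (dP x Kx).
Qed.

(** * The jets on a finite family of compact sets determine metrics and their topology *)

Section JetMetric.
Variables (R : realType) (X : manifold3 R).
Notation V := 'rV[R]_3.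
Variables (s : seq X) (K : X -> set V) (chi : X -> X -> R).
Hypothesis pu : partition_unity s K chi.

Lemma pu_pos q : exists2 p, p \in s & 0 < chi p q.
Proof.
apply: contrapT => H; have := pu_sum pu q; rewrite big_seq big1 => [/eqP|p ps].
  by rewrite eq_sym oner_eq0.
apply/eqP; rewrite eq_le (pu_ge0 pu) andbT leNgt; apply/negP => p0.
by apply: H; exists p.
Qed.

Lemma pu_overlap p (c : atlas X) x : cimg (val c) x -> chi p (cinv (val c) x) != 0 ->
  overlap (val c) (val (chart_at p)) x /\ K p (transition (val c) (val (chart_at p)) x).
Proof. by move=> cx /(pu_supp pu)[dp Kp]; split=> //; apply/overlapP. Qed.

Lemma riemannian_ext (g g' : riemannian X) : (forall c x, g c x = g' c x) -> g = g'.
Proof.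
case: g g' => [g ? ? ? ? ?] [g' ? ? ? ? ?] /= E.
have {}E : g = g' by apply/funext => c; apply/funext => x; exact: E.
by subst g'; congr Riemannian; exact: Prop_irrelevance.
Qed.

Lemma pu_riemannian_ext (g g' : riemannian X) :
  (forall p x, p \in s -> K p x -> g (chart_at p) x = g' (chart_at p) x) -> g = g'.
Proof.
move=> H; apply: riemannian_ext => c x.
have [cx|ncx] := pselect (cimg (val c) x); last by rewrite !metric_out.
have [p ps /lt0r_neq0 p0] := pu_pos (cinv (val c) x).
by have [ox Kx] := pu_overlap cx p0; rewrite !(metric_overlap _ ox) H.
Qed.

(* Continuity of a family of metrics need only be tested in the finitely many
   charts of the partition, on the compact sets [K p]. *)
Lemma pu_riem_continuous (Y : topologicalType) (f : Y -> riemannian X) :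
  (forall p (l : seq 'I_3) i j y eps, p \in s -> 0 < eps -> \forall y' \near y, forall x, K p x ->
    `|iter_pderiv l (fun z => f y (chart_at p) z i j) x -
      iter_pderiv l (fun z => f y' (chart_at p) z i j) x| < eps) ->
  continuous f.
Proof.
move=> H; apply/riem_continuousP => c i j.
(* Families live on relatively open sets, so [K p] is replaced by the locus where [chi p] is
   positive; it is contained in [K p], and these loci cover because the sum of the [chi p] is 1. *)
pose A p := [set x | cimg (val (chart_at p)) x /\ 0 < chi p (cinv (val (chart_at p)) x)].
have near_chi p (c' : atlas X) x : cimg (val c') x -> 0 < chi p (cinv (val c') x) ->
    \forall x' \near x, hs true x' -> cimg (val c') x' /\ 0 < chi p (cinv (val c') x').
  move=> cx px; have oc := cimg_ropen (val c').
  have /famP/(_ [::] true x cx)[/jcont_slice/= J _] :=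
    @smooth_on_fam _ bool _ _ oc (@pu_smooth _ _ _ _ _ pu p c').
  have N : nbhs (chi p (cinv (val c') x)) [set r : R | 0 < r].
    by apply: open_nbhs_nbhs; split => //; exact: open_gt.
  have := J _ N; have := oc.2 _ cx.
  rewrite /within /=; apply: filterS2 => x' h1 h2 hx'; split; [exact: h1|exact: h2].
have AK p x : A p x -> K p x.
  move=> [cx px]; have [_] := pu_supp pu (lt0r_neq0 px).
  by rewrite cinvK.
have oA p : ropen true (A p).
  split=> x [cx px]; first exact: (cimg_ropen (val (chart_at p))).1.
  exact: near_chi.
have sA p i' j' : p \in s -> sfam (A p) (fun y x => f y (chart_at p) x i' j').
  move=> ps; have sm y : smooth_on (A p) (fun x => f y (chart_at p) x i' j').
    by apply: smooth_on_sub (@metric_smooth _ _ (f y) (chart_at p) i' j') => x [].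
  split=> //; apply/famP => l y x Ax.
  have /famP/(_ l true x Ax)[Jx Dx] := @smooth_on_fam _ bool _ _ (oA p) (sm y).
  split; last exact: Dx.
  apply/jcontP => eps eps0; have eps20 : 0 < eps / 2 by rewrite divr_gt0.
  have [U0 U0y [d d0 dP]] := (jcontP _ _ _ _).1 Jx _ eps20.
  have /nbhs_distP[r r0 rP] := (oA p).2 _ Ax.
  exists [set y' | forall x, K p x ->
    `|iter_pderiv l (fun z => f y (chart_at p) z i' j') x -
      iter_pderiv l (fun z => f y' (chart_at p) z i' j') x| < eps / 2]; first exact: H.
  exists (Num.min d r); first by rewrite lt_min d0.
  move=> y' x' Uy' hx'; rewrite lt_min => /andP[dx rx].
  have := Uy' x' (AK _ _ (rP _ rx hx')); rewrite !iter_pderivE distrC => H1.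
  have := dP true x' (nbhs_singleton U0y) hx' dx => H2.
  rewrite [eps]splitr; apply: le_lt_trans (ltrD H1 H2); exact: ler_distD.
apply: sfam_local => x cx; have [p ps p0] := pu_pos (cinv (val c) x).
pose d := chart_at p.
pose B := [set x' | hs true x' -> cimg (val c) x' /\ 0 < chi p (cinv (val c) x')].
exists B; split; first exact: near_chi.
have oc := cimg_ropen (val c).
have oB : ropen true (cimg (val c) `&` B).
  split=> z [cz Bz]; first exact: oc.1.
  have [_ pz] := Bz (oc.1 _ cz).
  have := near_chi _ _ _ cz pz; rewrite /within /=; apply: filterS => z' h hz'.
  by split; [exact: (h hz').1|exact: h].
have BO z : (cimg (val c) `&` B) z -> overlap (val c) (val d) z.
  by move=> [cz /(_ (oc.1 _ cz))[_ pz]]; exact: (pu_overlap cz (lt0r_neq0 pz)).1.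
have sJ k l : sfam (cimg (val c) `&` B)
    (fun (_ : Y) z => Defs.jacobian (transition (val c) (val d)) z k l).
  apply: (sfam_single _ oB); apply: smooth_on_sub BO _.
  by apply: msmooth_jac; [exact: overlap_ropen|exact: transition_smooth].
have sg k l : sfam (cimg (val c) `&` B)
    (fun y z => f y d (transition (val c) (val d) z) k l).
  apply: (sfam_comp oB (oA p)) (sA p k l ps).
    move=> z zB; have [cz /(_ (oc.1 _ cz))[_ pz]] := zB; split.
      by have /transition_overlap/overlap_cimg := BO z zB.
    by rewrite /transition cmapK //; have /overlapP[] := BO z zB.
  by move=> k'; apply: smooth_on_sub BO _; exact: transition_smooth.
apply: (sfam_ext oB (F := fun y z => (Defs.jacobian (transition (val c) (val d)) z *m
    f y d (transition (val c) (val d) z) *m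
    (Defs.jacobian (transition (val c) (val d)) z)^T) i j)).
  by move=> y z /BO/(metric_overlap (f y)) ->.
apply: (sfam_mulmx oB) => k l; first exact: (sfam_mulmx oB).
by apply: sfam_ext (sJ l k) => // y z _; rewrite [RHS]mxE.
Qed.

Variable Z : set (riemannian X).

(** Restricting the points to [seq_sub s] makes the index type countable, so that [pickle] numbers
    the seminorms. *)
Definition jet_index : Type := seq_sub s * seq 'I_3 * 'I_3 * 'I_3.

Definition jet_set (n : nat) : set V :=
  if (unpickle n : option jet_index) is Some k then K (val k.1.1.1) else set0.

Definition jet_fun (n : nat) (t : set_type Z) : V -> R :=
  if (unpickle n : option jet_index) is Some (p, l, i, j)
  then iter_pderiv l (fun z => val t (chart_at (val p)) z i j) else cst 0.

Lemma jet_separates : separates jet_set jet_fun.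
Proof.
move=> t t' H; apply/val_inj/pu_riemannian_ext => p x ps Kx; apply/matrixP => i j.
pose k : jet_index := (SeqSub ps, [::], i, j).
by have := H (pickle k) x; rewrite /jet_set /jet_fun pickleK; exact.
Qed.

Lemma jet_near n (t : set_type Z) eps : 0 < eps ->
  \forall t' \near t, forall x, jet_set n x -> `|jet_fun n t x - jet_fun n t' x| <= eps.
Proof.
move=> eps0; rewrite /jet_set /jet_fun; case: unpickle => [[[[p l] i] j]|]; last first.
  by near=> t'.
have /riem_cvgP H : (fun t' : set_type Z => val t') @ nbhs t --> val t.
  exact: continuous_val.
have := H (chart_at (val p)) l (K (val p)) (pu_compact pu (p := _)) (@pu_cimg _ _ _ _ _ pu _) _ eps0.
by apply: filterS => t' Ht' x Kx; rewrite distrC; apply: ltW; exact: Ht'.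
Unshelve. all: by end_near. Qed.

Lemma jet_continuous : continuous (id : uspace jet_separates -> set_type Z).
Proof.
apply: continuous_to_set_type; apply: pu_riem_continuous => p l i j t eps ps eps0.
pose k : jet_index := (SeqSub ps, l, i, j).
have := uspace_near t (pickle k) eps0; rewrite /jet_set /jet_fun pickleK /=.
by apply: (@filterS _ _ (nbhs_filter t)) => t' Ht' x Kx; exact: Ht'.
Qed.

Lemma jet_compact n : compact (jet_set n).
Proof.
by rewrite /jet_set; case: unpickle => [k|]; [exact: pu_compact pu _|exact: compact0].
Qed.

Lemma jet_unif_cont n t : unif_cont (jet_set n) (jet_fun n t).
Proof.
rewrite /jet_set /jet_fun; case: unpickle => [[[[p l] i] j]|]; last first.
  by move=> eps eps0; exists 1.
apply: (unif_cont_smooth (cimg_ropen (val (chart_at (val p))))).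
- exact: pu_compact pu _.
- exact: pu_cimg pu _.
- rewrite iter_pderivE; elim: l => [|k l IH] /=; first exact: metric_smooth.
  by apply: smooth_on_pd => //; exact: cimg_ropen.
Qed.

Lemma metrizable_metrics : metrizable R (set_type Z).
Proof. exact: (uniform_metrizable jet_near jet_continuous). Qed.

Lemma separable_metrics (t0 : set_type Z) :
  exists a : nat -> set_type Z, forall (t : set_type Z) A, nbhs t A -> exists n, A (a n).
Proof. exact: (uniform_separable t0 jet_compact jet_unif_cont jet_continuous). Qed.

End JetMetric.

(** * Dugundji extension *)

(** A plain distance function on [Y], so that estimates need not be transported to the metric space
    homeomorphic to [Y]. *)
Record metrizes (R : realType) (Y : topologicalType) (dist : Y -> Y -> R) : Prop := {
  dist_xx : forall y, dist y y = 0;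
  dist_sym : forall x y, dist x y = dist y x;
  dist_triangle : forall y x z, dist x z <= dist x y + dist y z;
  dist_nbhs : forall y A, nbhs y A <->
    exists2 eps, 0 < eps & forall y', dist y y' < eps -> A y'
}.

Lemma metrizable_dist (R : realType) (Y : topologicalType) : metrizable R Y ->
  exists dist : Y -> Y -> R, metrizes dist.
Proof.
move=> [M [f [h [fK hK fc hc]]]]; exists (fun y y' => mdist (f y) (f y')); split.
- by move=> y; exact: mdistxx.
- by move=> x y; exact: metric_sym.
- by move=> y x z; exact: metric_triangle.
- move=> y A; split.
    move=> yA; have : nbhs (f y) (h @^-1` A) by apply: hc; rewrite fK.
    rewrite -nbhs_ballE => -[eps eps0 H]; exists eps => // y' yy'.
    by rewrite -(fK y'); apply: H; rewrite ballEmdist.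
  move=> [eps eps0 H]; have B : nbhs (f y) (ball (f y) eps) by exact: nbhsx_ballx.
  have N : nbhs y (f @^-1` ball (f y) eps) := fc y _ B.
  by apply: filterS N => y' /=; rewrite ballEmdist; exact: H.
Qed.

Lemma jcont_near (R : realType) (Y : topologicalType) b (F G : Y -> 'rV[R]_3 -> R) y x :
  (\forall y' \near y, forall x', F y' x' = G y' x') -> jcont b F y x -> jcont b G y x.
Proof.
move=> FG; rewrite /jcont.
have -> : F y x = G y x by have := nbhs_singleton FG; apply.
apply: cvg_trans; apply: near_eq_cvg.
exists ([set y' | forall x', F y' x' = G y' x'], setT) => /=.
  by split => //; exact: filterT.
by move=> [y' x'] /= [-> ].
Qed.

Definition convex_cone (R : realType) (S : set R) :=
  (forall r r', S r -> S r' -> S (r + r')) /\ (forall t r, 0 < t -> S r -> S (t * r)).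

(** The cone of positive numbers omits 0, so the case where all weights vanish is a separate
    outcome. Values matter only where the weight is nonzero, as suits functions known only inside a
    chart. *)
Lemma cone_sum (R : realType) (S : set R) (I : Type) (s : seq I) (w v : I -> R) :
  convex_cone S -> (forall i, 0 <= w i) -> (forall i, w i != 0 -> S (v i)) ->
  \sum_(i <- s) w i = 0 \/ S (\sum_(i <- s) w i * v i).
Proof.
move=> [SD SM] w0 Sv; elim: s => [|i s IH]; first by left; rewrite big_nil.
rewrite !big_cons; have [wi|wi] := eqVneq (w i) 0; first by rewrite wi mul0r !add0r.
right; have wi0 : 0 < w i by rewrite lt_def wi w0.
have Si := SM _ _ wi0 (Sv i wi).
case: IH => [e|]; last exact: SD.
suff -> : \sum_(j <- s) w j * v j = 0 by rewrite addr0.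
elim: s e => [|j s IH]; first by rewrite !big_nil.
have s0 : 0 <= \sum_(i <- s) w i by rewrite sumr_ge0.
rewrite !big_cons => /eqP; rewrite paddr_eq0 // => /andP[/eqP -> /eqP /IH ->].
by rewrite mul0r addr0.
Qed.

(** * Locally finite weights subordinate to a sequence *)

Section Weights.
Variables (R : realType) (Y : topologicalType) (dist : Y -> Y -> R).
Hypothesis md : metrizes dist.
Variable a : nat -> Y.

Let dist_ge0 x y : 0 <= dist x y.
Proof.
by have := dist_triangle md y x x; rewrite (dist_xx md) (dist_sym md y x); lra.
Qed.

Definition gap (y : Y) : R := inf (range (fun n => dist y (a n))).

Let gap_inf y : has_inf (range (fun n => dist y (a n))).
Proof. by split; [exists (dist y (a 0%N)), 0%N|exists 0 => _ [n _ <-]]. Qed.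

Lemma gap_le y n : gap y <= dist y (a n).
Proof. by apply: ge_inf; [have [] := gap_inf y|exists n]. Qed.

Lemma gap_ge0 y : 0 <= gap y.
Proof. by apply: lb_le_inf; [have [] := gap_inf y|move=> _ [n _ <-]]. Qed.

Lemma gap_adherent y eps : 0 < eps -> exists n, dist y (a n) < gap y + eps.
Proof. by move=> /inf_adherent-/(_ _ (gap_inf y))[_ [n _ <-]]; exists n. Qed.

Lemma gap_lipschitz y y' : gap y <= gap y' + dist y y'.
Proof.
apply/ler_addgt0Pl => eps eps0; have [n hn] := gap_adherent y' eps0.
by have := gap_le y n; have := dist_triangle md y' y (a n); lra.
Qed.

Lemma lipschitz_continuous (f : Y -> R) :
  (forall y y', f y <= f y' + dist y y') -> continuous f.
Proof.
move=> fl y; apply/cvgrPdist_lt => eps eps0.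
apply/(dist_nbhs md); exists eps => // y' yy'.
have := fl y y'; have := fl y' y; rewrite (dist_sym md y' y) => h1 h2.
by rewrite ltr_norml; apply/andP; split; lra.
Qed.

Lemma gap_continuous : continuous gap.
Proof. exact/lipschitz_continuous/gap_lipschitz. Qed.

Lemma dist_continuous n : continuous (fun y => dist y (a n)).
Proof.
by apply: lipschitz_continuous => y y'; rewrite addrC; exact: dist_triangle.
Qed.

(* Off the closure of the sequence [a], some [tent k] is positive near a given
   point; the factor [n] in [lam] then makes almost all [lam n] vanish there. *)
Definition tent n y := Num.max 0 (2 * gap y - dist y (a n)).

Definition lam n y := Num.max 0 (tent n y - n%:R * \sum_(k < n) tent k y).

Lemma tent_ge0 n y : 0 <= tent n y. Proof. by rewrite le_max lexx. Qed.

Lemma lam_ge0 n y : 0 <= lam n y. Proof. by rewrite le_max lexx. Qed.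

Lemma tent_continuous n : continuous (tent n).
Proof.
move=> y; apply: (@continuous_max _ _ (fun=> 0 : R) (fun y => 2 * gap y - dist y (a n))).
  exact: cvg_cst.
apply: cvgB; last exact: dist_continuous.
by apply: cvgM; [exact: cvg_cst|exact: gap_continuous].
Qed.

Lemma lam_continuous n : continuous (lam n).
Proof.
move=> y; apply: (@continuous_max _ _ (fun=> 0 : R) (fun y => tent n y - n%:R * \sum_(k < n) tent k y)).
  exact: cvg_cst.
apply: cvgB; first exact: tent_continuous.
apply: cvgM; first exact: cvg_cst.
elim: n => [|n IH].
  by under eq_fun do rewrite big_ord0; rewrite big_ord0; exact: cvg_cst.
under eq_fun do rewrite big_ord_recr /=; rewrite big_ord_recr /=.
by apply: cvgD => //; exact: tent_continuous.
Qed.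

Lemma lam_gt0 n y : 0 < lam n y -> dist y (a n) < 2 * gap y.
Proof.
rewrite lt_max ltxx /= => H.
have S0 : 0 <= n%:R * \sum_(k < n) tent k y.
  by rewrite mulr_ge0 // sumr_ge0 // => k _; exact: tent_ge0.
have : 0 < tent n y by lra.
by rewrite lt_max ltxx /=; lra.
Qed.

Lemma tent_pos y : 0 < gap y -> exists n, 0 < tent n y.
Proof.
move=> g0; have [n hn] := gap_adherent y g0; exists n.
by rewrite lt_max; apply/orP; right; lra.
Qed.

Lemma lam_pos y : 0 < gap y -> exists n, 0 < lam n y.
Proof.
(* At the first positive tent the subtracted sum is 0, so [lam n] equals [tent n]. *)
move=> g0; have [n n0 nmin] := ex_minnP (tent_pos g0).
exists n; rewrite lt_max big1 ?mulr0 ?subr0 ?n0 ?orbT // => k _.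
apply/eqP; rewrite eq_le tent_ge0 andbT leNgt; apply/negP => /nmin.
by rewrite leqNgt ltn_ord.
Qed.

Lemma lam_locally_finite y : 0 < gap y ->
  exists N, \forall y' \near y, forall m, (N <= m)%N -> lam m y' = 0.
Proof.
move=> g0; have [n n0] := tent_pos g0.
(* Near [y] one has [tent m] <= 4 [gap y] and [tent n] > half its value at [y]; beyond 8 [gap y] /
   [tent n y] the subtracted term wins. The bound [n.+1] puts [tent n] into the sum. *)
pose N := maxn n.+1 (Num.truncn (8 * gap y / tent n y)).+1; exists N.
have t2 : tent n y / 2 < tent n y by lra.
have g2 : gap y < 2 * gap y by lra.
have h1 : \forall y' \near y, tent n y / 2 < tent n y' := @tent_continuous n y _ (lt_nbhsr t2).
have h2 : \forall y' \near y, gap y' < 2 * gap y := gap_continuous (lt_nbhsl g2).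
apply: filterS2 h1 h2 => y' h1 h2 m; rewrite geq_max => /andP[nm Nm].
apply/eqP; rewrite eq_le lam_ge0 andbT ge_max lexx /= subr_le0.
have u1 : tent m y' <= 2 * gap y' by rewrite ge_max; have := dist_ge0 y' (a m); have := gap_ge0 y'; lra.
have u2 : tent n y' <= \sum_(k < m) tent k y'.
  rewrite (bigD1 (Ordinal nm)) //= lerDl sumr_ge0 // => k _; exact: tent_ge0.
have m1 : 8 * gap y / tent n y < m%:R.
  by apply: lt_le_trans (truncnS_gt _) _; rewrite ler_nat.
rewrite ltr_pdivrMr // in m1.
have m0 : 0 <= m%:R :> R by [].
have : m%:R * (tent n y / 2) <= m%:R * \sum_(k < m) tent k y'.
  by apply: ler_wpM2l => //; lra.
lra.
Qed.

Definition vanishes_from N y := forall m, (N <= m)%N -> lam m y = 0.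

Lemma exists_vanish y : exists N, 0 < gap y -> vanishes_from N y.
Proof.
have [/lam_locally_finite[N /nbhs_singleton H]|n] := pselect (0 < gap y).
  by exists N.
by exists 0%N.
Qed.

(** Chosen point by point, with no continuity; [sum_vanish] shows that any other valid bound gives
    the same sums, in particular one valid on a neighborhood. *)
Definition cutoff y := sval (cid (exists_vanish y)).

Lemma cutoffP y : 0 < gap y -> vanishes_from (cutoff y) y.
Proof. by rewrite /cutoff; case: cid. Qed.

Lemma sum_vanish (W : zmodType) (v : nat -> W) N N' y :
  (forall n, lam n y = 0 -> v n = 0) -> vanishes_from N y -> vanishes_from N' y ->
  \sum_(n < N) v n = \sum_(n < N') v n.
Proof.
move=> v0; wlog NN' : N N' / (N <= N')%N.
  by move=> H hN hN'; case: (leqP N N') => [|/ltnW] NN; [exact: H|rewrite (H _ _ NN)].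
move=> hN _; rewrite -!(big_mkord xpredT v) (big_cat_nat (leq0n N) NN') /=.
by rewrite [X in _ = _ + X]big_nat [X in _ = _ + X]big1 ?addr0 // => n /andP[Nn _]; rewrite v0 // hN.
Qed.

Definition weight n y := lam n y / \sum_(k < cutoff y) lam k y.

Lemma lam_sum_gt0 N y : 0 < gap y -> vanishes_from N y -> 0 < \sum_(k < N) lam k y.
Proof.
move=> g0 hN; have [n n0] := lam_pos g0.
have nN : (n < N)%N by rewrite ltnNge; apply/negP => /hN; apply/eqP; rewrite gt_eqF.
by rewrite (bigD1 (Ordinal nN)) //= ltr_pwDl // sumr_ge0 // => k _; exact: lam_ge0.
Qed.

Lemma weightE N n y : 0 < gap y -> vanishes_from N y ->
  weight n y = lam n y / \sum_(k < N) lam k y.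
Proof.
by move=> g0 hN; rewrite /weight (sum_vanish (v := fun k => lam k y) _ (cutoffP g0) hN).
Qed.

Lemma weight_ge0 n y : 0 <= weight n y.
Proof.
by rewrite divr_ge0 ?lam_ge0 // sumr_ge0 // => k _; exact: lam_ge0.
Qed.

Lemma weight_sum N y : 0 < gap y -> vanishes_from N y -> \sum_(n < N) weight n y = 1.
Proof.
move=> g0 hN; under eq_bigr do rewrite (weightE _ g0 hN).
by rewrite -mulr_suml divff // gt_eqF // lam_sum_gt0.
Qed.

Lemma weight_gt0 n y : weight n y != 0 -> dist y (a n) < 2 * gap y.
Proof.
rewrite mulf_eq0 negb_or => /andP[l0 _]; apply: lam_gt0.
by rewrite lt_def l0 lam_ge0.
Qed.

Section Average.
Variable W : lmodType R.
Implicit Type v : nat -> W.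

Definition average v y := \sum_(n < cutoff y) weight n y *: v n.

Lemma averageE v N y : 0 < gap y -> vanishes_from N y ->
  average v y = \sum_(n < N) weight n y *: v n.
Proof.
move=> g0 hN; apply: (sum_vanish (v := fun n => weight n y *: v n) _ (cutoffP g0) hN).
by move=> n ln; rewrite /weight ln mul0r scale0r.
Qed.

End Average.

Lemma average_close (v : nat -> R^o) y l eps : 0 < gap y ->
  (forall n, weight n y != 0 -> `|v n - l| <= eps) -> `|average v y - l| <= eps.
Proof.
move=> g0 H; have s1 := weight_sum g0 (cutoffP g0).
have -> : average v y - l = \sum_(n < cutoff y) weight n y * (v n - l).
  under [RHS]eq_bigr do rewrite mulrBr.
  by rewrite sumrB -mulr_suml s1 mul1r.
apply: le_trans (ler_norm_sum _ _ _) _.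
rewrite -[leRHS]mul1r -s1 mulr_suml; apply: ler_sum => n _.
rewrite normrM ger0_norm ?weight_ge0 //.
have [->|w0] := eqVneq (weight n y) 0; first by rewrite !mul0r.
by apply: ler_wpM2l; [exact: weight_ge0|exact: H].
Qed.

Lemma average_cone (S : set R) (v : nat -> R^o) y : convex_cone S -> 0 < gap y ->
  (forall n, S (v n)) -> S (average v y).
Proof.
move=> cS g0 Sv; have s1 := weight_sum g0 (cutoffP g0).
have [e|//] := @cone_sum R S 'I_(cutoff y) (index_enum _) (fun n => weight n y) v cS
  (fun n => weight_ge0 n y) (fun n _ => Sv n).
by have := oner_neq0 R; rewrite -s1 e eqxx.
Qed.

End Weights.

(** * Continuity and smoothness of the Dugundji extension *)

Section Extension.
Variables (R : realType) (Y Z : topologicalType) (dist : Y -> Y -> R) (e : Z -> Y).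
Hypothesis md : metrizes dist.
Hypothesis ce : closed_embedding e.
Variable z : nat -> Z.
Hypothesis dense_z : forall (t : Z) A, nbhs t A -> exists n, A (z n).
Notation V := 'rV[R]_3.

Let a n := e (z n).
Notation gap := (gap dist a).
Notation weight := (weight md a).
Notation average := (average md a).

Lemma gap_embed t : gap (e t) = 0.
Proof.
apply/eqP; rewrite eq_le gap_ge0 // andbT leNgt; apply/negP => g0.
have N : nbhs (e t) [set y | dist (e t) y < gap (e t)].
  by apply/(dist_nbhs md); exists (gap (e t)).
have [_ /(_ t _ N)] := ce; move=> /dense_z[n /=].
by rewrite ltNge gap_le.
Qed.

Lemma gap_gt0 y : ~ range e y -> 0 < gap y.
Proof.
move=> ny; rewrite lt_def gap_ge0 // andbT; apply/negP => /eqP g0.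
have [_ _ _ cr] := ce; apply: ny.
apply: cr => A /(dist_nbhs md)[eps eps0 HA].
have [n] := gap_adherent md a y eps0; rewrite g0 add0r => /HA An.
by exists (a n); split=> //; exists (z n).
Qed.

Lemma gap_le_dist t y : gap y <= dist (e t) y.
Proof.
by have := gap_lipschitz md a y (e t); rewrite gap_embed add0r (dist_sym md).
Qed.

Lemma embed_near t A : nbhs t A ->
  exists2 r, 0 < r & forall t', dist (e t) (e t') < r -> A t'.
Proof.
rewrite nbhsE => -[B [oB Bt] BA]; have [_ _ emb _] := ce.
have [C oC CB] := emb B oB; have : nbhs (e t) C.
  by apply: open_nbhs_nbhs; split=> //; change ((e @^-1` C) t); rewrite CB.
move=> /(dist_nbhs md)[r r0 H]; exists r => // t' /H Ct'.
by apply: BA; rewrite -CB.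
Qed.

(* Dugundji's extension: the given values on the closed subset, and convex
   combinations of the values at nearby points of the dense sequence off it. *)
Definition dugundji (W : lmodType R) (phi : Z -> W) (y : Y) : W :=
  if pselect (exists t, e t = y) is left ex then phi (sval (cid ex))
  else average (fun n => phi (z n)) y.

Lemma dugundji_embed (W : lmodType R) (phi : Z -> W) t : dugundji phi (e t) = phi t.
Proof.
rewrite /dugundji; case: pselect => [ex|[]]; last by exists t.
case: (cid ex) => t' /= E; have [inj _ _ _] := ce; by rewrite (inj _ _ E).
Qed.

Lemma dugundji_off (W : lmodType R) (phi : Z -> W) y : ~ range e y ->
  dugundji phi y = average (fun n => phi (z n)) y.
Proof.
move=> ny; rewrite /dugundji; case: pselect => // -[t E].
by exfalso; apply: ny; exists t.
Qed.

(** Symmetry, the transformation law and vanishing outside the chart are linear conditions on the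
    components, so they pass to the extension. Positivity on a fixed vector is a cone condition on a
    linear function, and follows with [dugundji_cone]. *)
Lemma dugundji_linear (W W' : lmodType R) (L : W -> W') (phi : Z -> W) y :
  linear L -> L (dugundji phi y) = dugundji (fun t => L (phi t)) y.
Proof.
move=> Ll; have LD u v : L (u + v) = L u + L v.
  by have := Ll 1 u v; rewrite !scale1r.
have L0 : L 0 = 0 by apply: (addrI (L 0)); rewrite -LD !addr0.
have LZ k u : L (k *: u) = k *: L u by have := Ll k u 0; rewrite L0 !addr0.
rewrite /dugundji; case: pselect => // _; rewrite (big_morph L LD L0).
by apply: eq_bigr => n _.
Qed.

Lemma dugundji_cone (S : set R) (phi : Z -> R^o) y : convex_cone S ->
  (forall t, S (phi t)) -> S (dugundji phi y).
Proof.
move=> cS H; have [[t _ <-]|ny] := pselect (range e y); first by rewrite dugundji_embed.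
by rewrite dugundji_off //; apply: average_cone => //; exact: gap_gt0.
Qed.

Notation dug psi := (fun y (x : V) => dugundji (fun t => psi t x : R^o) y).

Lemma dugundji_local (psi : Z -> V -> R) y : ~ range e y ->
  exists N, \forall y' \near y, forall x, dug psi y' x = \sum_(n < N) weight n y' * psi (z n) x.
Proof.
move=> ny; have [N HN] := lam_locally_finite md (gap_gt0 ny); exists N.
have oC : \forall y' \near y, ~ range e y'.
  by apply: open_nbhs_nbhs; split => //; apply: closed_openC; have [] := ce.
apply: filterS2 HN oC => y' HN ny' x; rewrite dugundji_off //.
by rewrite (@averageE _ _ dist md _ _ _ N) //; exact: gap_gt0.
Qed.

(** Since [cutoff] may jump, the normalizing sum is first rewritten with a bound valid near [y]. *)
Lemma weight_continuous n y : ~ range e y -> {for y, continuous (weight n)}.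
Proof.
move=> ny; have [N HN] := lam_locally_finite md (gap_gt0 ny).
have oC : \forall y' \near y, ~ range e y'.
  by apply: open_nbhs_nbhs; split => //; apply: closed_openC; have [] := ce.
have g0 := gap_gt0 ny; have vN := nbhs_singleton HN.
rewrite /continuous_at /prop_for (weightE md n g0 vN).
have H : (fun y' => lam dist a n y' / \sum_(k < N) lam dist a k y') @ y -->
   lam dist a n y / \sum_(k < N) lam dist a k y.
  apply: cvgM; first exact: lam_continuous.
  apply: cvgV; first by rewrite gt_eqF // (lam_sum_gt0 md).
  move: (N); elim=> [|m IH].
    by under eq_fun do rewrite big_ord0; rewrite big_ord0; exact: cvg_cst.
  under eq_fun do rewrite big_ord_recr /=; rewrite big_ord_recr /=.
  by apply: cvgD => //; exact: lam_continuous.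
apply: cvg_trans H; apply: near_eq_cvg; apply: filterS2 HN oC => y' vN' ny'.
by rewrite (weightE md n (gap_gt0 ny') vN').
Qed.

(** On the image of [e], averages are close to the given value because only nearby sample points
    have nonzero weight; off it, the extension is locally a fixed finite combination with continuous
    coefficients. *)
Lemma dugundji_jcont (psi : Z -> V -> R) y x : hs true x ->
  (forall t, jcont true psi t x) -> jcont true (dug psi) y x.
Proof.
move=> hx H; have [[t _ <-]|ny] := pselect (range e y).
  apply/jcontP => eps eps0; have eps20 : 0 < eps / 2 by rewrite divr_gt0.
  have /jcontP/(_ _ eps20)[U Ut [d d0 dP]] := H t.
  have [r r0 rP] := embed_near Ut.
  (* A sample point of nonzero weight is within twice the gap of [y'], hence within twice its
     distance to [e t], so its total distance to [e t] is below 3 times r/3. *)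
  exists [set y | dist (e t) y < r / 3].
    by apply/(dist_nbhs md); exists (r / 3) => //; rewrite divr_gt0.
  exists d => // y' x' /= yr hx' xd; rewrite dugundji_embed.
  apply: (@le_lt_trans _ _ (eps / 2)); last by lra.
  have [[t' _ E]|ny'] := pselect (range e y').
    rewrite -E dugundji_embed; apply/ltW/dP => //; apply: rP.
    by rewrite E (lt_trans yr) //; lra.
  rewrite dugundji_off //; apply: (@average_close R Y dist md a (fun n => psi (z n) x') y' (psi t x) (eps / 2) (gap_gt0 ny')).
  move=> n /weight_gt0 w; apply/ltW/dP => //; apply: rP.
  have := dist_triangle md y' (e t) (e (z n)); have := gap_le_dist t y'.
  by move: w; rewrite /a; lra.
have [N HN] := dugundji_local psi ny.
apply: (@jcont_near _ _ _ (fun y' x' => \sum_(n < N) weight n y' * psi (z n) x')).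
  by apply: filterS HN => y' HN x'; rewrite HN.
elim: (N) => [|m IH].
  apply: (@jcont_near _ _ _ (fun _ _ => 0)); last by apply: jcont_cst; exact: cvg_cst.
  by near=> y' => x'; rewrite big_ord0.
apply: (@jcont_near _ _ _ (fun y' x' => \sum_(n < m) weight n y' * psi (z n) x' + weight m y' * psi (z m) x')).
  by near=> y' => x'; rewrite big_ord_recr.
apply: jcontD => //; apply: jcontM; first by apply: jcont_cst; exact: weight_continuous.
apply: (@cvg_comp _ _ _ snd (psi (z m))); first exact: cvg_snd.
exact: jcont_slice (H (z m)).
Unshelve. all: by end_near. Qed.

Section DugundjiFamily.
Variables (A : set V) (oA : ropen true A) (phi : Z -> V -> R).
Hypothesis sphi : forall t, smooth_on A (phi t).

(** The weights depend on [y] only, so derivatives in [x] pass through the finite sum: continuity of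
    all derivatives reduces to [dugundji_jcont]. *)
Lemma dugundji_iter_pd s y x : A x ->
  iter_pd true s (dug phi y) x = dug (fun t => iter_pd true s (phi t)) y x.
Proof.
move=> Ax; have [[t _ <-]|ny] := pselect (range e y).
  rewrite dugundji_embed; congr (iter_pd _ _ _ _).
  by apply/funext => x'; rewrite dugundji_embed.
have -> : dug phi y = fun x => \sum_(n < cutoff md a y) weight n y * phi (z n) x.
  by apply/funext => x'; rewrite dugundji_off.
rewrite dugundji_off //; elim: s x Ax => [//|i s IH] x Ax /=.
have siter n : smooth_on A (iter_pd true s (phi n)).
  by elim: (s) => //= k l; exact: smooth_on_pd.
rewrite (pd_ext oA (g := fun x => \sum_(n < cutoff md a y) weight n y * iter_pd true s (phi (z n)) x)) //.
rewrite (pd_sum oA) // => [|n]; last by apply: smooth_onM => //; exact: smooth_on_cst.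
apply: eq_bigr => n _; rewrite (pdM oA) //; last exact: smooth_on_cst.
by rewrite (pd_cst oA) // mul0r add0r.
Qed.

Lemma dugundji_smooth y : smooth_on A (dug phi y).
Proof.
have [[t _ <-]|ny] := pselect (range e y).
  by apply: smooth_on_ext (sphi t) => x _; rewrite dugundji_embed.
apply: (@smooth_on_ext _ _ (fun x => \sum_(n < cutoff md a y) weight n y * phi (z n) x)).
  by move=> x _; rewrite dugundji_off.
by apply: (smooth_on_sum oA) => n; apply: smooth_onM => //; exact: smooth_on_cst.
Qed.

Lemma dugundji_sfam : fam true A phi -> sfam A (dug phi).
Proof.
move=> fphi; split; first exact: dugundji_smooth.
apply/famP => s y x Ax; split; last first.
  have /famP/(_ s true x Ax)[_] := @smooth_on_fam _ bool _ _ oA (dugundji_smooth y).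
  exact.
apply: (@jcont_local _ _ _ (dug (fun t => iter_pd true s (phi t)))); first exact: oA.1.
  by apply: filterS (oA.2 _ Ax) => x' Ax' y'; rewrite dugundji_iter_pd.
apply: dugundji_jcont; first exact: oA.1.
by move=> t; have /famP/(_ s t x Ax)[] := fphi.
Qed.

End DugundjiFamily.

End Extension.

(** * The retraction *)

Section Conformal.
Variables (R : realType) (X : manifold3 R).
Notation V := 'rV[R]_3.

Section Factor.
Variables (g : riemannian X) (w : X -> R).
Hypothesis w0 : forall q, 0 < w q.
Hypothesis sw : forall c : atlas X, smooth_on (cimg (val c)) (fun x => w (cinv (val c) x)).

Let comp (c : atlas X) (x : V) : 'M[R]_3 := w (cinv (val c) x) *: g c x.

Let comp_smooth c i j : smooth_on (cimg (val c)) (fun x => comp c x i j).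
Proof.
apply: (@smooth_on_ext _ _ (fun x => w (cinv (val c) x) * g c x i j)).
  by move=> x _; rewrite mxE.
by apply: smooth_onM => //; exact: metric_smooth.
Qed.

Let comp_sym c x : (comp c x)^T = comp c x.
Proof. by rewrite linearZ /= Defs.metric_sym. Qed.

Let comp_posdef c x (v : V) : cimg (val c) x -> v != 0 ->
  0 < (v *m comp c x *m v^T) ord0 ord0.
Proof.
move=> cx v0; rewrite -scalemxAr -scalemxAl mxE mulr_gt0 //; exact: metric_posdef.
Qed.

Let comp_transform c d p : cdom (val c) p -> cdom (val d) p ->
  let J := Defs.jacobian (transition (val c) (val d)) (cmap (val c) p) in
  comp c (cmap (val c) p) = J *m comp d (cmap (val d) p) *m J^T.
Proof.
move=> cp dp J; rewrite /comp !cmapK // (metric_transform g cp dp) -/J.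
by rewrite -scalemxAr -scalemxAl.
Qed.

Let comp_out c x : ~ cimg (val c) x -> comp c x = 0.
Proof. by move=> ncx; rewrite /comp metric_out // scaler0. Qed.

Definition conformal : riemannian X :=
  Riemannian comp_smooth comp_sym comp_posdef comp_transform comp_out.

End Factor.

End Conformal.

Section MetricExtension.
Variables (R : realType) (X : manifold3 R) (Y Z : topologicalType).
Variables (dist : Y -> Y -> R) (e : Z -> Y) (md : metrizes dist) (ce : closed_embedding e).
Variable z : nat -> Z.
Hypothesis dense_z : forall (t : Z) A, nbhs t A -> exists n, A (z n).
Variable f : Z -> riemannian X.
Hypothesis cf : continuous f.
Notation V := 'rV[R]_3.

Let comp y (c : atlas X) (x : V) : 'M[R]_3 := dugundji e md z (fun t => f t c x) y.

Let comp_entry y c x i j :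
  comp y c x i j = dugundji e md z (fun t => f t c x i j : R^o) y.
Proof.
apply: (@dugundji_linear R Y Z dist e md z 'M[R]_3 R^o (fun M => M i j)).
by move=> k M N; rewrite !mxE.
Qed.

Let comp_sfam c i j : sfam (cimg (val c)) (fun y x => comp y c x i j).
Proof.
have oc := cimg_ropen (val c).
apply: (sfam_ext oc (F := fun y x => dugundji e md z (fun t => f t c x i j : R^o) y)).
  by move=> y x _; rewrite comp_entry.
have [sf ff] := (riem_continuousP f).1 cf c i j.
exact: (dugundji_sfam md ce dense_z oc sf ff).
Qed.

Let comp_sym y c x : (comp y c x)^T = comp y c x.
Proof.
rewrite /comp (@dugundji_linear R Y Z dist e md z 'M[R]_3 'M[R]_3 trmx); last first.
  by move=> k M N; rewrite linearP.
by congr dugundji; apply/funext => t; exact: Defs.metric_sym.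
Qed.

Let comp_posdef y c x (v : V) : cimg (val c) x -> v != 0 ->
  0 < (v *m comp y c x *m v^T) ord0 ord0.
Proof.
move=> cx v0.
rewrite (@dugundji_linear R Y Z dist e md z 'M[R]_3 R^o (fun M => (v *m M *m v^T) ord0 ord0)).
  apply: (@dugundji_cone R Y Z dist e md ce z [set r | 0 < r]).
    by split=> [r r'|r r'] /=; [exact: addr_gt0|exact: mulr_gt0].
  by move=> t; exact: metric_posdef.
move=> k M N; rewrite mulmxDr mulmxDl -scalemxAr -scalemxAl addmxE.
by congr (_ + _); rewrite mxE.
Qed.

Let comp_transform y c d p : cdom (val c) p -> cdom (val d) p ->
  let J := Defs.jacobian (transition (val c) (val d)) (cmap (val c) p) in
  comp y c (cmap (val c) p) = J *m comp y d (cmap (val d) p) *m J^T.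
Proof.
move=> cp dp J; rewrite /comp.
rewrite (@dugundji_linear R Y Z dist e md z 'M[R]_3 'M[R]_3 (fun M => J *m M *m J^T)).
  by congr dugundji; apply/funext => t; exact: metric_transform.
by move=> k M N; rewrite mulmxDr mulmxDl -scalemxAr -scalemxAl.
Qed.

Let comp_out y c x : ~ cimg (val c) x -> comp y c x = 0.
Proof.
move=> ncx; have -> : comp y c x = dugundji e md z (fun t => 0 : 'M[R]_3) y.
  by congr dugundji; apply/funext => t; exact: metric_out.
rewrite -(@dugundji_linear R Y Z dist e md z 'M[R]_3 'M[R]_3 (fun=> 0) (fun t => f t c x) y) //.
by move=> k M N; rewrite scaler0 addr0.
Qed.

Definition dugundji_metric y : riemannian X :=
  Riemannian (fun c i j => (comp_sfam c i j).1 y) (comp_sym y) (comp_posdef y)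
    (comp_transform y) (@comp_out y).

Lemma dugundji_metric_embed t : dugundji_metric (e t) = f t.
Proof. by apply: riemannian_ext => c x; exact: (dugundji_embed md ce). Qed.

Lemma dugundji_metric_continuous : continuous dugundji_metric.
Proof. exact/riem_continuousP. Qed.

End MetricExtension.

Section MeanCurvatureCone.
Variables (R : realType) (X : manifold3 R).
Notation V := 'rV[R]_3.
Variable S : set R.
Hypothesis cS : convex_cone S.

Definition Rpos_Hin : set (riemannian X) :=
  [set g | (forall p, 0 < scalar_curvature g p) /\
           (forall p, boundary X p -> S (mean_curvature g p))].

Lemma cone_mulE t r : 0 < t -> S (t * r) <-> S r.
Proof.
move=> t0; split; last exact: cS.2.
have ti : 0 < t^-1 by rewrite invr_gt0.
by move=> /(cS.2 _ _ ti); rewrite mulKf // gt_eqF.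
Qed.

Lemma mean_bdry_q (g : riemannian X) (c : atlas X) x : cimg (val c) x ->
  S (mean_coord (g c) x) <-> S (bdry_q (g c) x).
Proof.
move=> cx; rewrite (mean_coordE (cimg_ropen (val c)) (@metric_msmooth _ _ g c)
  (Defs.metric_sym g c) (fun x => @metric_unit _ _ g c x)
  (fun x => @metric_inv00 _ _ g c x) cx).
by apply: cone_mulE; rewrite sqrtr_gt0; exact: metric_inv00.
Qed.

(** Mean curvature is tested only in the chosen charts, [bdry_q] in all of them; the two differ by
    positive factors, to which a cone is insensitive. *)
Lemma bdry_q_cone (g : riemannian X) :
  (forall p, boundary X p -> S (mean_curvature g p)) <->
  (forall (c : atlas X) x, cimg (val c) x -> x ord0 ord0 = 0 -> S (bdry_q (g c) x)).
Proof.
split=> [H c x cx x0|H p bp]; last by apply/mean_bdry_q; [|apply: H]; try exact: coord_at_cimg.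
pose p := cinv (val c) x; pose d := chart_at p.
have ox : overlap (val c) (val d) x by apply/overlapP; split=> //; exact: chart_at_dom.
rewrite (bdry_q_chart g ox x0); apply/cone_mulE; first exact: normal_factor_gt0 g _ _ _ ox x0.
apply/mean_bdry_q; first by have /transition_overlap/overlap_cimg := ox.
apply: (H p); exact: (transition_boundary g ox x0).
Qed.

End MeanCurvatureCone.

Arguments Rpos_Hin {R} X S _.

(** * The conformal correction and the retraction *)

Section Retraction.
Variables (R : realType) (X : manifold3 R).
Notation V := 'rV[R]_3.
Hypothesis cX : compact [set: X].
Variables (s : seq X) (K : X -> set V) (chi : X -> X -> R).
Hypothesis pu : partition_unity s K chi.
Variable S : set R.
Hypothesis cS : convex_cone S.
Let Z := set_type (Rpos_Hin X S).
Variables (Y : topologicalType) (dist : Y -> Y -> R) (e : Z -> Y).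
Hypotheses (md : metrizes dist) (ce : closed_embedding e).
Variable z : nat -> Z.
Hypothesis dense_z : forall (t : Z) A, nbhs t A -> exists n, A (z n).

Definition mean_metric : Y -> riemannian X :=
  dugundji_metric md ce dense_z (@continuous_val _ (Rpos_Hin X S)).
Notation F := mean_metric.

(* The convex combination of [bdry_q] of the nearby metrics, as opposed to [bdry_q]
   of their convex combination. *)
Definition mean_q (p : X) (y : Y) (x : V) : R :=
  dugundji e md z (fun t => bdry_q (val t (chart_at p)) x : R^o) y.

Lemma sfam_metric_q (T : topologicalType) (f : T -> riemannian X) (c : atlas X) :
  continuous f -> sfam (cimg (val c)) (fun t => bdry_q (f t c)).
Proof.
move=> cf; apply: (sfam_bdry_q (cimg_ropen (val c))).
- by move=> i j; have /riem_continuousP H := cf; exact: H.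
- by move=> t x; exact: metric_posdef_at.
- by move=> t x; exact: Defs.metric_sym.
Qed.

Lemma sfam_mean_q p : sfam (cimg (val (chart_at p))) (mean_q p).
Proof.
have [sq fq] := sfam_metric_q (chart_at p) (@continuous_val _ (Rpos_Hin X S)).
exact: (dugundji_sfam md ce dense_z (cimg_ropen _) sq fq).
Qed.

Definition corr p y x : R := bdry_q (F y (chart_at p)) x - mean_q p y x.

Lemma sfam_corr p : sfam (cimg (val (chart_at p))) (corr p).
Proof.
apply: (sfamB (cimg_ropen _)); last exact: sfam_mean_q.
exact/sfam_metric_q/dugundji_metric_continuous.
Qed.

(* Near the boundary the conformal factor is 1 + psi + O(psi^2), with psi vanishing
   on the boundary and normal derivative there equal to the excess of [bdry_q] of
   the extended metric over the desired value; [1 + psi + psi^2] is positive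
   without any bound on [psi]. *)
Definition local_psi p y (x : V) : R :=
  chi p (cinv (val (chart_at p)) x) * (x ord0 ord0 * corr p y x).

Definition psi y q := \sum_(p <- s) chart_ext (val (chart_at p)) (local_psi p y) q.

Lemma local_psi0 p y x : cimg (val (chart_at p)) x -> ~ K p x -> local_psi p y x = 0.
Proof.
move=> cx nK; rewrite /local_psi.
have [->|/(pu_supp pu)[_]] := eqVneq (chi p (cinv (val (chart_at p)) x)) 0.
  by rewrite mul0r.
by rewrite cinvK.
Qed.

Lemma sfam_psi_term p (c : atlas X) : sfam (cimg (val c))
  (fun y x => chart_ext (val (chart_at p)) (local_psi p y) (cinv (val c) x)).
Proof.
have op := cimg_ropen (val (chart_at p)).
apply: (sfam_chart_ext (pu_compact pu (p := p)) (@pu_cimg _ _ _ _ _ pu p)); last first.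
  by move=> y x; exact: local_psi0.
apply: (sfamM op); first by apply: (sfam_single _ op); exact: (pu_smooth pu).
apply: (sfamM op); last exact: sfam_corr.
by apply: (sfam_single _ op); exact: smooth_on_coord.
Qed.

Lemma sfam_psi (c : atlas X) : sfam (cimg (val c)) (fun y x => psi y (cinv (val c) x)).
Proof. by apply: (sfam_sum (cimg_ropen (val c))) => p; exact: sfam_psi_term. Qed.

Definition factor y q := 1 + psi y q + psi y q * psi y q.

Lemma factor_gt0 y q : 0 < factor y q.
Proof. by rewrite /factor; nra. Qed.

Lemma sfam_factor (c : atlas X) : sfam (cimg (val c)) (fun y x => factor y (cinv (val c) x)).
Proof.
have oc := cimg_ropen (val c); have sp := sfam_psi c.
apply: (sfamD oc); last exact: sfamM.
by apply: (sfamD oc) => //; exact: sfam_const.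
Qed.

Definition retr y : riemannian X :=
  conformal (F y) (factor_gt0 y) (fun c => (sfam_factor c).1 y).

Lemma retr_continuous : continuous retr.
Proof.
apply/riem_continuousP => c i j; have oc := cimg_ropen (val c).
apply: (sfam_ext oc (F := fun y x => factor y (cinv (val c) x) * F y c x i j)).
  by move=> y x _; rewrite mxE.
apply: (sfamM oc); first exact: sfam_factor.
have cF : continuous F by exact: dugundji_metric_continuous.
by have /riem_continuousP H := cF; exact: H.
Qed.

Lemma retr_embed t : retr (e t) = val t.
Proof.
have FE : F (e t) = val t by exact: dugundji_metric_embed.
(* At a point of [Z] the prescribed value [mean_q] is [bdry_q] of the metric itself, so [corr]
   vanishes. *)
have psi0 q : psi (e t) q = 0.
  rewrite /psi big1 // => p _; rewrite /chart_ext; case: pselect => //= _.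
  by rewrite /local_psi /corr FE /mean_q (dugundji_embed md ce) subrr !mulr0.
apply: riemannian_ext => c x.
change (factor (e t) (cinv (val c) x) *: F (e t) c x = val t c x).
by rewrite /factor psi0 mulr0 !addr0 scale1r FE.
Qed.

Lemma psi_term_boundary p y (c : atlas X) x : cimg (val c) x -> x ord0 ord0 = 0 ->
  chart_ext (val (chart_at p)) (local_psi p y) (cinv (val c) x) = 0.
Proof.
move=> cx x0; rewrite /chart_ext; case: pselect => //= dp.
have ox : overlap (val c) (val (chart_at p)) x by apply/overlapP.
by rewrite /local_psi [cmap _ _ _ _](transition_boundary (F y) ox x0) mul0r mulr0.
Qed.

Lemma psi_boundary y (c : atlas X) x : cimg (val c) x -> x ord0 ord0 = 0 ->
  psi y (cinv (val c) x) = 0.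
Proof. by move=> cx x0; rewrite /psi big1 // => p _; exact: psi_term_boundary. Qed.

(** The factor given by the normal coordinate vanishes on the boundary, so in the product rule only
    its own derivative survives, and that is [normal_factor]. *)
Lemma pd_psi_term p y (c : atlas X) x : cimg (val c) x -> x ord0 ord0 = 0 ->
  pd true ord0 (fun x => chart_ext (val (chart_at p)) (local_psi p y) (cinv (val c) x)) x =
  chi p (cinv (val c) x) * (normal_factor c (chart_at p) x *
    corr p y (transition (val c) (val (chart_at p)) x)).
Proof.
move=> cx x0; have oc := cimg_ropen (val c); pose d := chart_at p.
have [dx|ndx] := pselect (cdom (val d) (cinv (val c) x)); last first.
  have -> : chi p (cinv (val c) x) = 0.
    by apply/eqP/negPn/negP => /(pu_supp pu)[].
  rewrite mul0r -(@pd_cst _ _ oc 0 ord0 x cx); apply: pd_local; first exact: oc.1.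
  have := near_chart_ext0 (pu_compact pu (p := p)) (@pu_cimg _ _ _ _ _ pu p) cx ndx.
  rewrite near_withinE; have := oc.2 _ cx; rewrite /within /=; apply: filterS2.
  by move=> x' h1 h2 hx'; apply: (h2 (h1 hx')) => v; exact: local_psi0.
have ox : overlap (val c) (val d) x by apply/overlapP.
have oA := overlap_ropen (val c) (val d); pose phi := transition (val c) (val d).
rewrite (pd_ext oA (g := fun x => chi p (cinv (val c) x) * (phi x ord0 ord0 * corr p y (phi x)))) //; last first.
  move=> x' /overlapP[cx' dx']; rewrite chart_ext_in // /local_psi cmapK //.
have s1 : smooth_on (overlap (val c) (val d)) (fun x => chi p (cinv (val c) x)).
  by apply: (smooth_on_sub (@overlap_cimg _ _ _ _)); exact: (pu_smooth pu).
have s2 : smooth_on (overlap (val c) (val d)) (fun x => phi x ord0 ord0).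
  exact: transition_smooth.
have s3 : smooth_on (overlap (val c) (val d)) (fun x => corr p y (phi x)).
  apply: (@smooth_on_comp _ _ (cimg (val d)) (corr p y) phi).
  - by move=> v /transition_overlap/overlap_cimg.
  - by move=> j; exact: transition_smooth.
  - by have [] := sfam_corr p.
have p0 : phi x ord0 ord0 = 0 by exact: (transition_boundary (F y) ox x0).
rewrite (pdM oA) //; last exact: smooth_onM.
rewrite p0 mul0r mulr0 add0r (pdM oA) // p0 mul0r addr0.
by rewrite /normal_factor jacE.
Qed.

(** The value for [F y] is split by the partition of unity and rewritten in each chart by
    [bdry_q_chart]; subtracting the normal derivative of [psi] replaces it term by term with
    [mean_q]. *)
Lemma retr_q y (c : atlas X) x : cimg (val c) x -> x ord0 ord0 = 0 ->
  bdry_q (retr y c) x = \sum_(p <- s) chi p (cinv (val c) x) *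
    (normal_factor c (chart_at p) x *
     mean_q p y (transition (val c) (val (chart_at p)) x)).
Proof.
move=> cx x0; have oc := cimg_ropen (val c).
pose w x := factor y (cinv (val c) x).
rewrite (bdry_q_conformal oc (@metric_msmooth _ _ (F y) c) (Defs.metric_sym (F y) c)
  (fun x => @metric_inv00 _ _ (F y) c x) (w := w) _ _ cx x0 (induced_unit (F y) cx)); first last.
- by move=> v cv v0; rewrite /w /factor psi_boundary // mulr0 !addr0.
- by have [sm _] := sfam_factor c; exact: sm.
have sp : smooth_on (cimg (val c)) (fun x => psi y (cinv (val c) x)).
  by have [] := sfam_psi c.
have -> : pd true ord0 w x = pd true ord0 (fun x => psi y (cinv (val c) x)) x.
  rewrite /w /factor (pdD oc) //; last 2 first.
  - by apply: smooth_onD => //; exact: smooth_on_cst.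
  - exact: smooth_onM.
  rewrite (pdD oc) //; last exact: smooth_on_cst.
  (* The square of [psi] has zero derivative where [psi] vanishes, so it does not disturb the
     prescribed normal derivative. *)
  by rewrite (pd_cst oc) // (pdM oc) // psi_boundary // mulr0 mul0r !addr0 add0r.
rewrite (pd_sum oc) // => [|p]; last by have [] := sfam_psi_term p c.
under eq_bigr do rewrite pd_psi_term //.
rewrite -[X in X - _]mul1r -(pu_sum pu (cinv (val c) x)) mulr_suml -sumrB.
apply: eq_bigr => p _.
have [->|/(pu_supp pu)[dx _]] := eqVneq (chi p (cinv (val c) x)) 0.
  by rewrite !mul0r subrr.
have ox : overlap (val c) (val (chart_at p)) x by apply/overlapP.
by rewrite (bdry_q_chart (F y) ox x0) /corr; ring.
Qed.

Lemma retr_mean y p : boundary X p -> S (mean_curvature (retr y) p).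
Proof.
move: p; apply/(bdry_q_cone cS) => c x cx x0; rewrite retr_q //.
have Sq t c' x' : cimg (val c') x' -> x' ord0 ord0 = 0 -> S (bdry_q (val (t : Z) c') x').
  by move: c' x'; apply/(bdry_q_cone cS); have /set_mem[] := valP t.
have [||e1|//] := @cone_sum R S X s (fun p => chi p (cinv (val c) x)) (fun p =>
  normal_factor c (chart_at p) x * mean_q p y (transition (val c) (val (chart_at p)) x)) cS.
- by move=> p; exact: (pu_ge0 pu).
- move=> p /(pu_supp pu)[dx _].
  have ox : overlap (val c) (val (chart_at p)) x by apply/overlapP.
  apply/(cone_mulE cS); first exact: normal_factor_gt0 (F y) _ _ _ ox x0.
  apply: (dugundji_cone md ce) => // t; apply: Sq.
    by have /transition_overlap/overlap_cimg := ox.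
  exact: (transition_boundary (F y) ox x0).
- by have := oner_neq0 R; rewrite -(pu_sum pu (cinv (val c) x)) e1 eqxx.
Qed.

Definition retr_dom : set Y := [set y | forall p, 0 < scalar_curvature (retr y) p].

(** Since [chart_at q] varies erratically with [q], [scalar_chart] first moves the evaluation near
    [p] to the chart at [p], where joint continuity applies with the positive value itself as
    tolerance. Compactness of [X] makes the neighborhood of [y] uniform. *)
Lemma retr_dom_open : open retr_dom.
Proof.
rewrite openE => y Uy; rewrite /interior.
have /compact_near_coveringP/near_covering_withinP/(_ Y (nbhs y)
  (fun y' p => 0 < scalar_curvature (retr y') p)) H := cX.
suff : \forall y' \near y, [set: X] `<=` [set p | 0 < scalar_curvature (retr y') p].
  by apply: filterS => y' Hy' p; exact: Hy'.
apply: H => p _; pose c := chart_at p.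
have sc : sfam (cimg (val c)) (fun y => scalar_coord (retr y c)).
  apply: (sfam_scalar (cimg_ropen (val c))).
    by move=> i j; have /riem_continuousP := retr_continuous; exact.
  by move=> t x; exact: metric_posdef_at.
have cp : cimg (val c) (coord_at p) by exact: coord_at_cimg.
have [_ /famP/(_ [::] y _ cp)[/jcontP/(_ _ (Uy p))[A Ay [d d0 dP]] _]] := sc.
have N : nbhs (cmap (val c) p) [set x | `|x - coord_at p| < d].
  by apply/nbhs_distP; exists d.
have N' := chart_nbhs (chart_at_dom p) N.
exists ([set q | cdom (val c) q /\ `|cmap (val c) q - coord_at p| < d], A) => //.
move=> [q y'] /= [[cq qd] Ay'] _.
rewrite /scalar_curvature (scalar_chart (retr y') (chart_at_dom q) cq).
have hq : hs true (cmap (val c) q).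
  by apply: (cimg_ropen (val c)).1; exact: cmap_fun.
have := dP y' _ Ay' hq qd; rewrite /= ltr_norml => /andP[+ _].
by rewrite /scalar_curvature -/c; lra.
Qed.

Lemma retraction_exists : exists (U : set Y) (r : U -> Z),
  [/\ open U, range e `<=` U, continuous r
    & forall (u : U) (t : Z), val u = e t -> r u = t].
Proof.
have Zr (u : retr_dom) : retr (val u) \in Rpos_Hin X S.
  apply/mem_set; split; first by have /set_mem := valP u.
  exact: retr_mean.
have cr : continuous (fun u : retr_dom => retr (val u)).
  move=> u; apply: (@continuous_comp (set_type retr_dom) Y (riemannian X) (fun u => val u) retr).
    exact: continuous_val.
  exact: retr_continuous.
exists retr_dom, (fun u => exist _ (retr (val u)) (Zr u)); split.
- exact: retr_dom_open.
- move=> _ [t _ <-] p; rewrite retr_embed.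
  by have /set_mem[] := valP t.
- by apply: continuous_to_set_type; exact: cr.
- by move=> u t ut; apply/val_inj => /=; rewrite ut retr_embed.
Qed.

End Retraction.

Lemma Rpos_Hin_ANR (R : realType) (X : manifold3 R) (S : set R) :
  compact [set: X] -> convex_cone S -> Rpos_Hin X S !=set0 ->
  ANR R (set_type (Rpos_Hin X S)).
Proof.
move=> cX cS [g Zg]; have [s [K [chi pu]]] := exists_partition_unity cX.
split; first exact: (metrizable_metrics pu).
move=> Y e /metrizable_dist[dist md] ce.
(* Nonemptiness supplies the default point of the dense sequence. *)
have [z dz] := separable_metrics pu (exist _ g (mem_set Zg) : set_type (Rpos_Hin X S)).
exact: (retraction_exists cX pu cS md ce dz).
Qed.

Theorem theorem1p4 (R : realType) (X : manifold3 R)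
    (X_compact : compact [set: X])
    (X_connected : connected [set: X])
    (X_orientable : orientable X) :
  [/\ metrics_Rpos_Hpos X !=set0 -> ANR R (set_type (metrics_Rpos_Hpos X)),
      metrics_Rpos_Hnneg X !=set0 -> ANR R (set_type (metrics_Rpos_Hnneg X))
    & metrics_Rpos_Hzero X !=set0 -> ANR R (set_type (metrics_Rpos_Hzero X))].
Proof.
split.
- apply: (@Rpos_Hin_ANR R X [set r | 0 < r]) => //.
  by split=> r r' /=; [exact: addr_gt0|exact: mulr_gt0].
- apply: (@Rpos_Hin_ANR R X [set r | 0 <= r]) => //.
  split=> r r' /=; first exact: addr_ge0.
  by move=> /ltW; exact: mulr_ge0.
- apply: (@Rpos_Hin_ANR R X [set r | r = 0]) => //.
  by split=> r r' /= => [-> ->|_ ->]; rewrite ?addr0 ?mulr0.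
Qed.
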